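(* A standard and spherical family of Harish-Chandra modules for $(\mathfrak{g},K)$ is determined up to isomorphism by the value in $\mathcal{O}$ of $TL^2-R^2$. Moreover any element of $\mathcal{O}$ can arise as the value of $TL^2-R^2$ in a standard and spherical family.
   Context: $\mathcal{O}=\mathbb{C}[T]$. $\mathfrak{g}$ is the Lie algebra over $\mathcal{O}$ that is free as an $\mathcal{O}$-module on $L_1,L_2,L_3,R_1,R_2,R_3$, with $[L_i,L_j]=-\varepsilon_{ijk}L_k$, $[R_i,R_j]=\varepsilon_{ijk}TL_k$, $[L_i,R_j]=-\varepsilon_{ijk}R_k$ ($\varepsilon_{ijk}$ the Levi-Civita symbol). (In the paper it is realized by differential operators commuting with $T=-\Delta-2\gamma/r$ on $\mathbb{R}^3\setminus\{0\}$, $\gamma>0$: $L_i$ are the infinitesimal rotations $L_1=x_2\partial_3-x_3\partial_2$ etc., and $R_i$ are the Runge-Lenz operators.) $\mathcal{U}(\mathfrak{g})$ is its enveloping algebra over $\mathcal{O}$; $L^2=\sum L_i^2$, $R^2=\sum R_i^2$. The element $TL^2-R^2$ is central in $\mathcal{U}(\mathfrak{g})$ and $K$-invariant. $K=O(3,\mathbb{C})$ acts on $\mathfrak{g}$ by $\mathcal{O}$-linear Lie algebra automorphisms, $A\cdot L_j=\sum_i(\det(A)^{-1}A)_{ij}L_i$, $A\cdot R_j=\sum_i(\det(A)^{-1}A)_{ij}R_i$; and $\mathfrak{k}=\mathfrak{so}(3,\mathbb{C})$ is embedded in $\mathfrak{g}$ by sending $E_i$ (with $E_iv=e_i\times v$)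 to $-L_i$. An algebraic family of Harish-Chandra modules for $(\mathfrak{g},K)$ is a free $\mathcal{O}$-module $\mathcal{F}$ with a locally finite-dimensional algebraic representation of $K$ by $\mathcal{O}$-module automorphisms, with finitely generated free isotypical summands, and with an $\mathcal{O}$-linear Lie algebra action of $\mathfrak{g}$ that is $K$-equivariant and restricts on $\mathfrak{k}$ to the infinitesimal form of the $K$-action. Isomorphisms are $\mathcal{O}$-linear bijections commuting with $K$ and $\mathfrak{g}$. The $SO(3)$-type representations of $K$ are the irreducible representations $W_\ell$, $\ell=0,1,2,\dots$, in which $-I$ acts trivially; $\dim W_\ell=2\ell+1$. $\mathcal{F}$ is standard and spherical if (i) its $K$-isotypical decomposition consists of the full set of $SO(3)$-type representations, each occurring with multiplicity one (i.e. the $\ell$-isotypical summand is isomorphic to $\mathcal{O}\otimes_{\mathbb{C}}W_\ell$ for each $\ell\ge0$, and there are no other $K$-types), and (ii) $\mathcal{U}(\mathfrak{g})\cdot\mathcal{F}^0=\mathcal{F}$, where $\mathcal{F}^0$ is the space of $K$-fixed elements. On a standard and spherical family, $TL^2-R^2$ acts as multiplication by some $Q\in\mathcal{O}$, called its value on $\mathcal{F}$. *)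

(* Defs.v *)
From HB Require Import structures.
From mathcomp Require Import all_boot all_order all_algebra.
From mathcomp Require Import reals complex mpoly.

Set Implicit Arguments.
Unset Strict Implicit.
Unset Printing Implicit Defensive.

Import GRing.Theory.
Local Open Scope ring_scope.

(* The complex numbers are R[i] for a real number structure R : realType, the  *)
(* base ring O = C[T] is {poly R[i]}, and T is 'X.                            *)

(* Levi-Civita symbol on the index set {0, 1, 2}.                             *)
Definition eps (A : comNzRingType) (i j k : 'I_3) : A :=
  ((i, j, k) \in [:: (0, 1, 2); (1, 2, 0); (2, 0, 1)])%:R
  - ((i, j, k) \in [:: (0, 2, 1); (2, 1, 0); (1, 0, 2)])%:R.

(* An element (a, b) stands for \sum_i a_i L_i + \sum_i b_i R_i.              *)
Definition lie_g (R : realType) : lmodType {poly R[i]} :=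
  ('cV[{poly R[i]}]_3 * 'cV[{poly R[i]}]_3)%type.

Definition gL (R : realType) (i : 'I_3) : lie_g R := (delta_mx i 0, 0).
Definition gR (R : realType) (i : 'I_3) : lie_g R := (0, delta_mx i 0).

(* Bilinear extension of [L_i,L_j] = -eps_ijk L_k, [R_i,R_j] = eps_ijk T L_k, *)
(* [L_i,R_j] = -eps_ijk R_k and hence [R_i,L_j] = -eps_ijk R_k.               *)
Definition bracket (R : realType) (x y : lie_g R) : lie_g R :=
  \sum_(i < 3) \sum_(j < 3) \sum_(k < 3) eps {poly R[i]} i j k *:
    ((- (x.1 i 0 * y.1 j 0) + 'X * (x.2 i 0 * y.2 j 0)) *: gL R k
     + (- (x.1 i 0 * y.2 j 0) - x.2 i 0 * y.1 j 0) *: gR R k).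

(* Formal expressions for the elements of the enveloping algebra over O.      *)
(* The enveloping algebra is their quotient by the O-algebra laws, linearity  *)
(* of EElt and x y - y x = [x, y]; on a g-module the action factors through   *)
(* the quotient, so the expressions suffice to speak of the action.           *)
Inductive env (R : realType) : Type :=
| EScalar of {poly R[i]}
| EElt of lie_g R
| EAdd of env R & env R
| EMul of env R & env R.

Fixpoint env_act (R : realType) (F : lmodType {poly R[i]})
    (act : lie_g R -> F -> F) (u : env R) (v : F) : F :=
  match u with
  | EScalar p => p *: v
  | EElt x => act x v
  | EAdd u1 u2 => env_act act u1 v + env_act act u2 v
  | EMul u1 u2 => env_act act u1 (env_act act u2 v)
  end.

Definition env_sq (R : realType) (x : 'I_3 -> lie_g R) : env R :=
  let sq i := EMul (EElt (x i)) (EElt (x i)) in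
  EAdd (sq 0) (EAdd (sq 1) (sq 2)).

(* T L^2 - R^2 *)
Definition env_TL2_R2 (R : realType) : env R :=
  EAdd (EMul (EScalar 'X) (env_sq (gL R)))
       (EMul (EScalar (-1)) (env_sq (gR R))).

(* K = O(3, C).  K-actions below are functions on all 3 x 3 matrices whose    *)
(* values outside K are irrelevant.                                           *)
Definition inK (R : realType) (A : 'M[R[i]]_3) : Prop := A^T *m A = 1%:M.

Definition adK (R : realType) (A : 'M[R[i]]_3) (x : lie_g R) : lie_g R :=
  let B : 'M[{poly R[i]}]_3 := map_mx polyC ((\det A)^-1 *: A) in
  (B *m x.1, B *m x.2).

(* The basis of so(3, C): E_i v = e_i x v.                                    *)
Definition soE (R : realType) (i : 'I_3) : 'M[R[i]]_3 :=
  \matrix_(k, j) eps R[i] i j k.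

(* Regular functions on K are the restrictions of polynomials in the nine     *)
(* matrix entries (1 / det = det on K).                                       *)
Definition mxeval (R : realType) (p : {mpoly R[i][3 * 3]}) (A : 'M[R[i]]_3)
    : R[i] := p.@[fun k => mxvec A 0 k].

(* Derivative of p at the identity in the direction X.                        *)
Definition mxderiv1 (R : realType) (p : {mpoly R[i][3 * 3]}) (X : 'M[R[i]]_3)
    : R[i] := \sum_(k < 3 * 3) mxeval p^`M(k) 1%:M * mxvec X 0 k.

Definition algebraic_rep (R : realType) (n : nat)
    (rho : 'M[R[i]]_3 -> 'M[R[i]]_n) : Prop :=
  [/\ rho 1%:M = 1%:M,
      forall A B, inK A -> inK B -> rho (A *m B) = rho A *m rho B
    & exists p : 'I_n -> 'I_n -> {mpoly R[i][3 * 3]},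
        forall A, inK A -> forall i j, rho A i j = mxeval (p i j) A].

(* The representation space is 'cV_n; a subspace is the row space of a matrix *)
(* U of row vectors, hence the transpose.                                     *)
Definition irreducible_rep (R : realType) (n : nat)
    (rho : 'M[R[i]]_3 -> 'M[R[i]]_n) : Prop :=
  [/\ algebraic_rep rho, (0 < n)%N
    & forall U : 'M[R[i]]_n, (forall A, inK A -> stablemx U (rho A)^T) ->
        U = 0 \/ row_full U].

(* rho is a matrix form of W_l. *)
Definition is_W (R : realType) (l : nat)
    (rho : 'M[R[i]]_3 -> 'M[R[i]]_(l.*2.+1)) : Prop :=
  irreducible_rep rho /\ rho (- 1%:M) = 1%:M.

Definition intertwiner (R : realType) (F : lmodType {poly R[i]})
    (kact : 'M[R[i]]_3 -> F -> F) (n : nat) (rho : 'M[R[i]]_3 -> 'M[R[i]]_n)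
    (phi : 'cV[R[i]]_n -> F) : Prop :=
  (forall (a : R[i]) w w', phi (a *: w + w') = a%:P *: phi w + phi w') /\
  (forall A, inK A -> forall w, phi (rho A *m w) = kact A (phi w)).

(* Membership in the isotypical summand: the sum of the images of all         *)
(* K-equivariant C-linear maps from the representation space of rho.          *)
Definition isotypical (R : realType) (F : lmodType {poly R[i]})
    (kact : 'M[R[i]]_3 -> F -> F) (n : nat) (rho : 'M[R[i]]_3 -> 'M[R[i]]_n)
    (v : F) : Prop :=
  exists m (phi : 'I_m -> 'cV[R[i]]_n -> F) (w : 'I_m -> 'cV[R[i]]_n),
    (forall i, intertwiner kact rho (phi i)) /\ v = \sum_(i < m) phi i (w i).

Definition free_module (A : comNzRingType) (F : lmodType A) : Prop :=
  exists (I : choiceType) (b : I -> F),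
    (forall v, exists (s : seq I) (c : I -> A), v = \sum_(i <- s) c i *: b i) /\
    (forall (s : seq I) (c : I -> A), uniq s -> \sum_(i <- s) c i *: b i = 0 ->
       forall i, i \in s -> c i = 0).

Definition fg_free_submodule (A : comNzRingType) (F : lmodType A)
    (P : F -> Prop) : Prop :=
  exists m (b : 'I_m -> F),
    (forall v, P v <-> exists c : 'I_m -> A, v = \sum_(i < m) c i *: b i) /\
    (forall c : 'I_m -> A, \sum_(i < m) c i *: b i = 0 -> forall i, c i = 0).

(* Every vector lies in a finite-dimensional (over C) K-stable subspace, the  *)
(* span of the w i, on which K acts by regular functions.                     *)
Definition locally_finite_algebraic (R : realType) (F : lmodType {poly R[i]})
    (kact : 'M[R[i]]_3 -> F -> F) : Prop :=
  forall v : F, exists n (w : 'I_n -> F) (p : 'I_n -> 'I_n -> {mpoly R[i][3 * 3]}),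
    (exists c : 'I_n -> R[i], v = \sum_(i < n) (c i)%:P *: w i) /\
    (forall A, inK A -> forall j,
       kact A (w j) = \sum_(i < n) (mxeval (p i j) A)%:P *: w i).

(* v' is the derivative of the K-action on v along X in so(3, C): for any     *)
(* expression of the orbit map A |-> A v through regular functions on K, v'   *)
(* is obtained by differentiating these functions at the identity.            *)
Definition infinitesimal (R : realType) (F : lmodType {poly R[i]})
    (kact : 'M[R[i]]_3 -> F -> F) (X : 'M[R[i]]_3) (v v' : F) : Prop :=
  forall n (w : 'I_n -> F) (p : 'I_n -> {mpoly R[i][3 * 3]}),
    (forall A, inK A -> kact A v = \sum_(i < n) (mxeval (p i) A)%:P *: w i) ->
    v' = \sum_(i < n) (mxderiv1 (p i) X)%:P *: w i.

Record HC_family (R : realType) := HCFamily {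
  hc_mod :> lmodType {poly R[i]};
  hc_K : 'M[R[i]]_3 -> hc_mod -> hc_mod;
  hc_g : lie_g R -> hc_mod -> hc_mod;
  hc_free : free_module hc_mod;
  hc_K_linear : forall A, inK A -> linear (hc_K A);
  hc_K1 : forall v, hc_K 1%:M v = v;
  hc_KM : forall A B, inK A -> inK B ->
    forall v, hc_K (A *m B) v = hc_K A (hc_K B v);
  hc_K_algebraic : locally_finite_algebraic hc_K;
  hc_isotypical_free : forall n (rho : 'M[R[i]]_3 -> 'M[R[i]]_n),
    irreducible_rep rho -> fg_free_submodule (isotypical hc_K rho);
  hc_g_linearl : forall v, linear (fun x => hc_g x v);
  hc_g_linearr : forall x, linear (hc_g x);
  hc_g_bracket : forall x y v,
    hc_g (bracket x y) v = hc_g x (hc_g y v) - hc_g y (hc_g x v);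
  hc_g_equivariant : forall A, inK A -> forall x v,
    hc_K A (hc_g x v) = hc_g (adK A x) (hc_K A v);
  (* so(3, C) is embedded in g by sending soE i to - L_i *)
  hc_g_infinitesimal : forall i v,
    infinitesimal hc_K (soE R i) v (hc_g (- gL R i) v) }.

Definition hc_iso (R : realType) (F1 F2 : HC_family R) : Prop :=
  exists f : {linear F1 -> F2},
    [/\ bijective f,
        forall A, inK A -> forall v, f (hc_K A v) = hc_K A (f v)
      & forall x v, f (hc_g x v) = hc_g x (f v)].

Definition K_fixed (R : realType) (F : HC_family R) (v : F) : Prop :=
  forall A, inK A -> hc_K A v = v.

(* O (x)_C W is 'cV[O]_n, with K acting through the matrices rho A.           *)
Definition isotypical_iso (R : realType) (F : HC_family R) (n : nat)
    (rho : 'M[R[i]]_3 -> 'M[R[i]]_n) : Prop :=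
  exists f : {linear 'cV[{poly R[i]}]_n -> F},
    [/\ injective f,
        forall v, isotypical (@hc_K R F) rho v <-> exists x, v = f x
      & forall A, inK A -> forall x,
          f (map_mx polyC (rho A) *m x) = hc_K A (f x)].

(* The first two clauses give the isotypical decomposition; directness of the *)
(* sum is automatic by Schur's lemma.                                         *)
Definition standard_spherical (R : realType) (F : HC_family R) : Prop :=
  [/\ forall l (rho : 'M[R[i]]_3 -> 'M[R[i]]_(l.*2.+1)),
        is_W rho -> isotypical_iso F rho,
      forall v : F, exists m (u : 'I_m -> F), v = \sum_(i < m) u i /\
        forall i, exists l (rho : 'M[R[i]]_3 -> 'M[R[i]]_(l.*2.+1)),
          is_W rho /\ isotypical (@hc_K R F) rho (u i)
    & forall v : F, exists m (u : 'I_m -> env R) (v0 : 'I_m -> F),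
        (forall i, K_fixed (v0 i)) /\
        v = \sum_(i < m) env_act (@hc_g R F) (u i) (v0 i)].

Definition TL2_R2_value (R : realType) (F : HC_family R) (Q : {poly R[i]})
    : Prop :=
  forall v : F, env_act (@hc_g R F) (env_TL2_R2 R) v = Q *: v.

(* Main.v *)
(* The model with value Q is the space of even polynomials in p, q over C[T]. *)
(* SL(2) acts by substitutions through its quotient SO(3), the forms of       *)
(* degree 2 l make up the l-isotypical summand, and R_i acts on the forms of  *)
(* degree d by (d + 1)^-1 (x_i + mu_d D_i), where x_i is a quadratic form,    *)
(* D_i the same form in the symbols dq, - dp, and mu_d = Q + T (d^2 / 4 - 1). *)
(* By the theory of highest weights, every irreducible representation of K    *)
(* which is trivial on - I is isomorphic to the one on the forms of some      *)
(* degree 2 l.                                                                *)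
(* Conversely, let v_0 generate the K-fixed vectors of a standard spherical   *)
(* family, let (e, f, h) be the sl(2)-triple of the L_i, (R_+, R_0, R_-) the  *)
(* weight vectors in the span of the R_i, and w_l = R_+^l v_0. The            *)
(* commutation relations and the value Q express R_0 w_l and R_- w_l through  *)
(* w_{l-1}, w_{l+1} and f, with constants that depend only on Q; also         *)
(* f^{2l+1} w_l = 0. Since the f^k w_l with k <= 2 l form a basis of the      *)
(* model, f^k w_l |-> f^k w_l is a well defined g-morphism from the model. It *)
(* is K-equivariant by exponentiation and onto because v_0 generates. Its     *)
(* kernel is stable under h and f e, which are diagonal with joint            *)
(* multiplicity one on the monomials, so a nonzero kernel would give f^k w_l  *)
(* = 0 for some k <= 2 l, hence w_l = 0 and f^{2l} = 0 on the whole family,   *)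
(* which is impossible on its l-isotypical summand.                           *)

Require Import Defs.
From HB Require Import structures.
From mathcomp Require Import all_boot all_order all_algebra.
From mathcomp Require Import boolp reals complex mpoly ring zify.

Set Implicit Arguments.
Unset Strict Implicit.
Unset Printing Implicit Defensive.

Import GRing.Theory Num.Theory.
Local Open Scope ring_scope.

(** * The double cover of SO(3) by SL(2) *)

(** Both halves rest on one explicit family [evenHC Q], and on the fact [standard_iso_even] that
    every standard spherical family of value Q is isomorphic to it.

    The model. Since SL(2) covers SO(3) with kernel +1, -1 ([lift_orth], [Ad_inj]), even binary
    forms over C[T] carry an action of K in which -1 is trivial, and the forms of degree 2l realize
    W_l. A quadratic form can multiply a form of degree d, or be applied to it as a differential
    operator; both operations are equivariant, and R_i acts as a combination of the two with
    coefficients depending on d. The commutator [R_i, R_j] is then a multiple of the derivation by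
    which L_k acts, and it is the required one when mu_(d+2) - mu_d = (d+1) T and the normalization
    is 1/(d+1) ([ladder_comm]). The free constant of this recursion is the value Q
    ([ladder_casimir], [act_homog_value]). Multiplication by quadratic forms reaches every even
    degree from the constants, so the model is generated by its fixed vectors
    ([even_generated_homog]). Its isotypical summands are found with Schur's lemma applied to the
    projections [comp], and highest weight theory shows that every matrix form of W_l is equivalent
    to the one on forms of degree 2l ([rho_highest_weight], [is_W_rhoW]).

    Uniqueness. Let v_0 generate the fixed vectors of a family and w_l = R_+^l v_0. The commutation
    relations express R_0 w_l through f w_(l+1), and the value Q expresses R_- w_(l+1) ([sph_f],
    [sph_m]), so Q fixes the action of g on the span of the f^b w_l. Hence [compare], defined on
    monomials, is a morphism of g-modules ([compare_g]). It is onto because v_0 generates, and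
    K-equivariant because unipotent elements act by exponentials of the g-action ([hc_exp],
    [g_morph_K]). A nonzero kernel would contain a multiple of a monomial ([stable_monomial]); as
    the family is torsion free, this gives f^b w_l = 0 for some b at most 2l. But climbing back with
    e gives w_l = 0, and then f^(2l) = 0 on the whole family, against [standard_lower_neq0].

    Derivatives are handled algebraically: K is generated by -1 and unipotent one-parameter groups,
    along which orbit maps are polynomial, and comparing coefficients replaces calculus
    ([one_param_exp], [curve_uniq]). *)

Lemma sum3E (V : nmodType) (F : 'I_3 -> V) :
  \sum_(i < 3) F i = F 0 + F 1 + F 2.
Proof.
rewrite !big_ord_recr big_ord0 /= add0r.
by congr (F _ + F _ + F _); apply: val_inj.
Qed.

Lemma sum2E (V : nmodType) (F : 'I_2 -> V) : \sum_(i < 2) F i = F 0 + F 1.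
Proof.
by rewrite !big_ord_recr big_ord0 /= add0r; congr (F _ + F _); apply: val_inj.
Qed.

Lemma ord3P (P : 'I_3 -> Prop) : P 0 -> P 1 -> P 2 -> forall i, P i.
Proof.
move=> P0 P1 P2 [[|[|[|//]]] Hi].
- by rewrite (_ : Ordinal Hi = 0) //; apply: val_inj.
- by rewrite (_ : Ordinal Hi = 1) //; apply: val_inj.
- by rewrite (_ : Ordinal Hi = 2) //; apply: val_inj.
Qed.

Lemma ord2P (P : 'I_2 -> Prop) : P 0 -> P 1 -> forall i, P i.
Proof.
move=> P0 P1 [[|[|//]] Hi].
- by rewrite (_ : Ordinal Hi = 0) //; apply: val_inj.
- by rewrite (_ : Ordinal Hi = 1) //; apply: val_inj.
Qed.

(** Small matrices are written entry by entry, so that a matrix identity splits by [congr] into ring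
    identities between entries. *)
Definition mx_of_rows (A : nmodType) m n (s : seq (seq A)) : 'M[A]_(m, n) :=
  \matrix_(i, j) nth 0 (nth [::] s i) j.

Notation mx2 a b c d := (mx_of_rows 2 2 [:: [:: a; b]; [:: c; d]]).
Notation mx3 a b c d e f g h i :=
  (mx_of_rows 3 3 [:: [:: a; b; c]; [:: d; e; f]; [:: g; h; i]]).

Lemma mx3P (A : nmodType) (B : 'M[A]_3) :
  B = mx3 (B 0 0) (B 0 1) (B 0 2) (B 1 0) (B 1 1) (B 1 2) (B 2 0) (B 2 1) (B 2 2).
Proof.
by apply/matrixP => i j; rewrite mxE; elim/ord3P: i; elim/ord3P: j.
Qed.

Lemma mx2P (A : nmodType) (B : 'M[A]_2) :
  B = mx2 (B 0 0) (B 0 1) (B 1 0) (B 1 1).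
Proof.
by apply/matrixP => i j; rewrite mxE; elim/ord2P: i; elim/ord2P: j.
Qed.

Lemma mulmx3 (A : pzSemiRingType) (a b c d e f g h i : A) a' b' c' d' e' f' g' h' i' :
  mx3 a b c d e f g h i *m mx3 a' b' c' d' e' f' g' h' i' =
  mx3 (a * a' + b * d' + c * g') (a * b' + b * e' + c * h') (a * c' + b * f' + c * i')
      (d * a' + e * d' + f * g') (d * b' + e * e' + f * h') (d * c' + e * f' + f * i')
      (g * a' + h * d' + i * g') (g * b' + h * e' + i * h') (g * c' + h * f' + i * i').
Proof.
by apply/matrixP => x y; rewrite !mxE sum3E !mxE; elim/ord3P: x; elim/ord3P: y.
Qed.

Lemma mulmx2 (A : pzSemiRingType) (a b c d a' b' c' d' : A) :
  mx2 a b c d *m mx2 a' b' c' d' =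
  mx2 (a * a' + b * c') (a * b' + b * d') (c * a' + d * c') (c * b' + d * d').
Proof.
by apply/matrixP => x y; rewrite !mxE sum2E !mxE; elim/ord2P: x; elim/ord2P: y.
Qed.

Lemma trmx3 (A : nmodType) (a b c d e f g h i : A) :
  (mx3 a b c d e f g h i)^T = mx3 a d g b e h c f i.
Proof.
by apply/matrixP => x y; rewrite !mxE; elim/ord3P: x; elim/ord3P: y.
Qed.

Lemma addmx3 (A : nmodType) (a b c d e f g h i : A) a' b' c' d' e' f' g' h' i' :
  mx3 a b c d e f g h i + mx3 a' b' c' d' e' f' g' h' i' =
  mx3 (a+a') (b+b') (c+c') (d+d') (e+e') (f+f') (g+g') (h+h') (i+i').
Proof.
by apply/matrixP => x y; rewrite !mxE; elim/ord3P: x; elim/ord3P: y.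
Qed.

Lemma scalemx3 (A : pzRingType) (k a b c d e f g h i : A) :
  k *: mx3 a b c d e f g h i =
  mx3 (k * a) (k * b) (k * c) (k * d) (k * e) (k * f) (k * g) (k * h) (k * i).
Proof.
by apply/matrixP => x y; rewrite !mxE; elim/ord3P: x; elim/ord3P: y.
Qed.

Lemma scalar_mx3 (A : pzSemiRingType) (k : A) : k%:M = mx3 k 0 0 0 k 0 0 0 k.
Proof.
by apply/matrixP => x y; rewrite !mxE; elim/ord3P: x; elim/ord3P: y.
Qed.

Lemma addmx2 (A : nmodType) (a b c d : A) a' b' c' d' :
  mx2 a b c d + mx2 a' b' c' d' = mx2 (a+a') (b+b') (c+c') (d+d').
Proof.
by apply/matrixP => x y; rewrite !mxE; elim/ord2P: x; elim/ord2P: y.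
Qed.

Lemma scalemx2 (A : pzRingType) (k a b c d : A) :
  k *: mx2 a b c d = mx2 (k * a) (k * b) (k * c) (k * d).
Proof.
by apply/matrixP => x y; rewrite !mxE; elim/ord2P: x; elim/ord2P: y.
Qed.

Lemma scalar_mx2 (A : pzSemiRingType) (k : A) : k%:M = mx2 k 0 0 k.
Proof.
by apply/matrixP => x y; rewrite !mxE; elim/ord2P: x; elim/ord2P: y.
Qed.

(* The action of g on the basis p^2, pq, q^2 of binary quadratic forms, where *)
(* g sends the j-th variable to the combination given by its j-th column.     *)
Definition sym2 (A : comPzRingType) (g : 'M[A]_2) : 'M[A]_3 :=
  mx3 (g 0 0 ^+ 2) (g 0 0 * g 0 1) (g 0 1 ^+ 2)
      (2 * g 0 0 * g 1 0) (g 0 0 * g 1 1 + g 0 1 * g 1 0) (2 * g 0 1 * g 1 1)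
      (g 1 0 ^+ 2) (g 1 0 * g 1 1) (g 1 1 ^+ 2).

(** The derivative of [sym2] at the identity, as [sym2D1] shows. *)
Definition dsym2 (A : comPzRingType) (m : 'M[A]_2) : 'M[A]_3 :=
  mx3 (2 * m 0 0) (m 0 1) 0
      (2 * m 1 0) (m 0 0 + m 1 1) (2 * m 0 1)
      0 (m 1 0) (2 * m 1 1).

Lemma sym2M (A : comPzRingType) (g h : 'M[A]_2) : sym2 (g *m h) = sym2 g *m sym2 h.
Proof.
rewrite /sym2 mulmx3 !mxE !sum2E.
by congr (mx_of_rows _ _ [:: [:: _; _; _]; [:: _; _; _]; [:: _; _; _]]); ring.
Qed.

Lemma sym2_1 (A : comPzRingType) : sym2 (1%:M : 'M[A]_2) = 1%:M.
Proof.
rewrite /sym2 !mxE /= scalar_mx3.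
by congr (mx_of_rows _ _ [:: [:: _; _; _]; [:: _; _; _]; [:: _; _; _]]); ring.
Qed.

Lemma sym2N (A : comPzRingType) (g : 'M[A]_2) : sym2 (- g) = sym2 g.
Proof.
rewrite /sym2 !mxE.
by congr (mx_of_rows _ _ [:: [:: _; _; _]; [:: _; _; _]; [:: _; _; _]]); ring.
Qed.

Lemma sym2D1 (A : comPzRingType) (z : A) (m : 'M[A]_2) :
  sym2 (1%:M + z *: m) = 1%:M + z *: dsym2 m + z ^+ 2 *: sym2 m.
Proof.
rewrite /sym2 /dsym2 !mxE /= scalar_mx3 !scalemx3 !addmx3.
by congr (mx_of_rows _ _ [:: [:: _; _; _]; [:: _; _; _]; [:: _; _; _]]); ring.
Qed.

(* The discriminant form b^2 - 4ac on quadratic forms a p^2 + b pq + c q^2.   *)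
Definition discr_mx (A : pzRingType) : 'M[A]_3 := mx3 0 0 (- 2) 0 1 0 (- 2) 0 0.

Lemma det_mx2 (A : comNzRingType) (g : 'M[A]_2) :
  \det g = g 0 0 * g 1 1 - g 0 1 * g 1 0.
Proof.
rewrite (expand_det_row _ 0) sum2E /cofactor !det_mx11 !mxE /=.
rewrite (_ : lift 0 0 = 1 :> 'I_2); last exact: val_inj.
rewrite (_ : lift 1 0 = 0 :> 'I_2); last exact: val_inj.
by rewrite expr0 expr1; ring.
Qed.

(** The discriminant of a quadratic form is invariant under unimodular substitution; this is what
    puts the image of SL(2) in an orthogonal group. *)
Lemma sym2_discr (A : comNzRingType) (g : 'M[A]_2) : \det g = 1 ->
  (sym2 g)^T *m discr_mx A *m sym2 g = discr_mx A.
Proof.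
rewrite det_mx2 => dg; rewrite /sym2 /discr_mx trmx3 !mulmx3.
have {}dg : g 0 0 * g 1 1 = 1 + g 0 1 * g 1 0 by rewrite -dg; ring.
by congr (mx_of_rows _ _ [:: [:: _; _; _]; [:: _; _; _]; [:: _; _; _]]);
  ring: dg.
Qed.

Lemma det_mx3 (A : comNzRingType) (a b c d e f g h i : A) :
  \det (mx3 a b c d e f g h i) =
  a * (e * i - f * h) - b * (d * i - f * g) + c * (d * h - e * g).
Proof.
rewrite (expand_det_row _ 0) sum3E /cofactor !det_mx2 !mxE /=.
by rewrite expr0 expr1; ring.
Qed.

Lemma det_sym2 (A : comNzRingType) (g : 'M[A]_2) : \det (sym2 g) = \det g ^+ 3.
Proof. by rewrite /sym2 det_mx3 det_mx2; ring. Qed.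

Lemma mx3_inj (A : nmodType) (a b c d e f g h i : A) a' b' c' d' e' f' g' h' i' :
  mx3 a b c d e f g h i = mx3 a' b' c' d' e' f' g' h' i' ->
  [/\ a = a', b = b', c = c', d = d' & e = e'] /\
  [/\ f = f', g = g', h = h' & i = i'].
Proof.
move=> /matrixP E.
move: (E 0 0) (E 0 1) (E 0 2) (E 1 0) (E 1 1) (E 1 2) (E 2 0) (E 2 1) (E 2 2).
by rewrite !mxE.
Qed.

(** With determinant 1, the entries of [sym2 g] determine every product of two entries of [g], hence
    [g] up to sign. *)
Lemma sym2_inj (F : idomainType) (g h : 'M[F]_2) :
  (2 : F) != 0 -> \det g = 1 -> \det h = 1 -> sym2 g = sym2 h -> g = h \/ g = - h.
Proof.
move=> nz2; rewrite !det_mx2 => dg dh /mx3_inj[[e00 e01 e02 e10 e11] [e12 e20 e21 e22]].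
have pm x y : x ^+ 2 = y ^+ 2 :> F -> x = y \/ x = - y.
  by move=> /eqP; rewrite eqf_sqr => /orP[] /eqP; auto.
have i2 (x y : F) : 2 * x = 2 * y -> x = y by exact: (mulfI nz2).
have {}e10 : g 0 0 * g 1 0 = h 0 0 * h 1 0 by apply: i2; rewrite !mulrA.
have {}e12 : g 0 1 * g 1 1 = h 0 1 * h 1 1 by apply: i2; rewrite !mulrA.
have ea : g 0 0 * g 1 1 = h 0 0 * h 1 1.
  have dg' : g 0 0 * g 1 1 = 1 + g 0 1 * g 1 0 by rewrite -dg; ring.
  have dh' : h 0 1 * h 1 0 = h 0 0 * h 1 1 - 1 by rewrite -dh; ring.
  apply: i2; transitivity (g 0 0 * g 1 1 + g 0 1 * g 1 0 + 1); first by ring: dg'.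
  by rewrite e11; ring: dh'.
have eb : g 0 1 * g 1 0 = h 0 1 * h 1 0.
  by apply: (addrI (g 0 0 * g 1 1)); rewrite e11 ea.
(* All products of two entries of g and h agree; cancel a nonzero entry. *)
have fin (s : F) x y : x != 0 -> x = s * y -> s ^+ 2 = 1 ->
    (forall u v, x * u = y * v -> u = s * v).
  move=> nx xE s2 u v E; apply: (mulfI nx); rewrite E.
  by rewrite mulrCA xE !mulrA -expr2 s2 mul1r.
have main s : s ^+ 2 = 1 -> (forall i j, g i j = s * h i j) -> g = h \/ g = - h.
  rewrite -[1](expr1n F 2) => /pm[] -> E; [left|right];
    by apply/matrixP => i j; rewrite ?mxE E ?mul1r ?mulN1r.
have [g0|g0] := eqVneq (g 0 0) 0.
  have g10 : g 0 1 != 0.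
    apply/eqP => g1; have := oner_neq0 F; rewrite -dg g0 g1 !mul0r subrr.
    by rewrite eqxx.
  have [E|E] := pm _ _ e02.
    apply: (main 1); first by rewrite expr1n.
    have E' : g 0 1 = 1 * h 0 1 by rewrite mul1r.
    have s2 : (1 : F) ^+ 2 = 1 by rewrite expr1n.
    have H := fin _ _ _ g10 E' s2.
    elim/ord2P; elim/ord2P=> //; apply: H => //; by rewrite mulrC e01 mulrC.
  apply: (main (-1)); first by rewrite sqrrN expr1n.
  have E' : g 0 1 = -1 * h 0 1 by rewrite mulN1r.
  have s2 : (-1 : F) ^+ 2 = 1 by rewrite sqrrN expr1n.
  have H := fin _ _ _ g10 E' s2.
  elim/ord2P; elim/ord2P=> //; apply: H => //; by rewrite mulrC e01 mulrC.
have [E|E] := pm _ _ e00.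
  apply: (main 1); first by rewrite expr1n.
  have E' : g 0 0 = 1 * h 0 0 by rewrite mul1r.
  have s2 : (1 : F) ^+ 2 = 1 by rewrite expr1n.
  have H := fin _ _ _ g0 E' s2.
  by elim/ord2P; elim/ord2P=> //; apply: H.
apply: (main (-1)); first by rewrite sqrrN expr1n.
have E' : g 0 0 = -1 * h 0 0 by rewrite mulN1r.
have s2 : (-1 : F) ^+ 2 = 1 by rewrite sqrrN expr1n.
have H := fin _ _ _ g0 E' s2.
by elim/ord2P; elim/ord2P=> //; apply: H.
Qed.

(** * The covering map from SL(2) onto SO(3) *)

Section SO3.
Variable C : numClosedFieldType.
Implicit Types (g h : 'M[C]_2) (A B : 'M[C]_3).

(* x_1 + i x_2 = p^2, - x_1 + i x_2 = q^2, x_3 = pq: the columns of [quad2vec] *)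
(* are the coordinates of p^2, pq, q^2 on the isotropic triple x_1, x_2, x_3.  *)
Definition quad2vec : 'M[C]_3 := mx3 1 0 (-1) 'i 0 'i 0 1 0.
Definition vec2quad : 'M[C]_3 :=
  mx3 2^-1 (- ('i / 2)) 0 0 0 1 (- 2^-1) (- ('i / 2)) 0.

Lemma quad2vecK : quad2vec *m vec2quad = 1%:M.
Proof.
rewrite /quad2vec /vec2quad mulmx3 scalar_mx3.
congr (mx_of_rows _ _ [:: [:: _; _; _]; [:: _; _; _]; [:: _; _; _]]); try by field.
by transitivity (- 'i ^+ 2 : C); [field | rewrite sqrCi opprK].
Qed.

Lemma vec2quadK : vec2quad *m quad2vec = 1%:M.
Proof. exact: (mulmx1C quad2vecK). Qed.

(** The change of basis carries the standard dot product to the discriminant. *)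
Lemma quad2vec_tr : quad2vec^T *m quad2vec = discr_mx C.
Proof.
rewrite /quad2vec /discr_mx trmx3 mulmx3; have J2 : 'i ^+ 2 = -1 :> C := sqrCi C.
 by congr (mx_of_rows _ _ [:: [:: _; _; _]; [:: _; _; _]; [:: _; _; _]]); ring: J2.
Qed.

Definition Ad g : 'M[C]_3 := quad2vec *m sym2 g *m vec2quad.

Lemma AdM g h : Ad (g *m h) = Ad g *m Ad h.
Proof.
rewrite /Ad sym2M !mulmxA.
by rewrite -[_ *m vec2quad *m quad2vec]mulmxA vec2quadK mulmx1.
Qed.

Lemma Ad1 : Ad 1%:M = 1%:M.
Proof. by rewrite /Ad sym2_1 mulmx1 quad2vecK. Qed.

Lemma AdN g : Ad (- g) = Ad g. Proof. by rewrite /Ad sym2N. Qed.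

Lemma Ad_sym2 g : vec2quad *m Ad g *m quad2vec = sym2 g.
Proof.
by rewrite /Ad !mulmxA vec2quadK mul1mx -!mulmxA vec2quadK mulmx1.
Qed.

Lemma Ad_inj g h : \det g = 1 -> \det h = 1 -> Ad g = Ad h -> g = h \/ g = - h.
Proof.
move=> dg dh E; apply: sym2_inj => //; first by rewrite pnatr_eq0.
by rewrite -!Ad_sym2 E.
Qed.

Lemma Ad_orth g : \det g = 1 -> (Ad g)^T *m Ad g = 1%:M.
Proof.
move=> dg; rewrite /Ad !trmx_mul !mulmxA.
rewrite -[_ *m quad2vec^T *m _]mulmxA quad2vec_tr.
rewrite -(mulmxA vec2quad^T) -(mulmxA vec2quad^T) sym2_discr //.
rewrite -quad2vec_tr mulmxA -trmx_mul quad2vecK trmx1 mul1mx.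
exact: quad2vecK.
Qed.

Lemma det_Ad g : \det g = 1 -> \det (Ad g) = 1.
Proof.
move=> dg; rewrite /Ad !det_mulmx det_sym2 dg expr1n mulr1 -det_mulmx.
by rewrite quad2vecK det1.
Qed.

(** The form a p^2 + b pq + c q^2 has discriminant zero, so it is the square of a linear form x p +
    y q. *)
Lemma isotropic_square (a b c : C) : b ^+ 2 = 4 * a * c ->
  exists x y, [/\ a = x ^+ 2, b = 2 * x * y & c = y ^+ 2].
Proof.
move=> E; have [x0|x0] := eqVneq (sqrtC a) 0.
  have a0 : a = 0 by rewrite -(sqrtCK a) x0 expr0n.
  exists 0, (sqrtC c); rewrite sqrtCK a0 expr0n; split=> //.
  by rewrite mulr0 mul0r; apply/eqP; rewrite -sqrf_eq0 E a0 !(mulr0, mul0r).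
exists (sqrtC a), (b / (2 * sqrtC a)); rewrite sqrtCK; split=> //.
  by rewrite mulrC divfK // mulf_neq0 ?pnatr_eq0.
have a0 : a != 0 by rewrite -(sqrtCK a) expf_neq0.
rewrite exprMn E exprVn exprMn sqrtCK.
by field.
Qed.

(** In the basis p^2, pq, q^2 the rotation sends p^2 to an isotropic form, that is to the square of
    a linear form. Composing with a substitution that undoes this leaves a rotation fixing p^2,
    which is the image of an upper unipotent. *)
Lemma Ad_surj A : A^T *m A = 1%:M -> \det A = 1 ->
  exists2 g, \det g = 1 & Ad g = A.
Proof.
move=> oA dA; pose B := vec2quad *m A *m quad2vec.
have AE : A = quad2vec *m B *m vec2quad.
  by rewrite /B !mulmxA quad2vecK mul1mx -!mulmxA quad2vecK mulmx1.
have dB : \det B = 1.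
  by rewrite /B !det_mulmx dA mulr1 -det_mulmx vec2quadK det1.
have qB : B^T *m discr_mx C *m B = discr_mx C.
  have QB : quad2vec *m B = A *m quad2vec by rewrite /B !mulmxA quad2vecK mul1mx.
  rewrite -quad2vec_tr mulmxA -trmx_mul -mulmxA QB trmx_mul.
  by rewrite mulmxA -(mulmxA _ A^T) oA mulmx1.
suff [g dg gB] : exists2 g, \det g = 1 & sym2 g = B.
  by exists g => //; rewrite /Ad gB -AE.
clearbody B; clear A oA dA AE.
(* The entry (0, 0) of the invariance says that the image of p^2 is isotropic. *)
have c1 (D : 'M[C]_3) : D^T *m discr_mx C *m D = discr_mx C ->
    D 1 0 ^+ 2 = 4 * D 0 0 * D 2 0.
  move=> /matrixP /(_ 0 0); rewrite [D]mx3P trmx3 /discr_mx !mulmx3 !mxE /=.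
  move=> /eqP; rewrite -subr_eq0 => /eqP E; apply/eqP; rewrite -subr_eq0.
  by apply/eqP; rewrite -E; ring.
have [x [y [ex exy ey]]] := isotropic_square (c1 _ qB).
(* [g] sends p to the linear form whose square is the image of p^2. *)
have [g dg gxy] : exists2 g : 'M[C]_2, \det g = 1 & g 0 0 = x /\ g 1 0 = y.
  have [x0|x0] := eqVneq x 0; last first.
    exists (mx2 x 0 y x^-1); last by rewrite !mxE.
    by rewrite det_mx2 !mxE /= divff // mul0r subr0.
  have [y0|y0] := eqVneq y 0; last first.
    exists (mx2 x (- y^-1) y 0); last by rewrite !mxE.
    by rewrite det_mx2 !mxE /= mulr0 mulNr mulVf // sub0r opprK.
  have := oner_neq0 C; rewrite -dB [B]mx3P ex ey exy x0 y0 det_mx3.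
  by rewrite !(mulr0, mul0r, expr0n) /= !(subr0, mulr0, mul0r, subrr, addr0) eqxx.
pose h : 'M[C]_2 := mx2 (g 1 1) (- g 0 1) (- g 1 0) (g 0 0).
have hg : h *m g = 1%:M.
  have dg' : g 0 0 * g 1 1 = 1 + g 0 1 * g 1 0 by rewrite -dg det_mx2; ring.
  rewrite /h [X in _ *m X]mx2P mulmx2 scalar_mx2.
  by congr (mx_of_rows _ _ [:: [:: _; _]; [:: _; _]]); ring: dg'.
have dh : \det h = 1 by rewrite -dg !det_mx2 !mxE /=; ring.
pose D := sym2 h *m B.
have qD : D^T *m discr_mx C *m D = discr_mx C.
  rewrite /D trmx_mul !mulmxA -(mulmxA _ _ (discr_mx C)) -(mulmxA _ _ (sym2 h)).
  by rewrite sym2_discr.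
have dD : \det D = 1 by rewrite /D det_mulmx det_sym2 dh expr1n mul1r.
have D0 : [/\ D 0 0 = 1, D 1 0 = 0 & D 2 0 = 0].
  have -> : D = sym2 h *m B by [].
  move: dg; rewrite det_mx2 !mxE !sum3E !mxE /= ex exy ey.
  case: gxy => <- <- dg.
  split.
  - by transitivity ((g 0 0 * g 1 1 - g 0 1 * g 1 0) ^+ 2);
      [ring | rewrite dg expr1n].
  - by ring.
  - by ring.
suff [s ds sD] : exists2 s, \det s = 1 & sym2 s = D.
  exists (g *m s); first by rewrite det_mulmx dg ds mulr1.
  by rewrite sym2M sD /D mulmxA -sym2M (mulmx1C hg) sym2_1 mul1mx.
(* Now [D] fixes p^2. Invariance of the discriminant and determinant 1 leave a single free entry,
   [a]. *)
clearbody D; move: D0 qD dD; rewrite [D]mx3P !mxE /= => -[-> -> ->].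
move: (D 0 1) (D 0 2) (D 1 1) (D 1 2) (D 2 1) (D 2 2) => a b c d e f.
rewrite /discr_mx trmx3 !mulmx3 det_mx3.
move=> /mx3_inj[[_ E1 E2 _ E3] [E4 _ _ E5]].
have nz2 : (2 : C) != 0 by rewrite pnatr_eq0.
have eq0' (s t : C) : s = t -> t - s = 0 by move=> ->; rewrite subrr.
have e0 : e = 0.
  by apply: (mulfI nz2); rewrite mulr0 -(eq0' _ _ E1); ring.
have f1 : f = 1.
  apply: (mulfI nz2); apply/eqP; rewrite -subr_eq0; apply/eqP.
  by rewrite -(eq0' _ _ E2); ring.
rewrite e0 f1 => dD; have {dD}c1' : c = 1 by rewrite -dD; ring.
have dE : d = 2 * a.
  apply/eqP; rewrite -subr_eq0; apply/eqP; move: E4; rewrite e0 f1 c1' => E4.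
  by rewrite -[LHS]opprK -[RHS]oppr0; congr (- _); rewrite -(eq0' _ _ E4); ring.
have bE : b = a ^+ 2.
  have nz4 : (4 : C) != 0 by rewrite pnatr_eq0.
  apply: (mulfI nz4); apply/eqP; rewrite -subr_eq0; apply/eqP.
  by rewrite -(eq0' _ _ E5) dE f1; ring.
exists (mx2 1 a 0 1); first by rewrite det_mx2 !mxE /=; ring.
rewrite /sym2 !mxE /= dE bE c1'.
by congr (mx_of_rows _ _ [:: [:: _; _; _]; [:: _; _; _]; [:: _; _; _]]); ring.
Qed.

Definition up (z : C) : 'M[C]_2 := mx2 1 z 0 1.
Definition lo (z : C) : 'M[C]_2 := mx2 1 0 z 1.

Lemma det_up z : \det (up z) = 1.
Proof. by rewrite det_mx2 !mxE /=; ring. Qed.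

Lemma det_lo z : \det (lo z) = 1.
Proof. by rewrite det_mx2 !mxE /=; ring. Qed.

(** SL(2) is generated by the elementary unipotents. *)
Lemma SL2_ind (P : 'M[C]_2 -> Prop) :
  (forall z, P (up z)) -> (forall z, P (lo z)) ->
  (forall g h, P g -> P h -> P (g *m h)) -> forall g, \det g = 1 -> P g.
Proof.
move=> Pu Pl PM.
have P1 g : \det g = 1 -> g 1 0 != 0 -> P g.
  rewrite det_mx2 => dg nz.
  have -> : g = up ((g 0 0 - 1) / g 1 0) *m lo (g 1 0) *m up ((g 1 1 - 1) / g 1 0).
    rewrite /up /lo !mulmx2 {1}[g]mx2P.
    have {}dg : g 0 1 = (g 0 0 * g 1 1 - 1) / g 1 0.
      apply: (mulIf nz); rewrite divfK //.
      have dg1 : g 0 0 * g 1 1 = 1 + g 0 1 * g 1 0 by rewrite -dg; ring.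
      by ring: dg1.
    by congr (mx_of_rows _ _ [:: [:: _; _]; [:: _; _]]); rewrite ?dg; field.
  by apply: (PM _ _ _ _) => //; apply: (PM _ _ _ _).
move=> g dg; have [g0|] := eqVneq (g 1 0) 0; last exact: P1.
(* When the lower left entry is 0, adding the first row to the second turns it into [g 0 0], which
   is nonzero. *)
have -> : g = lo (-1) *m (lo 1 *m g).
  rewrite mulmxA mulmx2 (_ : mx2 _ _ _ _ = 1%:M) ?mul1mx // scalar_mx2.
  by congr (mx_of_rows _ _ [:: [:: _; _]; [:: _; _]]); ring.
apply: (PM _ _ _ _) => //; apply: P1; first by rewrite det_mulmx det_lo dg mulr1.
rewrite !mxE sum2E !mxE /= g0 mulr0 addr0 mul1r.
by apply/eqP => g00; move: dg (oner_neq0 C); rewrite det_mx2 g0 g00 mulr0 mul0r subrr => <-;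
  rewrite eqxx.
Qed.

Lemma orth_det A : A^T *m A = 1%:M -> \det A ^+ 2 = 1.
Proof. by move=> /(congr1 determinant); rewrite det_mulmx det_tr det1 -expr2. Qed.

Lemma lift_orth A : A^T *m A = 1%:M ->
  exists2 g, \det g = 1 & Ad g = \det A *: A.
Proof.
move=> oA; have dA := orth_det oA; apply: Ad_surj.
  have -> : (\det A *: A)^T = \det A *: A^T by apply/matrixP => i j; rewrite !mxE.
  by rewrite -scalemxAr -scalemxAl scalerA oA -expr2 dA scale1r.
by rewrite detZ -exprSr (exprM _ 2 2) dA expr1n.
Qed.

(** O(3) is generated by -1 and the images of the elementary unipotents, so equivariance under K
    reduces to polynomial one-parameter groups. *)
Lemma orth_ind (P : 'M[C]_3 -> Prop) :
  P (- 1%:M) -> (forall z, P (Ad (up z))) -> (forall z, P (Ad (lo z))) ->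
  (forall A B, A^T *m A = 1%:M -> B^T *m B = 1%:M -> P A -> P B -> P (A *m B)) ->
  forall A, A^T *m A = 1%:M -> P A.
Proof.
move=> PN Pu Pl PM.
have P1 g : \det g = 1 -> P (Ad g).
  move=> dg; suff [] : P (Ad g) /\ (Ad g)^T *m Ad g = 1%:M by [].
  elim/SL2_ind: dg => {g} [z|z|g h [Pg og] [Ph oh]].
  - by split; [exact: Pu | apply/Ad_orth/det_up].
  - by split; [exact: Pl | apply/Ad_orth/det_lo].
  - rewrite AdM; split; first exact: PM.
    by rewrite trmx_mul mulmxA -(mulmxA _ _ (Ad g)) og mulmx1.
move=> A oA; have [g dg gA] := lift_orth oA.
have : \det A ^+ 2 = 1 ^+ 2 by rewrite expr1n orth_det.
move/eqP; rewrite eqf_sqr => /orP[] /eqP dA.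
  by move: gA; rewrite dA scale1r => <-; exact: P1.
have -> : A = - 1%:M *m Ad g by rewrite gA dA scaleN1r mulmxN mulNmx mul1mx opprK.
apply: PM; [|exact: Ad_orth|exact: PN|exact: P1].
have -> : (- 1%:M : 'M[C]_3)^T = - 1%:M.
  by apply/matrixP => i j; rewrite !mxE eq_sym.
by rewrite mulNmx mulmxN opprK mul1mx.
Qed.

End SO3.

(** * Polynomial one-parameter groups *)

Section Curves.
Variables (C : numFieldType) (V : lmodType C).
Implicit Types (u : nat -> V) (f g : C -> V).

(** For an invariant subspace this extracts weight components from unipotent orbits; for the zero
    subspace it is the uniqueness of coefficients. *)
Lemma subspace_curve_coef (P : V -> Prop) (m : nat) u :
  P 0 -> (forall a x y, P x -> P y -> P (a *: x + y)) ->
  (forall z, P (\sum_(j < m) z ^+ j *: u j)) -> forall j, (j < m)%N -> P (u j).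
Proof.
move=> P0 Plin; elim: m u => [//|m IH] u Pu.
have PZ a x : P x -> P (a *: x) by move=> Px; rewrite -[_ *: _]addr0; exact: Plin.
have PB x y : P x -> P y -> P (x - y).
  by move=> Px Py; rewrite addrC -scaleN1r; apply: Plin.
(* [f (2 z) - 2 ^ m f z] has no term of degree [m]. *)
have Pm j : (j < m)%N -> P (u j).
  move=> jm; have nz : 2 ^+ j - 2 ^+ m != 0 :> C.
    rewrite subr_eq0 -!natrX eqr_nat eqn_exp2l //.
    by apply: contraTneq jm => ->; rewrite ltnn.
  rewrite -[u j]scale1r -(mulVf nz) -scalerA; apply: (PZ _ _).
  move: j jm {nz}; apply: (IH (fun j => (2 ^+ j - 2 ^+ m) *: u j)) => z.
  suff -> : \sum_(j < m) z ^+ j *: ((2 ^+ j - 2 ^+ m) *: u j) =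
    \sum_(j < m.+1) (2 * z) ^+ j *: u j - 2 ^+ m *: \sum_(j < m.+1) z ^+ j *: u j.
    by apply: (PB _ _ _) => //; apply: (PZ _ _).
  rewrite scaler_sumr -sumrB big_ord_recr /= scalerA exprMn subrr addr0.
  apply: eq_bigr => j _; rewrite !scalerA -scalerBl; congr (_ *: _).
  by rewrite exprMn mulrBr mulrC [_ * 2 ^+ m]mulrC.
move=> j; rewrite ltnS leq_eqVlt => /orP[/eqP->|]; last exact: Pm.
have := Pu 1; under eq_bigr do rewrite expr1n scale1r.
rewrite big_ord_recr /= => Ps.
have -> : u m = (\sum_(i < m) u i + u m) - \sum_(i < m) u i by rewrite addrC addKr.
apply: (PB _ _ Ps); elim/big_ind: _ => // [x y Px Py|i _]; last exact: Pm.
by rewrite -[x]scale1r; apply: Plin.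
Qed.

(** [u] is the coefficient sequence of a vector-valued polynomial function; [u 1] plays the role of
    the derivative at 0. *)
Definition curve f u := exists m, (forall j, (m <= j)%N -> u j = 0) /\
  forall z, f z = \sum_(j < m) z ^+ j *: u j.

Lemma curve_widen f u m : (forall j, (m <= j)%N -> u j = 0) ->
  (forall z, f z = \sum_(j < m) z ^+ j *: u j) ->
  forall n, (m <= n)%N -> forall z, f z = \sum_(j < n) z ^+ j *: u j.
Proof.
move=> u0 fE n /subnK <-; elim: (n - m)%N => [//|k IH] z.
by rewrite addSn big_ord_recr /= -IH u0 ?scaler0 ?addr0 // leq_addl.
Qed.

Lemma curve_uniq f u (v : nat -> V) : curve f u -> curve f v -> u =1 v.
Proof.
move=> [m [u0 fu]] [n [v0 fv]] j; pose N := (maxn m n + j.+1)%N.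
have mN : (m <= N)%N by rewrite (leq_trans (leq_maxl m n)) ?leq_addr.
have nN : (n <= N)%N by rewrite (leq_trans (leq_maxr m n)) ?leq_addr.
apply/eqP; rewrite -subr_eq0; apply/eqP.
apply: (@subspace_curve_coef (fun x => x = 0) N (fun j => u j - v j)) => //.
- by move=> a x y -> ->; rewrite scaler0 addr0.
- move=> z; transitivity (f z - f z); last by rewrite subrr.
  rewrite {1}(curve_widen u0 fu mN) (curve_widen v0 fv nN) -sumrB.
  by apply: eq_bigr => i _; rewrite scalerBr.
- by rewrite /N addnS ltnS leq_addl.
Qed.

Lemma curve_ext f g u : f =1 g -> curve f u -> curve g u.
Proof. by move=> fg [m [u0 E]]; exists m; split=> // z; rewrite -fg. Qed.

Lemma curveD f g u (v : nat -> V) : curve f u -> curve g v ->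
  curve (fun z => f z + g z) (fun j => u j + v j).
Proof.
move=> [m [u0 fu]] [n [v0 gv]]; exists (maxn m n); split=> [j|z].
  by rewrite geq_max => /andP[mj nj]; rewrite u0 // v0 // addr0.
rewrite (curve_widen u0 fu (leq_maxl m n)) (curve_widen v0 gv (leq_maxr m n)).
by rewrite -big_split; apply: eq_bigr => i _; rewrite scalerDr.
Qed.

Lemma curve_sum (I : Type) (r : seq I) (F : I -> C -> V) (U : I -> nat -> V) :
  (forall i, curve (F i) (U i)) ->
  curve (fun z => \sum_(i <- r) F i z) (fun j => \sum_(i <- r) U i j).
Proof.
move=> H; elim: r => [|i r IH].
  by exists 0; split=> [j _|z]; rewrite big_nil ?big_ord0.
have [m [u0 E]] := curveD (H i) IH; exists m; split=> [j mj|z].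
  by rewrite big_cons u0.
by rewrite big_cons E; apply: eq_bigr => j _; rewrite big_cons.
Qed.

Lemma curve_poly (q : {poly C}) (x : V) :
  curve (fun z => q.[z] *: x) (fun j => q`_j *: x).
Proof.
exists (size q); split=> [j sj|z]; first by rewrite nth_default ?scale0r.
rewrite horner_coef scaler_suml; apply: eq_bigr => i _.
by rewrite scalerA mulrC.
Qed.

(** A polynomial one-parameter group is the exponential of its derivative at 0: its coefficients
    satisfy the recursion (j+1) u_(j+1) = X u_j. *)
Lemma one_param_exp (T : C -> V -> V) (X : {linear V -> V}) :
  (forall v, T 0 v = v) -> (forall z w v, T (z + w) v = T w (T z v)) ->
  (forall v, exists2 u, curve (T^~ v) u & u 1 = X v) ->
  forall v, curve (T^~ v) (fun j => (j`!%:R)^-1 *: iter j X v).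
Proof.
move=> T0 TD TX v; have [u cu u1] := TX v; have [m [u0 Tu]] := cu.
(* Both sides are coefficients of the curve z |-> X (T z v), which is also the linear term in x of T
   (z + x) v, found by expanding (z + x)^i. *)
have uS j : u j.+1 *+ j.+1 = X (u j).
  apply: (@curve_uniq (fun z => \sum_(i < m) z ^+ i *: X (u i))
    (fun j => u j.+1 *+ j.+1) (fun j => X (u j))).
    have [u' cu' u1'] := TX (T 0 v).
    exists m; split=> [i mi|z]; first by rewrite u0 ?mul0rn // ltnW.
    have [w cw w1] := TX (T z v).
    transitivity (w 1).
      by rewrite w1 Tu linear_sum; apply: eq_bigr => i _; rewrite linearZ.
    have H : curve (T^~ (T z v)) (fun j => \sum_(i < m) ((z%:P + 'X) ^+ i)`_j *: u i).
      apply: curve_ext (curve_sum _ (fun i : 'I_m => curve_poly ((z%:P + 'X) ^+ i) (u i))).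
      move=> x /=; rewrite -TD Tu; apply: eq_bigr => i _.
      by rewrite horner_exp hornerD hornerC hornerX.
    rewrite -(curve_uniq H cw).
    rewrite (eq_bigr (fun i : 'I_m => (z ^+ i.-1 *+ i) *: u i)); last first.
        move=> i _; congr (_ *: _); rewrite exprDn.
        case: i => [[|i] Hi] /=; first by rewrite big_ord_recl big_ord0 /=
           expr0 mul1r bin0 addr0 coef1 mulr0n.
        rewrite coef_sum 2!big_ord_recl /= big1 ?addr0; last first.
          by move=> k _; rewrite coefMn -rmorphXn coefCM coefXn /= mulr0 mul0rn.
        by rewrite !coefMn -!rmorphXn !coefCM !coefXn /= mulr0 mul0rn add0r mulr1 subn1 bin1.
      case: (m) u0 => [|n] u0; first by rewrite !big_ord0.
      rewrite big_ord_recl /= mulr0n scale0r add0r big_ord_recr /= u0 ?mul0rn ?scaler0 ?addr0 //.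
      by apply: eq_bigr => i _; rewrite /bump /= add1n -scalerMnl scalerMnr.
  by exists m; split=> // i mi; rewrite u0 // linear0.
have uE j : u j = (j`!%:R)^-1 *: iter j X v.
  elim: j => [|j IH] /=.
    rewrite fact0 invr1 scale1r -[RHS]T0 Tu.
    case: (m) u0 => [|n] u0; first by rewrite big_ord0 u0.
    rewrite big_ord_recl expr0 scale1r big1 ?addr0 // => i _.
    by rewrite expr0n scale0r.
  apply: (@scalerI _ _ j.+1%:R); first by rewrite pnatr_eq0.
  rewrite scaler_nat uS IH linearZ scalerA factS natrM invfM mulrA divff ?mul1r //.
  by rewrite pnatr_eq0.
exists m; split=> [j mj|z]; first by rewrite -uE u0.
by rewrite Tu; apply: eq_bigr => j _; rewrite uE.
Qed.

End Curves.

Lemma mpoly_alg_ind (A : comNzRingType) n (P : {mpoly A[n]} -> Prop) :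
  (forall c, P c%:MP) -> (forall i, P 'X_i) ->
  (forall f g, P f -> P g -> P (f + g)) ->
  (forall f g, P f -> P g -> P (f * g)) -> forall f, P f.
Proof.
move=> PC PX PD PM; have PXm (m : 'X_{1..n}) : P 'X_[m].
  rewrite mpolyXE_id; elim/big_ind: _ => // [|i _]; first by rewrite -mpolyC1.
  elim: (m i) => [|k IH]; first by rewrite expr0 -mpolyC1.
  by rewrite exprS; exact: PM.
elim/mpolyind => [|c m p _ _ Pp]; first by rewrite -mpolyC0.
by apply: PD => //; rewrite -mul_mpolyC; exact: PM.
Qed.

(** * The chain rule along polynomial curves *)

Section ChainRule.
Variables (A B : comNzRingType) (iota : {rmorphism A -> B}) (n : nat).
Variable h : 'I_n -> {poly B}.
Implicit Type f : {mpoly A[n]}.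

Definition mpoly_curve f : {poly B} := mmap (polyC \o iota) h f.

Lemma mpoly_curve_horner f z :
  (mpoly_curve f).[z] = mmap iota (fun k => (h k).[z]) f.
Proof.
rewrite /mpoly_curve; elim/mpoly_alg_ind: f => [c|i|f g IHf IHg|f g IHf IHg].
- by rewrite !mmapC /= hornerC.
- by rewrite !mmapX !mmap1U.
- by rewrite !rmorphD /= hornerD IHf IHg.
- by rewrite !rmorphM /= hornerM IHf IHg.
Qed.

Lemma mpoly_curve_coef1 f : (mpoly_curve f)`_1 =
  \sum_k mmap iota (fun k => (h k).[0]) f^`M(k) * (h k)`_1.
Proof.
elim/mpoly_alg_ind: f => [c|i|f g IHf IHg|f g IHf IHg].
- rewrite /mpoly_curve mmapC coefC /= big1 // => k _.
  by rewrite mderivC rmorph0 mul0r.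
- rewrite /mpoly_curve mmapX mmap1U (bigD1 i) //= big1 => [|k ki].
    rewrite mderivX mnm1E eqxx scale1r addr0 (_ : U_(i) - U_(i) = 0)%MM.
      by rewrite mmapX mmap11 mul1r.
    by apply/mnmP => k; rewrite mnmBE mnm0E subnn.
  by rewrite mderivX mnm1E eq_sym (negbTE ki) scale0r rmorph0 mul0r.
- rewrite /mpoly_curve rmorphD coefD -!/(mpoly_curve _) IHf IHg -big_split /=.
  by apply: eq_bigr => k _; rewrite mderivD rmorphD mulrDl.
- have E : mpoly_curve (f * g) = mpoly_curve f * mpoly_curve g by exact: rmorphM.
  rewrite E coefM 2!big_ord_recl big_ord0 /= addr0 /bump /= IHf IHg.
  rewrite -!horner_coef0 !mpoly_curve_horner mulr_sumr mulr_suml -big_split /=.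
  apply: eq_bigr => k _; rewrite mderivM rmorphD !rmorphM /=.
  by ring.
Qed.

End ChainRule.

(** * Nilpotents of sl(2) and their one-parameter groups *)

Section OneParameter.
Variable C : numClosedFieldType.
Implicit Types m : 'M[C]_2.

(** Trace and determinant zero mean m^2 = 0 for a 2 x 2 matrix, so that 1 + z m is the exponential
    of z m. *)
Definition nil2 m := \tr m = 0 /\ \det m = 0.

Lemma nil2_sqr m : nil2 m -> m *m m = 0.
Proof.
case; rewrite /mxtrace sum2E det_mx2 => t d.
have {}t : m 1 1 = - m 0 0 by apply/eqP; rewrite eq_sym eqr_oppLR -addr_eq0 t.
have {}d : m 0 1 * m 1 0 = - m 0 0 ^+ 2.
  by rewrite -[LHS]addr0 -d t; ring.
rewrite [m]mx2P mulmx2 t (_ : 0 = mx2 0 0 0 0); last first.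
  by apply/matrixP => i j; rewrite !mxE; elim/ord2P: i; elim/ord2P: j.
by congr (mx_of_rows _ _ [:: [:: _; _]; [:: _; _]]); ring: d.
Qed.

Lemma nil2_det m z : nil2 m -> \det (1%:M + z *: m) = 1.
Proof.
case; rewrite /mxtrace sum2E !det_mx2 !mxE /= !mulr0n !mulr1n => t d.
have d' : m 0 0 * m 1 1 = m 0 1 * m 1 0 by apply/eqP; rewrite -subr_eq0 d.
have t' : m 1 1 = - m 0 0 by apply/eqP; rewrite eq_sym eqr_oppLR -addr_eq0 t.
transitivity (1 + z * (m 0 0 + m 1 1) + z ^+ 2 * (m 0 0 * m 1 1 - m 0 1 * m 1 0)).
  by ring.
by rewrite t d !mulr0 !addr0.
Qed.

Lemma nil2_conj g h m : h *m g = 1%:M -> nil2 m -> nil2 (g *m m *m h).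
Proof.
move=> hg [tm dm]; split; first by rewrite mxtrace_mulC mulmxA hg mul1mx.
by rewrite !det_mulmx dm mulr0 mul0r.
Qed.

Definition E12 : 'M[C]_2 := mx2 0 1 0 0.
Definition E21 : 'M[C]_2 := mx2 0 0 1 0.
(** A third nilpotent, which together with [E12] and [E21] spans sl(2); linear statements need only
    be checked on nilpotents. *)
Definition N22 : 'M[C]_2 := mx2 1 (-1) 1 (-1).

Lemma nil2_E12 : nil2 E12.
Proof. by split; rewrite ?/mxtrace ?sum2E ?det_mx2 !mxE /=; ring. Qed.
Lemma nil2_E21 : nil2 E21.
Proof. by split; rewrite ?/mxtrace ?sum2E ?det_mx2 !mxE /=; ring. Qed.
Lemma nil2_N22 : nil2 N22.
Proof. by split; rewrite ?/mxtrace ?sum2E ?det_mx2 !mxE /=; ring. Qed.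

Lemma sl2_nil_span m : \tr m = 0 ->
  m = m 0 0 *: N22 + (m 0 1 + m 0 0) *: E12 + (m 1 0 - m 0 0) *: E21.
Proof.
rewrite /mxtrace sum2E => t.
have {}t : m 1 1 = - m 0 0 by apply/eqP; rewrite eq_sym eqr_oppLR -addr_eq0 t.
rewrite /N22 /E12 /E21 !scalemx2 !addmx2 {1}[m]mx2P t.
by congr (mx_of_rows _ _ [:: [:: _; _]; [:: _; _]]); ring.
Qed.

Lemma sl2_nil_ind (P : 'M[C]_2 -> Prop) :
  (forall m, nil2 m -> P m) ->
  (forall a m m', P m -> P m' -> P (a *: m + m')) ->
  forall m, \tr m = 0 -> P m.
Proof.
move=> Pn Plin m tm.
have P0 : P 0 by apply: Pn; split; rewrite ?mxtrace0 // det_mx2 !mxE mulr0 subrr.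
rewrite (sl2_nil_span tm) -addrA; apply: (Plin _ _ _ _) => //.
  exact: (Pn _ nil2_N22).
apply: (Plin _ _ _ _); first exact: (Pn _ nil2_E12).
by rewrite -[_ *: E21]addr0; apply: (Plin _ _ _ _) => //; exact: (Pn _ nil2_E21).
Qed.

(** For nilpotent [m], the image in SO(3) of exp(z m); it is quadratic in z by [one_parE], with
    linear coefficient [tang m]. *)
Definition one_par m z : 'M[C]_3 := Ad (1%:M + z *: m).

Lemma one_par0 m : one_par m 0 = 1%:M.
Proof. by rewrite /one_par scale0r addr0 Ad1. Qed.

Lemma one_parD m z w : nil2 m -> one_par m (z + w) = one_par m w *m one_par m z.
Proof.
move=> /nil2_sqr mm; rewrite /one_par -AdM mulmxDl !mulmxDr !mul1mx !mulmx1.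
by rewrite -scalemxAl -scalemxAr mm !scaler0 addr0 scalerDl addrA.
Qed.

Lemma one_par_orth m z : nil2 m -> (one_par m z)^T *m one_par m z = 1%:M.
Proof. by move=> nm; apply/Ad_orth/nil2_det. Qed.

Lemma one_par_up z : one_par E12 z = Ad (up z).
Proof.
rewrite /one_par /E12 /up scalar_mx2 scalemx2 addmx2; congr (Ad (mx_of_rows _ _ _)).
by congr [:: [:: _; _]; [:: _; _]]; ring.
Qed.

Lemma one_par_lo z : one_par E21 z = Ad (lo z).
Proof.
rewrite /one_par /E21 /lo scalar_mx2 scalemx2 addmx2; congr (Ad (mx_of_rows _ _ _)).
by congr [:: [:: _; _]; [:: _; _]]; ring.
Qed.

Definition tang m : 'M[C]_3 := quad2vec C *m dsym2 m *m vec2quad C.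

Lemma dsym2_linear : linear (@dsym2 C).
Proof.
move=> a m m'; rewrite /dsym2 scalemx3 addmx3 !mxE.
by congr (mx_of_rows _ _ [:: [:: _; _; _]; [:: _; _; _]; [:: _; _; _]]); ring.
Qed.

Lemma tang_linear : linear tang.
Proof.
move=> a m m'; rewrite /tang dsym2_linear mulmxDr mulmxDl.
by rewrite -scalemxAr -scalemxAl.
Qed.

Lemma one_parE m z : one_par m z = 1%:M + z *: tang m + z ^+ 2 *: Ad m.
Proof.
rewrite /one_par /Ad sym2D1 !mulmxDr !mulmxDl mulmx1 quad2vecK.
by rewrite -!scalemxAr -!scalemxAl.
Qed.

(* The elements of sl(2) whose image in so(3) is the standard basis.          *)
Definition sl2E (i : 'I_3) : 'M[C]_2 :=
  nth 0 [:: mx2 0 ('i / 2) ('i / 2) 0; mx2 0 2^-1 (- 2^-1) 0;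
            mx2 (- ('i / 2)) 0 0 ('i / 2)] i.

Lemma tr_sl2E i : \tr (sl2E i) = 0.
Proof. by rewrite /mxtrace sum2E; elim/ord3P: i; rewrite /= !mxE /=; ring. Qed.

Definition sl2_coord m (i : 'I_3) : C :=
  nth 0 [:: - 'i * (m 0 1 + m 1 0); m 0 1 - m 1 0; 'i * (m 0 0 - m 1 1)] i.

Lemma sl2_coordK m : \tr m = 0 -> m = \sum_i sl2_coord m i *: sl2E i.
Proof.
rewrite /mxtrace sum2E => t.
have {}t : m 1 1 = - m 0 0 by apply/eqP; rewrite eq_sym eqr_oppLR -addr_eq0 t.
rewrite sum3E /sl2_coord /sl2E /= !scalemx2 !addmx2 {1}[m]mx2P t.
have J2 : 'i * 'i = -1 :> C by rewrite -expr2 sqrCi.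
congr (mx_of_rows _ _ [:: [:: _; _]; [:: _; _]]).
- transitivity (- ('i * 'i) * m 0 0); [by rewrite J2; ring | by field].
- transitivity ((- ('i * 'i) * (m 0 1 + m 1 0) + (m 0 1 - m 1 0)) / 2);
    [by rewrite J2; field | by field].
- transitivity ((- ('i * 'i) * (m 0 1 + m 1 0) - (m 0 1 - m 1 0)) / 2);
    [by rewrite J2; field | by field].
- transitivity (('i * 'i) * m 0 0); [by rewrite J2; ring | by field].
Qed.

End OneParameter.

Section Derivative.
Variable R : realType.
Local Notation C := R[i].
Implicit Types (p : {mpoly C[3 * 3]}) (m : 'M[C]_2).

Lemma tang_sl2E i : tang (sl2E C i) = soE R i.
Proof.
have J2 : 'i * 'i = -1 :> C by rewrite -expr2 sqrCi.
rewrite [RHS]mx3P /tang /dsym2 /quad2vec /vec2quad !mulmx3.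
elim/ord3P: i; rewrite /soE /sl2E /= !mxE /eps /=;
congr (mx_of_rows _ _ [:: [:: _; _; _]; [:: _; _; _]; [:: _; _; _]]); first
  [by field | by ring: J2 |
   by transitivity (- ('i * 'i) : C); [by field | rewrite J2; ring] |
   by transitivity (('i * 'i) : C); [by field | rewrite J2; ring] |
   by transitivity ((1 - ('i * 'i)) / 2 : C); [by field | rewrite J2; field] |
   by transitivity ((- 1 + ('i * 'i)) / 2 : C); [by field | rewrite J2; field] ].
Qed.

End Derivative.

Section Derivative.
Variable R : realType.
Local Notation C := R[i].
Implicit Types (p : {mpoly C[3 * 3]}) (m : 'M[C]_2).

Lemma mxvec_quadratic (n1 n2 : nat) (X Y Z : 'M[C]_(n1, n2)) z k :
  mxvec (X + z *: Y + z ^+ 2 *: Z) 0 k =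
  mxvec X 0 k + mxvec Y 0 k * z + mxvec Z 0 k * z ^+ 2.
Proof.
case/mxvec_indexP: k => i j; rewrite !mxvecE !mxE.
by rewrite [z * _]mulrC [z ^+ 2 * _]mulrC.
Qed.

Lemma mxderiv1_linear p : linear_for *%R (mxderiv1 p).
Proof.
move=> a X Y; rewrite /mxderiv1 mulr_sumr -big_split; apply: eq_bigr => k _.
by rewrite linearP !mxE mulrDr mulrCA.
Qed.

(** Links the two notions of derivative: the formal one at the identity used by [infinitesimal], and
    the linear coefficient of a polynomial curve. *)
Lemma mxeval_one_par p m : exists q : {poly C},
  (forall z, q.[z] = mxeval p (one_par m z)) /\ q`_1 = mxderiv1 p (tang m).
Proof.
pose h (k : 'I_(3 * 3)) : {poly C} := (mxvec 1%:M 0 k)%:P +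
  mxvec (tang m) 0 k *: 'X + mxvec (Ad m) 0 k *: 'X^2.
have hE z k : (h k).[z] = mxvec (one_par m z) 0 k.
  by rewrite /h one_parE mxvec_quadratic !hornerD hornerC !hornerZ hornerX hornerXn.
have c1 (a b c : C) : (a%:P + b *: 'X + c *: 'X^2)`_1 = b.
  by rewrite !coefD !coefZ coefC coefX coefXn /= add0r mulr1 mulr0 addr0.
exists (mpoly_curve idfun h p); split=> [z|].
  by rewrite mpoly_curve_horner /mxeval; apply: meval_eq => k; exact: hE.
rewrite mpoly_curve_coef1; apply: eq_bigr => k _; congr (_ * _).
  by rewrite /mxeval; apply: meval_eq => j; rewrite hE one_par0.
exact: c1.
Qed.

(** The same module with scalars restricted to the constants, the field over which curves are
    taken. *)
Definition cmod (F : lmodType {poly C}) : Type := F.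

End Derivative.

Section ComplexScalars.
Variables (R : realType) (F : lmodType {poly R[i]}).

HB.instance Definition _ := GRing.Zmodule.on (cmod F).

Let cscale (a : R[i]) (v : cmod F) : cmod F := a%:P *: (v : F).

Let cscaleA a b v : cscale a (cscale b v) = cscale (a * b) v.
Proof. by rewrite /cscale scalerA polyCM. Qed.

Let cscale1 : left_id 1 cscale.
Proof. by move=> v; rewrite /cscale polyC1 scale1r. Qed.

Let cscaleDr : right_distributive cscale +%R.
Proof. by move=> a u v; rewrite /cscale scalerDr. Qed.

Let cscaleDl v : {morph cscale^~ v : a b / a + b}.
Proof. by move=> a b; rewrite /cscale polyCD scalerDl. Qed.

HB.instance Definition _ := GRing.Zmodule_isLmodule.Build R[i] (cmod F)
  cscaleA cscale1 cscaleDr cscaleDl.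

Lemma cscaleE (a : R[i]) (v : cmod F) : a *: v = (a%:P *: (v : F)) :> F.
Proof. by []. Qed.

End ComplexScalars.

(** * Exponentiating the g-action of a family *)

Section HCExp.
Variables (R : realType) (F : HC_family R).
Local Notation C := R[i].
Implicit Types (m : 'M[C]_2) (v : F).

(* The element of g acting as the infinitesimal generator of [one_par m]:     *)
(* E_i in so(3) corresponds to - L_i.                                         *)
Definition gk m : lie_g R := \sum_i (sl2_coord m i)%:P *: - gL R i.

Lemma hc_gk m v :
  hc_g (gk m) v = \sum_i (sl2_coord m i)%:P *: hc_g (- gL R i) v.
Proof.
pose X : {linear lie_g R -> F} := HB.pack (fun x => hc_g x v)
  (GRing.isLinear.Build _ _ _ _ (fun x => hc_g x v) (hc_g_linearl v)).
rewrite (_ : hc_g _ v = X (gk m)) // linear_sum.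
by apply: eq_bigr => i _; rewrite linearZ.
Qed.

Lemma gk_infinitesimal m v n (w : 'I_n -> F) (p : 'I_n -> {mpoly C[3 * 3]}) :
  \tr m = 0 ->
  (forall A, inK A -> hc_K A v = \sum_(i < n) (mxeval (p i) A)%:P *: w i) ->
  hc_g (gk m) v = \sum_(i < n) (mxderiv1 (p i) (tang m))%:P *: w i.
Proof.
move=> tm E; rewrite hc_gk.
under eq_bigr => k _ do rewrite (hc_g_infinitesimal k E) scaler_sumr.
rewrite exchange_big /=; apply: eq_bigr => i _.
under eq_bigr => k _ do rewrite scalerA -polyCM.
rewrite -scaler_suml -rmorph_sum /=; congr (_%:P *: _).
pose X : {linear 'M[C]_3 -> C^o} := HB.pack (mxderiv1 (p i))
  (GRing.isLinear.Build _ _ _ _ (mxderiv1 (p i) : _ -> C^o) (@mxderiv1_linear _ (p i))).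
pose Y : {linear 'M[C]_2 -> 'M[C]_3} := HB.pack (@tang C)
  (GRing.isLinear.Build _ _ _ _ (@tang C) (@tang_linear C)).
transitivity (X (Y m)); last by [].
rewrite {2}(sl2_coordK tm) !linear_sum; apply: eq_bigr => k _.
by rewrite !linearZ /= tang_sl2E.
Qed.

(** Local finiteness makes the orbit map polynomial along [one_par m], and the infinitesimal
    condition gives its derivative, so [one_param_exp] applies. *)
Lemma hc_exp m v : nil2 m ->
  curve (fun z => hc_K (one_par m z) v : cmod F)
    (fun j => (j`!%:R)^-1 *: (iter j (hc_g (gk m)) v : cmod F)).
Proof.
move=> nm.
have Xlin : linear (hc_g (gk m) : cmod F -> cmod F).
  by move=> a x y; rewrite hc_g_linearr.
pose X : {linear cmod F -> cmod F} := HB.pack (hc_g (gk m) : cmod F -> cmod F)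
  (GRing.isLinear.Build _ _ _ _ (hc_g (gk m) : cmod F -> cmod F) Xlin).
apply: (@one_param_exp _ (cmod F) (fun z => hc_K (one_par m z) : cmod F -> cmod F) X).
- by move=> x; rewrite one_par0 hc_K1.
- by move=> z w x; rewrite one_parD // hc_KM //; exact: one_par_orth.
move=> x; have [n [w [p [[c xE] wE]]]] := hc_K_algebraic x.
(* The coefficients of the orbit map of [x] on the spanning vectors [w i]. *)
pose q (i : 'I_n) := \sum_(j < n) (c j)%:MP * p i j.
have xq A : inK A -> hc_K A x = \sum_(i < n) (mxeval (q i) A)%:P *: w i.
  move=> kA; pose KA : {linear F -> F} := HB.pack (hc_K A : F -> F)
    (GRing.isLinear.Build _ _ _ _ (hc_K A : F -> F) (@hc_K_linear _ _ _ kA)).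
  rewrite (_ : hc_K A x = KA x) // xE linear_sum.
  under eq_bigr => j _ do rewrite linearZ /= wE // scaler_sumr.
  rewrite exchange_big /=; apply: eq_bigr => i _.
  have -> : mxeval (q i) A = \sum_j c j * mxeval (p i j) A.
    rewrite /mxeval /q raddf_sum; apply: eq_bigr => j _.
    by rewrite [LHS]mevalM mevalC.
  rewrite raddf_sum scaler_suml; apply: eq_bigr => j _.
  by rewrite scalerA -polyCM.
pose Q i := sval (boolp.cid (mxeval_one_par (q i) m)).
have QE i z : (Q i).[z] = mxeval (q i) (one_par m z).
  by rewrite /Q; case: boolp.cid => s [].
have Q1 i : (Q i)`_1 = mxderiv1 (q i) (tang m).
  by rewrite /Q; case: boolp.cid => s [].
exists (fun j => \sum_(i < n) (Q i)`_j *: (w i : cmod F)); last first.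
  rewrite [RHS](@gk_infinitesimal _ _ _ w q) //; last by case: nm.
  by apply: eq_bigr => i _; rewrite Q1.
apply: curve_ext (curve_sum _ (fun i => curve_poly (Q i) (w i : cmod F))) => z /=.
rewrite xq; last exact: one_par_orth.
by apply: eq_bigr => i _; rewrite QE.
Qed.

End HCExp.

(** * Binary forms *)

Section Substitution.
Variable A : comNzRingType.
Local Notation S := {mpoly A[2]}.
Implicit Types (g h m : 'M[A]_2) (f : S).

Definition linform m (j : 'I_2) : S := \sum_i m i j *: 'X_i.

Definition subst g : S -> S := mmap (@mpolyC 2 A) (linform g).

HB.instance Definition _ g := GRing.RMorphism.copy (subst g)
  (mmap (@mpolyC 2 A) (linform g)).

Lemma substC g c : subst g c%:MP = c%:MP. Proof. exact: mmapC. Qed.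

Lemma substZ g c f : subst g (c *: f) = c *: subst g f.
Proof. by rewrite -mul_mpolyC rmorphM /= substC mul_mpolyC. Qed.

Lemma subst_linear g : linear (subst g).
Proof. by move=> a f f'; rewrite rmorphD /= substZ. Qed.

Lemma substX g j : subst g 'X_j = linform g j.
Proof. by rewrite /subst mmapX mmap1U. Qed.

Lemma subst_linform g h j : subst g (linform h j) = linform (g *m h) j.
Proof.
rewrite /linform rmorph_sum /=.
under eq_bigr => i _ do rewrite substZ substX scaler_sumr.
rewrite exchange_big /=; apply: eq_bigr => k _; rewrite mxE scaler_suml.
by apply: eq_bigr => i _; rewrite scalerA mulrC.
Qed.

Lemma substM g h f : subst g (subst h f) = subst (g *m h) f.
Proof.
elim/mpoly_alg_ind: f => [c|i|f f' IH IH'|f f' IH IH'].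
- by rewrite !substC.
- by rewrite !substX subst_linform.
- by rewrite !rmorphD /= IH IH'.
- by rewrite !rmorphM /= IH IH'.
Qed.

Lemma linform1 j : linform 1%:M j = 'X_j.
Proof.
rewrite /linform (bigD1 j) //= mxE eqxx scale1r big1 ?addr0 // => i ij.
by rewrite mxE (negbTE ij) scale0r.
Qed.

Lemma subst1 f : subst 1%:M f = f.
Proof.
elim/mpoly_alg_ind: f => [c|i|f f' IH IH'|f f' IH IH'].
- by rewrite !substC.
- by rewrite !substX linform1.
- by rewrite !rmorphD /= IH IH'.
- by rewrite !rmorphM /= IH IH'.
Qed.

Lemma mderivXU (i j : 'I_2) : ('X_j : S)^`M(i) = (i == j)%:R%:MP.
Proof.
rewrite mderivX mnm1E eq_sym; case: eqP => [->|_]; last by rewrite scale0r mpolyC0.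
rewrite scale1r (_ : U_(j) - U_(j) = 0)%MM ?mpolyX0 //.
by apply/mnmP => k; rewrite mnmBE mnm0E subnn.
Qed.

Lemma subst_mderiv g f i : (subst g f)^`M(i) = \sum_j g i j *: subst g f^`M(j).
Proof.
elim/mpoly_alg_ind: f => [c|k|f f' IH IH'|f f' IH IH'].
- rewrite substC mderivC big1 // => j _.
  by rewrite mderivC rmorph0 scaler0.
- rewrite substX /linform raddf_sum /= (bigD1 i) //= big1 => [|l li]; last first.
    by rewrite mderivZ mderivXU eq_sym (negbTE li) mpolyC0 scaler0.
  rewrite addr0 mderivZ mderivXU eqxx (bigD1 k) //= big1 => [|l lk]; last first.
    by rewrite mderivXU (negbTE lk) substC mpolyC0 scaler0.
  by rewrite mderivXU eqxx addr0 substC.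
- rewrite !rmorphD mderivD IH IH' -big_split /=; apply: eq_bigr => j _.
  by rewrite mderivD rmorphD scalerDr.
- rewrite rmorphM /= mderivM IH IH' mulr_suml mulr_sumr -big_split /=.
  apply: eq_bigr => j _.
  by rewrite mderivM rmorphD !rmorphM /= scalerDr -scalerAl -scalerAr.
Qed.

(** The infinitesimal form of [subst]: the derivation which acts by [m] on linear forms. *)
Definition der m f : S := \sum_j linform m j * f^`M(j).

Lemma der_linear m : linear (der m).
Proof.
move=> a f f'; rewrite /der scaler_sumr -big_split; apply: eq_bigr => j _.
by rewrite linearP mulrDr -scalerAr.
Qed.

Lemma linform_linear j a m m' :
  linform (a *: m + m') j = a *: linform m j + linform m' j.
Proof.
rewrite /linform scaler_sumr -big_split; apply: eq_bigr => i _.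
by rewrite !mxE scalerDl scalerA.
Qed.

Lemma der_linearl f : linear (der^~ f).
Proof.
move=> a m m'; rewrite /der scaler_sumr -big_split; apply: eq_bigr => j _.
by rewrite linform_linear mulrDl -scalerAl.
Qed.

Lemma der_mul m f f' : der m (f * f') = der m f * f' + f * der m f'.
Proof.
rewrite /der mulr_suml mulr_sumr -big_split; apply: eq_bigr => j _ /=.
by rewrite mderivM mulrDr !mulrA [f * linform _ _]mulrC.
Qed.

Lemma derC m c : der m c%:MP = 0.
Proof. by rewrite /der big1 // => j _; rewrite mderivC mulr0. Qed.

Lemma derX m j : der m 'X_j = linform m j.
Proof.
rewrite /der (bigD1 j) //= mderivXU eqxx mpolyC1 mulr1 big1 ?addr0 // => i ij.
by rewrite mderivXU (negbTE ij) mpolyC0 mulr0.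
Qed.

(** The hypothesis says that m' is the conjugate of m by g, without inverting g. *)
Lemma subst_der g m m' f : m' *m g = g *m m ->
  subst g (der m f) = der m' (subst g f).
Proof.
move=> E; rewrite /der rmorph_sum /=.
under eq_bigr => j _ do rewrite rmorphM /= subst_linform -E.
under [RHS]eq_bigr => i _ do rewrite subst_mderiv mulr_sumr.
rewrite exchange_big /=; apply: eq_bigr => j _; rewrite /linform mulr_suml.
under [RHS]eq_bigr => i _ do rewrite -scalerAr mulr_suml scaler_sumr.
rewrite exchange_big /=; apply: eq_bigr => k _; rewrite mxE scaler_suml mulr_suml.
by apply: eq_bigr => i _; rewrite -!scalerAl scalerA mulrC.
Qed.

Lemma der_linform m m' j : der m (linform m' j) = linform (m *m m') j.
Proof.
rewrite {1}/linform.
pose D : {linear S -> S} := HB.pack (der m) (GRing.isLinear.Build _ _ _ _ (der m) (der_linear m)).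
rewrite (_ : der m _ = D (\sum_i m' i j *: 'X_i)) // linear_sum.
under eq_bigr => i _ do rewrite linearZ /= derX /linform scaler_sumr.
rewrite exchange_big /=; apply: eq_bigr => k _; rewrite mxE scaler_suml.
by apply: eq_bigr => i _; rewrite scalerA mulrC.
Qed.

Lemma der_comm m m' f :
  der m (der m' f) - der m' (der m f) = der (m *m m' - m' *m m) f.
Proof.
have DD a (x y : S) : der a (x + y) = der a x + der a y.
  by rewrite -[x]scale1r der_linear !scale1r.
elim/mpoly_alg_ind: f => [c|k|f f' IH IH'|f f' IH IH'].
- by rewrite !derC subrr.
- rewrite !derX !der_linform.
  have -> : m *m m' - m' *m m = -1 *: (m' *m m) + m *m m' by rewrite scaleN1r addrC.
  by rewrite linform_linear scaleN1r addrC.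
- by rewrite !DD // -IH -IH'; ring.
- rewrite !der_mul !DD // !der_mul -[der (_ - _) f]IH -[der (_ - _) f']IH'.
  by ring.
Qed.

Lemma subst_one_par m f : exists q : {poly S},
  [/\ forall z, q.[z%:MP] = subst (1%:M + z *: m) f, q`_0 = f & q`_1 = der m f].
Proof.
pose h (j : 'I_2) : {poly S} := ('X_j)%:P + linform m j *: 'X.
have hE z j : (h j).[z%:MP] = linform (1%:M + z *: m) j.
  rewrite /h hornerD hornerC hornerZ hornerX addrC [_ + z *: m]addrC linform_linear.
  by rewrite linform1 mulrC mul_mpolyC.
have h0 j : (h j).[0] = 'X_j by rewrite -mpolyC0 hE scale0r addr0 linform1.
have m0 f' : mmap (@mpolyC 2 A) (fun k => (h k).[0]) f' = f'.
  rewrite -[RHS]subst1; congr (_ : S); apply: eq_bigr => l _.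
  by congr (_ * _); apply: mmap1_eq => k; rewrite h0 linform1.
exists (mpoly_curve (@mpolyC 2 A) h f); split=> [z||].
- rewrite mpoly_curve_horner; apply: eq_bigr => l _; congr (_ * _).
  by apply: mmap1_eq => k; rewrite hE.
- by rewrite -horner_coef0 mpoly_curve_horner m0.
- rewrite mpoly_curve_coef1; apply: eq_bigr => k _.
  by rewrite m0 mulrC /h coefD coefC coefZ coefX add0r mulr1.
Qed.

End Substitution.

Section LinearExtension.
Variables (A : comNzRingType) (n : nat) (V : lmodType A).
Variable phi : 'X_{1..n} -> V.
Implicit Types f : {mpoly A[n]}.

Definition linext f : V := \sum_(m <- msupp f) f@_m *: phi m.

Lemma linext_widen f (s : seq 'X_{1..n}) : uniq s -> {subset msupp f <= s} ->
  linext f = \sum_(m <- s) f@_m *: phi m.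
Proof.
move=> us fs; rewrite (bigID (fun m => m \in msupp f)) /= [X in _ + X]big1 ?addr0.
  rewrite -big_filter; apply: perm_big; apply: uniq_perm; rewrite ?msupp_uniq ?filter_uniq //.
  move=> m; rewrite mem_filter; case E: (m \in msupp f) => //=.
  by rewrite (fs _ E).
by move=> m /memN_msupp_eq0 ->; rewrite scale0r.
Qed.

Lemma linext_linear : linear linext.
Proof.
move=> a f g; pose s := undup (msupp (a *: f + g) ++ msupp f ++ msupp g).
have us : uniq s by rewrite undup_uniq.
rewrite !(@linext_widen _ s us); last 3 first.
- by move=> m mf; rewrite mem_undup !mem_cat mf !orbT.
- by move=> m mf; rewrite mem_undup !mem_cat mf !orbT.
- by move=> m mf; rewrite mem_undup !mem_cat mf.
rewrite scaler_sumr -big_split; apply: eq_bigr => m _.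
by rewrite mcoeffD mcoeffZ scalerDl scalerA.
Qed.

Lemma linextX m : linext 'X_[m] = phi m.
Proof. by rewrite /linext msuppX big_seq1 mcoeffX eqxx scale1r. Qed.

End LinearExtension.

(* [ring] does not treat the variables 'X_0, 'X_1 as atoms.                   *)
Ltac gring := move: (@mpolyX 2 _ (mnm1 (0 : 'I_2))) (@mpolyX 2 _ (mnm1 (1 : 'I_2))) => ? ?; ring.

(** * Quadratic forms as multiplication and differential operators *)

Section Quadrics.
Variable A : comNzRingType.
Local Notation S := {mpoly A[2]}.
Implicit Types (g m : 'M[A]_2) (f : S) (w : 'cV[A]_3).

(* [qmul w] is the quadratic form w_0 p^2 + w_1 pq + w_2 q^2; [qdiff w] is the *)
(* same quadratic form in the symbols dq, - dp, which transform like p, q.    *)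
Definition qmul w : S := (w 0 0)%:MP * 'X_0 ^+ 2 + (w 1 0)%:MP * ('X_0 * 'X_1)
  + (w 2 0)%:MP * 'X_1 ^+ 2.

Definition qdiff w f : S := (w 0 0)%:MP * f^`M(1)^`M(1)
  - (w 1 0)%:MP * f^`M(0)^`M(1) + (w 2 0)%:MP * f^`M(0)^`M(0).

Lemma qmul_linear a w w' : qmul (a *: w + w') = a *: qmul w + qmul w'.
Proof. by rewrite /qmul !mxE !mpolyCD !mpolyCM -mul_mpolyC; gring. Qed.

Lemma qdiff_linearl a w w' f : qdiff (a *: w + w') f = a *: qdiff w f + qdiff w' f.
Proof. by rewrite /qdiff !mxE !mpolyCD !mpolyCM -mul_mpolyC; ring. Qed.

Lemma qdiff_linear w : linear (qdiff w).
Proof. by move=> a f f'; rewrite /qdiff !(mderivD, mderivZ) -!mul_mpolyC; ring. Qed.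

Lemma linform2E m j : linform m j = (m 0 j)%:MP * 'X_0 + (m 1 j)%:MP * 'X_1.
Proof. by rewrite /linform sum2E !mul_mpolyC. Qed.

Lemma der2E m f : der m f = ((m 0 0)%:MP * 'X_0 + (m 1 0)%:MP * 'X_1) * f^`M(0)
  + ((m 0 1)%:MP * 'X_0 + (m 1 1)%:MP * 'X_1) * f^`M(1).
Proof. by rewrite /der sum2E !linform2E. Qed.

Lemma subst_mderiv2 g f i : (subst g f)^`M(i) =
  (g i 0)%:MP * subst g f^`M(0) + (g i 1)%:MP * subst g f^`M(1).
Proof. by rewrite subst_mderiv sum2E !mul_mpolyC. Qed.

Lemma mulmx_sum3 (X : 'M[A]_3) w i :
  (X *m w) i 0 = X i 0 * w 0 0 + X i 1 * w 1 0 + X i 2 * w 2 0.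
Proof. by rewrite mxE sum3E. Qed.

Lemma mderiv01 f : f^`M(1)^`M(0) = f^`M(0)^`M(1).
Proof. exact: mderiv_comm. Qed.

Lemma subst_qmul g w : subst g (qmul w) = qmul (sym2 g *m w).
Proof.
rewrite /qmul !rmorphD !rmorphM ?rmorphXn /= !substC !substX !linform2E.
rewrite !mulmx_sum3 /sym2 !mxE /= !mpolyCD !mpolyCM !mpolyCD !mpolyCM.
by rewrite ?rmorphXn /= ?mpolyC_nat ?mpolyC1; gring.
Qed.

Lemma subst_qdiff g w f : \det g = 1 ->
  subst g (qdiff w f) = qdiff (sym2 g *m w) (subst g f).
Proof.
rewrite det_mx2 => /(congr1 (@mpolyC 2 A)); rewrite mpolyCB !mpolyCM mpolyC1 => dg.
have {}dg : (g 0 0)%:MP * (g 1 1)%:MP = 1 + (g 0 1)%:MP * (g 1 0)%:MP :> S.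
  by rewrite -dg; ring.
rewrite /qdiff !rmorphD rmorphN !rmorphM /= !substC.
rewrite ![(subst g f)^`M(_)]subst_mderiv2 !mderivD !mderiv_mulC !subst_mderiv2.
rewrite !mderiv01 !mulmx_sum3 /sym2 !mxE /= !mpolyCD !mpolyCM !mpolyCD !mpolyCM.
by rewrite ?rmorphXn /= ?mpolyC_nat ?mpolyC1; ring: dg.
Qed.

Lemma der_qmul m w : der m (qmul w) = qmul (dsym2 m *m w).
Proof.
rewrite der2E /qmul !mderivD !mderiv_mulC !mderivM !mderivXU /=.
rewrite !mulmx_sum3 /dsym2 !mxE /= !(mpolyCD, mpolyCM, mpolyC0, mpolyC1).
by rewrite ?mpolyC_nat ?mpolyC1; gring.
Qed.

Lemma der_qdiff m w f : \tr m = 0 ->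
  der m (qdiff w f) = qdiff (dsym2 m *m w) f + qdiff w (der m f).
Proof.
rewrite /mxtrace sum2E => /eqP; rewrite addrC addr_eq0 => /eqP t.
rewrite [der m f]der2E der2E t /qdiff.
rewrite !(mderivD, mderivN, mderiv_mulC, mderivM, mderivC, mderivXU) /=.
rewrite !mulmx_sum3 /dsym2 !mxE /= t !mderiv01.
rewrite !(mpolyCD, mpolyCM, mpolyCN, mpolyC0, mpolyC1, mpolyC_nat).
by gring.
Qed.

(** The image of the wedge of two quadratic forms under the isomorphism of the exterior square of
    Sym^2 with sl(2); the commutators below are multiples of it. *)
Definition qwedge w w' : 'M[A]_2 :=
  let c := w 0 0 * w' 2 0 - w 2 0 * w' 0 0 in
  mx2 (- c) (w 0 0 * w' 1 0 - w 1 0 * w' 0 0)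
      (- (w 1 0 * w' 2 0 - w 2 0 * w' 1 0)) c.

Lemma homog_mderiv d f i : f \is d.-homog -> f^`M(i) \is d.-1.-homog.
Proof.
move=> /dhomogP hf; apply/dhomogP => m; rewrite mcoeff_msupp mcoeff_mderiv => nz.
have /hf : (m + U_(i))%MM \in msupp f.
  by rewrite mcoeff_msupp; apply: contraNneq nz => ->; rewrite mul0rn.
by rewrite /= mdegD mdeg1 addn1 /= => <-.
Qed.

Lemma euler d f : f \is d.-homog ->
  'X_0 * f^`M(0) + 'X_1 * f^`M(1) = d%:R * f.
Proof.
move=> /dhomogP hf; rewrite [f]mpolyE !raddf_sum /= !mulr_sumr -big_split /=.
apply: eq_big_seq => m /hf dm; rewrite !mderivZ !mderivX.
have XU (i : 'I_2) : (m i)%:R *: ('X_i * 'X_[m - U_(i)]) = (m i)%:R *: 'X_[A, m].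
  case E: (m i) => [|k]; first by rewrite !scale0r.
  rewrite -mpolyXD addmC submK //.
  apply/mnm_lepP => j; rewrite mnm1E; case: eqP => // <-.
  by rewrite E.
rewrite -!scalerAr !XU -scalerDr -scalerDl -natrD.
by rewrite -[in RHS]dm /= mdegE sum2E scaler_nat mulr_natl.
Qed.

(* Differentiating Euler's identity avoids the truncated degree of f^`M(i).   *)
Lemma euler_mderiv d f : f \is d.-homog ->
  'X_0 * f^`M(0)^`M(0) + 'X_1 * f^`M(0)^`M(1) = (d%:R - 1) * f^`M(0) /\
  'X_0 * f^`M(0)^`M(1) + 'X_1 * f^`M(1)^`M(1) = (d%:R - 1) * f^`M(1).
Proof.
move=> /euler E; split.
  have := congr1 (mderiv 0) E.
  rewrite -mpolyC_nat mderivD !mderivM mderivC !mderivXU /= mpolyC0 mpolyC1.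
  rewrite mderiv01 mpolyC_nat !mul0r !add0r => {}E; apply: (addrI f^`M(0)).
  by transitivity (d%:R * f^`M(0)); [rewrite -E; gring | ring].
have := congr1 (mderiv 1) E.
rewrite -mpolyC_nat mderivD !mderivM mderivC !mderivXU /= mpolyC0 mpolyC1.
rewrite mpolyC_nat !mul0r !add0r => {}E; apply: (addrI f^`M(1)).
by transitivity (d%:R * f^`M(1)); [rewrite -E; gring | ring].
Qed.

End Quadrics.

(** * Ladder operators and their commutators *)

Section Ladder.
Variable A : comNzRingType.
Local Notation S := {mpoly A[2]}.
Implicit Types (g m : 'M[A]_2) (f : S) (w : 'cV[A]_3) (d : nat).

Lemma euler_rules d f : f \is d.-homog ->
  'X_0 * f^`M(0)^`M(0) = (d%:R - 1) * f^`M(0) - 'X_1 * f^`M(0)^`M(1) /\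
  'X_1 * f^`M(1)^`M(1) = (d%:R - 1) * f^`M(1) - 'X_0 * f^`M(0)^`M(1).
Proof. by move=> /euler_mderiv[<- <-]; split; gring. Qed.

Lemma mderiv2M (i j : 'I_2) (f f' : S) : (f * f')^`M(i)^`M(j) =
  f^`M(i)^`M(j) * f' + f^`M(i) * f'^`M(j) + f^`M(j) * f'^`M(i) + f * f'^`M(i)^`M(j).
Proof. by rewrite !mderivM mderivD !mderivM; ring. Qed.

Lemma qmul_mderiv0 w : (qmul w)^`M(0) =
  (w 0 0 *+ 2)%:MP * 'X_0 + (w 1 0)%:MP * 'X_1.
Proof.
rewrite /qmul !mderivD !mderiv_mulC !mderivM !mderivXU /=.
by rewrite mpolyC0 mpolyC1 mpolyCMn; gring.
Qed.

Lemma qmul_mderiv1 w : (qmul w)^`M(1) =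
  (w 1 0)%:MP * 'X_0 + (w 2 0 *+ 2)%:MP * 'X_1.
Proof.
rewrite /qmul !mderivD !mderiv_mulC !mderivM !mderivXU /=.
by rewrite mpolyC0 mpolyC1 mpolyCMn; gring.
Qed.

Lemma mderiv_lin i (a b : A) : (a%:MP * 'X_0 + b%:MP * 'X_1 : S)^`M(i) =
  (if i == 0 then a else b)%:MP.
Proof.
rewrite mderivD !mderiv_mulC !mderivXU.
by elim/ord2P: i; rewrite /= mpolyC0 mpolyC1 mulr1 mulr0 ?addr0 ?add0r.
Qed.

(** After antisymmetrization in [w] and [w'], Euler's relations reduce the second order terms to
    first order ones. The factor d + 3 here and d - 1 in [qmul_qdiff_comm] are one more than the
    neighbouring degrees d + 2 and d - 2, which is why the normalization 1/(d+1) absorbs them. *)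
Lemma qdiff_qmul_comm d f w w' : f \is d.-homog ->
  qdiff w (qmul w' * f) - qdiff w' (qmul w * f) =
  (d%:R + 3) * der (qwedge w w') f.
Proof.
move=> /euler_rules[]; rewrite der2E /qdiff !mderiv2M.
rewrite !qmul_mderiv0 !qmul_mderiv1 !mderiv_lin /qmul /qwedge !mxE /=.
rewrite !(mpolyCD, mpolyCM, mpolyCN, mpolyCMn).
move: (@mpolyX 2 _ (mnm1 (0 : 'I_2))) (@mpolyX 2 _ (mnm1 (1 : 'I_2))) => p q.
move: (d%:R : S) (f^`M(0)) (f^`M(1)) (f^`M(0)^`M(0)) (f^`M(1)^`M(1)) (f^`M(0)^`M(1)).
move: (w 0 0)%:MP (w 1 0)%:MP (w 2 0)%:MP (w' 0 0)%:MP (w' 1 0)%:MP (w' 2 0)%:MP.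
move=> r s t r' s' t' D x y a b c E1 E2; rewrite -[RHS]addr0.
(* The two sides differ by a combination of the two Euler relations, which is zero. *)
have <- : ((t * r' - t' * r) * p + (t * s' - t' * s) * q) *
    (p * a - ((D - 1) * x - q * c)) +
  ((r * s' - r' * s) * p + (r * t' - r' * t) * q) *
    (q * b - ((D - 1) * y - p * c)) = 0.
  by rewrite E1 E2 !subrr !mulr0 addr0.
by ring.
Qed.

Lemma qmul_qdiff_comm d f w w' : f \is d.-homog ->
  qmul w * qdiff w' f - qmul w' * qdiff w f =
  - (d%:R - 1) * der (qwedge w w') f.
Proof.
move=> /euler_rules[]; rewrite der2E /qdiff /qmul /qwedge !mxE /=.
rewrite !(mpolyCD, mpolyCM, mpolyCN, mpolyC0, mpolyC1).
move: (@mpolyX 2 _ (mnm1 (0 : 'I_2))) (@mpolyX 2 _ (mnm1 (1 : 'I_2))) => p q.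
move: (d%:R : S) (f^`M(0)) (f^`M(1)) (f^`M(0)^`M(0)) (f^`M(1)^`M(1)) (f^`M(0)^`M(1)).
move: (w 0 0)%:MP (w 1 0)%:MP (w 2 0)%:MP (w' 0 0)%:MP (w' 1 0)%:MP (w' 2 0)%:MP.
move=> r s t r' s' t' D x y a b c E1 E2; rewrite -[RHS]addr0.
have <- : ((r * t' - r' * t) * p + (s * t' - s' * t) * q) *
    (p * a - ((D - 1) * x - q * c)) +
  ((r' * s - r * s') * p + (r' * t - r * t') * q) *
    (q * b - ((D - 1) * y - p * c)) = 0.
  by rewrite E1 E2 !subrr !mulr0 addr0.
by ring.
Qed.

Lemma qdiff_mderiv f w i : (qdiff w f)^`M(i) = qdiff w f^`M(i).
Proof.
rewrite /qdiff !(mderivD, mderivN, mderiv_mulC).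
by elim/ord2P: i; rewrite !mderiv01.
Qed.

Lemma qdiff_comm f w w' : qdiff w (qdiff w' f) = qdiff w' (qdiff w f).
Proof.
rewrite {1}/qdiff [in RHS]/qdiff !qdiff_mderiv /qdiff !mderiv01.
move: (w 0 0)%:MP (w 1 0)%:MP (w 2 0)%:MP (w' 0 0)%:MP (w' 1 0)%:MP (w' 2 0)%:MP.
move: (f^`M(0)^`M(0)^`M(0)^`M(0)) (f^`M(0)^`M(0)^`M(0)^`M(1))
  (f^`M(0)^`M(0)^`M(1)^`M(1)) (f^`M(0)^`M(1)^`M(1)^`M(1)) (f^`M(1)^`M(1)^`M(1)^`M(1)).
by move=> *; ring.
Qed.

Lemma homog_qmul d f w : f \is d.-homog -> qmul w * f \is d.+2.-homog.
Proof.
move=> hf; rewrite -[d.+2]/(2 + d)%N; apply: dhomogM => //.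
have X1 (i : 'I_2) : ('X_i : S) \is 1.-homog by rewrite dhomogX /= mdeg1.
rewrite /qmul !mul_mpolyC !rpredD ?rpredZ //.
- exact: (dhomogMn 2 (X1 0)).
- exact: (dhomogM (X1 0) (X1 1)).
- exact: (dhomogMn 2 (X1 1)).
Qed.

Lemma homog_qdiff d f w : f \is d.-homog -> qdiff w f \is d.-2.-homog.
Proof.
move=> hf; rewrite /qdiff !mul_mpolyC; apply: rpredD; first apply: rpredB;
  by apply: rpredZ; do 2!apply: homog_mderiv.
Qed.

Lemma homog_linform m j : linform m j \is 1.-homog.
Proof. by apply: rpred_sum => i _; rewrite rpredZ // dhomogX /= mdeg1. Qed.

Lemma homog_subst d g f : f \is d.-homog -> subst g f \is d.-homog.
Proof.
move=> /dhomogP hf; rewrite [f]mpolyE rmorph_sum /= big_seq.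
apply: rpred_sum => m /hf /= <-; rewrite substZ rpredZ //.
rewrite mpolyXE_id rmorph_prod /= mdegE.
elim/big_ind2: _ => [|x a y b hx hy|i _]; first exact: dhomog1.
  exact: dhomogM.
rewrite rmorphXn /= substX.
by have := dhomogMn (m i) (homog_linform g i); rewrite mul1n.
Qed.

Lemma homog_der d m f : f \is d.-homog -> der m f \is d.-homog.
Proof.
case: d => [|d] hf; last first.
  apply: rpred_sum => j _; rewrite -[d.+1]/(1 + d)%N; apply: dhomogM.
    exact: homog_linform.
  exact: (homog_mderiv _ hf).
suff -> : f = (f@_0)%:MP by rewrite derC rpred0.
apply/mpolyP => k; rewrite mcoeffC.
have [->|k0] := eqVneq k 0%MM; first by rewrite mulr1.
rewrite mulr0; apply: dhomog_nemf_coeff hf _.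
by rewrite /= mdeg_eq0.
Qed.

(* On forms of degree d the operator is c d (w + mu d w(dq, - dp)).           *)
Definition ladder (c mu : nat -> A) w : S -> S :=
  linext (fun k => c (mdeg k) *: (qmul w * 'X_[k] + mu (mdeg k) *: qdiff w 'X_[k])).

Variables c mu : nat -> A.

Lemma ladder_linear w : linear (ladder c mu w).
Proof. exact: linext_linear. Qed.

Lemma subst_linext (V : lmodType A) (L : S -> V) f : linear L ->
  L f = \sum_(m <- msupp f) f@_m *: L 'X_[m].
Proof.
move=> Ll; pose D : {linear S -> V} := HB.pack L (GRing.isLinear.Build _ _ _ _ L Ll).
rewrite -[L]/(D : S -> V) {1}[f]mpolyE linear_sum.
by apply: eq_bigr => k _; rewrite linearZ.
Qed.

Lemma linear_eq_monomials (V : lmodType A) (L L' : S -> V) f :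
  linear L -> linear L' -> {in msupp f, forall k, L 'X_[k] = L' 'X_[k]} -> L f = L' f.
Proof.
move=> Ll Ll' E; rewrite (subst_linext _ Ll) (subst_linext _ Ll').
by apply: eq_big_seq => k /E ->.
Qed.

Lemma ladder_homog d f w : f \is d.-homog ->
  ladder c mu w f = c d *: (qmul w * f + mu d *: qdiff w f).
Proof.
move=> /dhomogP hf.
apply: (@linear_eq_monomials _ (ladder c mu w)
  (fun f => c d *: (qmul w * f + mu d *: qdiff w f))).
- exact: ladder_linear.
- by move=> a x y; rewrite qdiff_linear -!mul_mpolyC; ring.
- by move=> k /hf <-; rewrite /ladder linextX.
Qed.

Lemma ladder_linearl a w w' f :
  ladder c mu (a *: w + w') f = a *: ladder c mu w f + ladder c mu w' f.
Proof.
rewrite /ladder /linext scaler_sumr -big_split; apply: eq_bigr => k _ /=.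
rewrite qmul_linear qdiff_linearl -!mul_mpolyC; ring.
Qed.

Lemma homog_monomial (k : 'X_{1..2}) : ('X_[k] : S) \is (mdeg k).-homog.
Proof. by rewrite dhomogX. Qed.

Lemma subst_ladder g w f : \det g = 1 ->
  subst g (ladder c mu w f) = ladder c mu (sym2 g *m w) (subst g f).
Proof.
move=> dg.
apply: (@linear_eq_monomials _ (fun f => subst g (ladder c mu w f))
  (fun f => ladder c mu (sym2 g *m w) (subst g f))).
- by move=> a x y; rewrite ladder_linear subst_linear.
- by move=> a x y; rewrite subst_linear ladder_linear.
move=> k _; have hk := homog_monomial k.
rewrite (ladder_homog _ hk) (ladder_homog _ (homog_subst g hk)).
by rewrite substZ rmorphD /= substZ rmorphM /= subst_qmul subst_qdiff.
Qed.

Lemma der_ladder m w f : \tr m = 0 ->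
  der m (ladder c mu w f) - ladder c mu w (der m f) =
  ladder c mu (dsym2 m *m w) f.
Proof.
move=> tm.
apply: (@linear_eq_monomials _
  (fun f => der m (ladder c mu w f) - ladder c mu w (der m f))).
- move=> a x y; rewrite !(ladder_linear, der_linear) -!mul_mpolyC; ring.
- exact: ladder_linear.
move=> k _; have hk := homog_monomial k.
rewrite !(ladder_homog _ hk) (ladder_homog _ (homog_der m hk)).
have DZ b x : der m (b *: x) = b *: der m x.
  by rewrite -[b *: x]addr0 der_linear /der [X in _ + X]big1 ?addr0 // => j _;
    rewrite mderiv0 mulr0.
have DD x y : der m (x + y) = der m x + der m y.
  by rewrite -[x]scale1r der_linear !scale1r.
rewrite DZ DD DZ der_mul der_qmul der_qdiff // -!mul_mpolyC; ring.
Qed.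

Variable T : A.
Hypothesis cE : forall d, c d * d.+1%:R = 1.
Hypothesis muE : forall d, mu d.+2 - mu d = T * d.+1%:R.

(** Two raisings commute and two lowerings commute. The mixed terms give c_d (mu_(d+2) - mu_d) times
    the derivation, which the recursion for mu turns into T. *)
Lemma ladder_comm d f w w' : ~~ odd d -> f \is d.-homog ->
  ladder c mu w (ladder c mu w' f) - ladder c mu w' (ladder c mu w f) =
  T *: der (qwedge w w') f.
Proof.
move=> od hf.
have LZ b x u : ladder c mu u (b *: x) = b *: ladder c mu u x.
  have L0 : ladder c mu u 0 = 0 by rewrite /ladder /linext msupp0 big_nil.
  by rewrite -[b *: x]addr0 ladder_linear L0 addr0.
have LD u x y : ladder c mu u (x + y) = ladder c mu u x + ladder c mu u y.
  by rewrite -[x]scale1r ladder_linear !scale1r.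
rewrite !(ladder_homog _ hf) !LZ !LD !LZ.
rewrite !(ladder_homog _ (homog_qmul _ hf)) !(ladder_homog _ (homog_qdiff _ hf)).
have E1 := qdiff_qmul_comm w w' hf; have E2 := qmul_qdiff_comm w w' hf.
have E3 := qdiff_comm f w w'.
transitivity (c d *: (c d.+2 *: (mu d.+2 *: ((d%:R + 3) * der (qwedge w w') f)) +
   mu d *: (c d.-2 *: (- (d%:R - 1) * der (qwedge w w') f)))).
  rewrite -E1 -E2 E3 -!mul_mpolyC {E1 E2 E3}.
  move: (qdiff w' (qdiff w f)) (qdiff w (qmul w' * f)) (qdiff w' (qmul w * f)).
  by move: (qdiff w f) (qdiff w' f) (qmul w) (qmul w') => *; ring.
(* In degree 0 the index [d.-2] is truncated, but the derivation kills constants; degree 1 is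
   excluded by parity. *)
case: d od hf {E1 E2 E3} => [|[//|d]] _ hf.
  suff -> : der (qwedge w w') f = 0 by rewrite !mulr0 !scaler0 addr0 scaler0.
  have [e1 e2] : f^`M(0) = 0 /\ f^`M(1) = 0.
    have z i : f^`M(i) = 0.
      apply/mpolyP => k; rewrite mcoeff_mderiv mcoeff0 (dhomog_nemf_coeff hf) ?mul0rn //.
      by rewrite /= mdegD mdeg1 addn1.
    by split.
  by rewrite der2E e1 e2 !mulr0 addr0.
have e1 : (d.+2%:R + 3 : S) = (d.+4.+1%:R : A)%:MP.
  by rewrite mpolyC_nat -natrD addn3.
have e2 : (d.+2%:R - 1 : S) = (d.+1%:R : A)%:MP.
  by rewrite mpolyC_nat -[d.+2]addn1 natrD addrK.
rewrite e1 e2 -!mul_mpolyC /=; move: (der _ f) => G.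
transitivity ((c d.+2 * (mu d.+4 * (c d.+4 * d.+4.+1%:R) -
  mu d.+2 * (c d * d.+1%:R)))%:MP * G); first by ring.
by rewrite !cE !mulr1 muE mulrCA cE mulr1.
Qed.

End Ladder.

(** * Casimir operators on forms *)

Section Casimir.
Variable A : comNzRingType.
Local Notation S := {mpoly A[2]}.
Implicit Types (f : S) (d : nat).
Local Notation e j := (delta_mx j 0 : 'cV[A]_3).

Lemma qmul_delta j : qmul (e j) = nth 0 [:: 'X_0 ^+ 2; 'X_0 * 'X_1; 'X_1 ^+ 2] j.
Proof.
rewrite /qmul !mxE; elim/ord3P: j => /=;
  by rewrite !(mpolyC0, mpolyC1, mul0r, mul1r, addr0, add0r).
Qed.

Lemma qdiff_delta j f : qdiff (e j) f =
  nth 0 [:: f^`M(1)^`M(1); - f^`M(0)^`M(1); f^`M(0)^`M(0)] j.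
Proof.
rewrite /qdiff !mxE; elim/ord3P: j => /=; rewrite !(mpolyC0, mpolyC1); ring.
Qed.

Lemma euler2 d f : f \is d.-homog ->
  'X_0 ^+ 2 * f^`M(0)^`M(0) + 2 * 'X_0 * 'X_1 * f^`M(0)^`M(1) +
  'X_1 ^+ 2 * f^`M(1)^`M(1) = d%:R * (d%:R - 1) * f.
Proof.
move=> hf; have [E1 E2] := euler_mderiv hf; have E := euler hf.
transitivity ('X_0 * ('X_0 * f^`M(0)^`M(0) + 'X_1 * f^`M(0)^`M(1)) +
  'X_1 * ('X_0 * f^`M(0)^`M(1) + 'X_1 * f^`M(1)^`M(1))); first by gring.
rewrite E1 E2.
transitivity ((d%:R - 1) * ('X_0 * f^`M(0) + 'X_1 * f^`M(1))); first by gring.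
by rewrite E; ring.
Qed.

(** The combination 2 e1 e1 - e0 e2 - e2 e0 is twice the contraction with the inverse of the
    discriminant form; for the ladder operators it is twice the sum of the R_i^2. *)
Lemma qmul_qdiff_trace d f : f \is d.-homog ->
  2 * (qmul (e 1) * qdiff (e 1) f) - qmul (e 0) * qdiff (e 2) f
  - qmul (e 2) * qdiff (e 0) f = - (d%:R * (d%:R - 1) * f).
Proof. by move=> /euler2 <-; rewrite !qmul_delta !qdiff_delta /=; gring. Qed.

Lemma qdiff_qmul_trace d f : f \is d.-homog ->
  2 * qdiff (e 1) (qmul (e 1) * f) - qdiff (e 0) (qmul (e 2) * f)
  - qdiff (e 2) (qmul (e 0) * f) = - ((d%:R + 2) * (d%:R + 3) * f).
Proof.
move=> hf; rewrite !qdiff_delta /= !mderiv2M !qmul_mderiv0 !qmul_mderiv1 !mderiv_lin.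
rewrite !qmul_delta !mxE /= !(mpolyCMn, mpolyC0, mpolyC1).
have E := euler hf; have E2 := euler2 hf.
transitivity (- (6 * f + 6 * ('X_0 * f^`M(0) + 'X_1 * f^`M(1)) +
  ('X_0 ^+ 2 * f^`M(0)^`M(0) + 2 * 'X_0 * 'X_1 * f^`M(0)^`M(1) +
   'X_1 ^+ 2 * f^`M(1)^`M(1)))); first by gring.
by rewrite E E2; ring.
Qed.

Lemma der_casimir d f : f \is d.-homog ->
  let e12 := der (mx2 0 1 0 0) in let e21 := der (mx2 0 0 1 0) in
  let h := der (mx2 1 0 0 (-1)) in
  2 * (e12 (e21 f) + e21 (e12 f)) + h (h f) = d%:R * (d%:R + 2) * f.
Proof.
move=> hf /=; have E := euler hf; have E2 := euler2 hf.
rewrite !der2E !mxE /= !(mpolyCN, mpolyC0, mpolyC1, mul0r, mul1r, add0r, addr0, mulN1r).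
rewrite !(mderivD, mderivN, mderivM, mderivXU) /= mpolyC0 mpolyC1 !mderiv01.
transitivity (('X_0 ^+ 2 * f^`M(0)^`M(0) + 2 * 'X_0 * 'X_1 * f^`M(0)^`M(1) +
   'X_1 ^+ 2 * f^`M(1)^`M(1)) + 3 * ('X_0 * f^`M(0) + 'X_1 * f^`M(1)));
  first by gring.
by rewrite E E2; ring.
Qed.

Variables (c mu : nat -> A) (T : A).
Hypothesis cE : forall d, c d * d.+1%:R = 1.
Hypothesis muE : forall d, mu d.+2 - mu d = T * d.+1%:R.
Local Notation lad j := (ladder c mu (e j)).

Lemma ladder_casimir d f : ~~ odd d -> f \is d.-homog ->
  2 * lad 1 (lad 1 f) - lad 0 (lad 2 f) - lad 2 (lad 0 f) =
  - ((2 * mu d + T * d.+2%:R) *: f).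
Proof.
move=> od hf.
have LZ b x u : ladder c mu u (b *: x) = b *: ladder c mu u x.
  have L0 : ladder c mu u 0 = 0 by rewrite /ladder /linext msupp0 big_nil.
  by rewrite -[b *: x]addr0 ladder_linear L0 addr0.
have LD u x y : ladder c mu u (x + y) = ladder c mu u x + ladder c mu u y.
  by rewrite -[x]scale1r ladder_linear !scale1r.
rewrite !(ladder_homog _ _ _ hf) !LZ !LD !LZ.
rewrite !(ladder_homog _ _ _ (homog_qmul _ hf)) !(ladder_homog _ _ _ (homog_qdiff _ hf)).
have E1 := qdiff_qmul_trace hf; have E2 := qmul_qdiff_trace hf.
transitivity (c d *: (c d.+2 *: (mu d.+2 *: - ((d%:R + 2) * (d%:R + 3) * f)) +
   mu d *: (c d.-2 *: - (d%:R * (d%:R - 1) * f)))).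
  (* The triple p^2, pq, q^2 and its counterpart in dq, -dp are isotropic, so the parts of degree d
     + 4 and d - 4 cancel. *)
  have Q1 : qmul (e 1) * (qmul (e 1) * f) = qmul (e 0) * (qmul (e 2) * f).
    by rewrite !qmul_delta /=; gring.
  have D1 : qdiff (e 1) (qdiff (e 1) f) = qdiff (e 0) (qdiff (e 2) f).
    by rewrite !qdiff_delta /= !mderivN opprK !mderiv01.
  have D2 := qdiff_comm f (e 2) (e 0).
  move: E1 E2 Q1 D1 D2.
  move: ((d%:R + 2) * (d%:R + 3) * f) (d%:R * (d%:R - 1) * f) => G1 G2.
  move: (qdiff (e 0) (qdiff (e 2) f)) (qdiff (e 1) (qdiff (e 1) f))
    (qdiff (e 2) (qdiff (e 0) f)) (qdiff (e 1) (qmul (e 1) * f))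
    (qdiff (e 0) (qmul (e 2) * f)) (qdiff (e 2) (qmul (e 0) * f)).
  move: (qdiff (e 0) f) (qdiff (e 1) f) (qdiff (e 2) f).
  have Q2 := mulrCA (qmul (e 2)) (qmul (e 0)) f.
  move: (qmul (e 0)) (qmul (e 1)) (qmul (e 2)) Q2 => q0 q1 q2 Q2.
  move=> d0 d1 d2 d02 d11 d20 d1q1 d0q2 d2q0 <- <- Q1 D1 D2.
  by rewrite !scalerDr Q1 D1 D2 Q2 -!mul_mpolyC; ring.
transitivity (- (c d * (mu d.+2 * (c d.+2 * d.+3%:R) * d.+2%:R + mu d * d%:R))%:MP * f).
  (* For d at least 2, [c d.-2] is inverse to d - 1; for d = 0 both sides vanish. *)
  have -> : mu d * d%:R = mu d * (c d.-2 * (d%:R * (d%:R - 1))).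
    case: d od {hf E1 E2} => [|[//|d]] _; first by rewrite mul0r !mulr0.
    have -> : d.+2%:R - 1 = d.+1%:R :> A by rewrite -[d.+2]addn1 natrD addrK.
    by rewrite /= [d.+2%:R * _]mulrC [c d * _]mulrA cE mul1r.
  have -> : d.+3%:R = d%:R + 3 :> A by rewrite -natrD addn3.
  have -> : d.+2%:R = d%:R + 2 :> A by rewrite -natrD addn2.
  rewrite -!mul_mpolyC !(mpolyCM, mpolyCD, mpolyCB, mpolyC_nat, mpolyC1).
  by ring.
rewrite cE mulr1 -mul_mpolyC mulNr; congr (- (_%:MP * _)).
have -> : mu d.+2 = mu d + T * d.+1%:R by rewrite -muE addrC subrK.
have -> : (mu d + T * d.+1%:R) * d.+2%:R + mu d * d%:R =
    d.+1%:R * (2 * mu d + T * d.+2%:R).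
  by rewrite -[d.+2]addn2 -[d.+1]addn1 !natrD; ring.
by rewrite mulrA cE mul1r.
Qed.

End Casimir.

(** * The bracket of g through cross products and quadratic forms *)

Section CrossProduct.
Variable R : realType.
Local Notation C := R[i].
Local Notation O := {poly C}.
Implicit Types (u v w : 'cV[O]_3).

Definition cross (A : pzRingType) (a b : 'cV[A]_3) : 'cV[A]_3 :=
  \col_i nth 0 [:: a 1 0 * b 2 0 - a 2 0 * b 1 0;
                   a 2 0 * b 0 0 - a 0 0 * b 2 0;
                   a 0 0 * b 1 0 - a 1 0 * b 0 0] i.

Lemma eps_sum (A : comNzRingType) (a : 'I_3 -> 'I_3 -> A) k :
  \sum_i \sum_j eps A i j k * a i j =
  nth 0 [:: a 1 2 - a 2 1; a 2 0 - a 0 2; a 0 1 - a 1 0] k.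
Proof. by rewrite !sum3E; elim/ord3P: k; rewrite /eps /=; ring. Qed.

Lemma fst_sum (U V : zmodType) (I : Type) (r : seq I) (F : I -> U * V) :
  (\sum_(i <- r) F i).1 = \sum_(i <- r) (F i).1.
Proof. by elim/big_rec2: _ => // i x y _ <-. Qed.

Lemma snd_sum (U V : zmodType) (I : Type) (r : seq I) (F : I -> U * V) :
  (\sum_(i <- r) F i).2 = \sum_(i <- r) (F i).2.
Proof. by elim/big_rec2: _ => // i x y _ <-. Qed.

Lemma eps_delta_sum (a : 'I_3 -> 'I_3 -> O) k :
  (\sum_i \sum_j \sum_l eps O i j l *: (a i j *: delta_mx l 0) : 'cV[O]_3) k 0 =
  nth 0 [:: a 1 2 - a 2 1; a 2 0 - a 0 2; a 0 1 - a 1 0] k.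
Proof.
rewrite -eps_sum summxE; apply: eq_bigr => i _; rewrite summxE.
apply: eq_bigr => j _; rewrite summxE (bigD1 k) //= big1 ?addr0 => [|l lk].
  by rewrite !mxE !eqxx mulr1.
by rewrite !mxE eq_sym (negbTE lk) !mulr0.
Qed.

Lemma bracket1 (x y : lie_g R) : (bracket x y).1 =
  \sum_i \sum_j \sum_l eps O i j l *:
    ((- (x.1 i 0 * y.1 j 0) + 'X * (x.2 i 0 * y.2 j 0)) *: delta_mx l 0).
Proof.
rewrite /bracket fst_sum; apply: eq_bigr => i _; rewrite fst_sum.
apply: eq_bigr => j _; rewrite fst_sum; apply: eq_bigr => k _.
by rewrite /= scaler0 addr0.
Qed.

Lemma bracket2 (x y : lie_g R) : (bracket x y).2 =
  \sum_i \sum_j \sum_l eps O i j l *: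
    ((- (x.1 i 0 * y.2 j 0) - x.2 i 0 * y.1 j 0) *: delta_mx l 0).
Proof.
rewrite /bracket snd_sum; apply: eq_bigr => i _; rewrite snd_sum.
apply: eq_bigr => j _; rewrite snd_sum; apply: eq_bigr => k _.
by rewrite /= scaler0 add0r.
Qed.

Lemma bracketE (x y : lie_g R) : bracket x y =
  (- cross x.1 y.1 + 'X *: cross x.2 y.2, - cross x.1 y.2 - cross x.2 y.1).
Proof.
rewrite [LHS]surjective_pairing bracket1 bracket2.
move: x.1 x.2 y.1 y.2 => a b a' b'.
congr (_, _); apply/matrixP => k j; rewrite (ord1 j) eps_delta_sum !mxE;
  elim/ord3P: k => /=; ring.
Qed.

Definition Jp : O := 'i%:P.
Lemma JpE : Jp ^+ 2 = -1.
Proof. by rewrite /Jp -rmorphXn /= sqrCi rmorphN1. Qed.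

(** The cross product in the coordinates on p^2, pq, q^2; see [VO_cross]. *)
Definition qcross u v : 'cV[O]_3 :=
  \col_i (Jp * nth 0 [:: u 0 0 * v 1 0 - u 1 0 * v 0 0;
                   2 * (u 0 0 * v 2 0 - u 2 0 * v 0 0);
                   u 1 0 * v 2 0 - u 2 0 * v 1 0] i).

Definition VO : 'M[O]_3 := map_mx polyC (vec2quad C).

Definition halfp : O := (2^-1)%:P.
Lemma halfpE : halfp + halfp = 1.
Proof. by rewrite /halfp -polyCD (_ : 2^-1 + 2^-1 = 1) //; field. Qed.

Lemma VOE : VO = mx3 halfp (- (Jp * halfp)) 0 0 0 1 (- halfp) (- (Jp * halfp)) 0.
Proof.
apply/matrixP => i j; rewrite !mxE /halfp /Jp.
by elim/ord3P: i; elim/ord3P: j => /=; rewrite ?polyCN ?polyCM ?polyC0 ?polyC1.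
Qed.

Lemma VO_mul w i : (VO *m w) i 0 =
  nth 0 [:: halfp * w 0 0 - Jp * halfp * w 1 0; w 2 0;
            - (halfp * w 0 0) - Jp * halfp * w 1 0] i.
Proof. by rewrite mulmx_sum3 VOE !mxE; elim/ord3P: i => /=; ring. Qed.

Lemma VO_cross u v : VO *m cross u v = qcross (VO *m u) (VO *m v).
Proof.
have J2 := JpE; apply/matrixP => i j; rewrite (ord1 j) VO_mul [RHS]mxE !VO_mul !mxE.
elim/ord3P: i => /=.
- by ring: J2.
- transitivity ((halfp + halfp) ^+ 2 * (u 0 0 * v 1 0 - u 1 0 * v 0 0)); last by ring: J2.
  by rewrite halfpE expr1n mul1r.
- by ring: J2.
Qed.

Lemma VO_linear a u v : VO *m (a *: u + v) = a *: (VO *m u) + VO *m v.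
Proof. by rewrite mulmxDr -scalemxAr. Qed.

(* The element of sl(2) which acts on the quadratic forms as the vector of    *)
(* coordinates u (in the basis p^2, pq, q^2) acts in so(3).                   *)
Definition tau u : 'M[O]_2 :=
  mx2 (Jp * halfp * u 1 0) (- (Jp * u 0 0)) (Jp * u 2 0) (- (Jp * halfp * u 1 0)).

Lemma tau_linear : linear tau.
Proof.
move=> a u v; rewrite /tau scalemx2 addmx2 !mxE.
by congr (mx_of_rows _ _ [:: [:: _; _]; [:: _; _]]); ring.
Qed.

Lemma tr_tau u : \tr (tau u) = 0.
Proof. by rewrite /mxtrace sum2E !mxE /=; ring. Qed.

Lemma oppmx2 (A : pzRingType) (a b c d : A) : - mx2 a b c d = mx2 (-a) (-b) (-c) (-d).
Proof. by apply/matrixP => x y; rewrite !mxE; elim/ord2P: x; elim/ord2P: y. Qed.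

Lemma tau_comm u v : tau u *m tau v - tau v *m tau u = tau (- qcross u v).
Proof.
have J2 := JpE; rewrite /tau !mulmx2 oppmx2 addmx2 !mxE /=.
congr (mx_of_rows _ _ [:: [:: _; _]; [:: _; _]]).
- by transitivity (- Jp ^+ 2 * ((halfp + halfp) * (u 0 0 * v 2 0 - u 2 0 * v 0 0)));
    [rewrite halfpE; ring | ring].
- by transitivity (Jp ^+ 2 * ((halfp + halfp) * (u 0 0 * v 1 0 - u 1 0 * v 0 0)));
    [ring | rewrite halfpE; ring].
- by transitivity (- Jp ^+ 2 * ((halfp + halfp) * (u 1 0 * v 2 0 - u 2 0 * v 1 0)));
    [ring | rewrite halfpE; ring].
- by transitivity (Jp ^+ 2 * ((halfp + halfp) * (u 0 0 * v 2 0 - u 2 0 * v 0 0)));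
    [rewrite halfpE; ring | ring].
Qed.

Lemma dsym2_tau u v : dsym2 (tau u) *m v = - qcross u v.
Proof.
have h2 (x y : O) : x * (halfp * y) *+ 2 = x * y.
  by rewrite -mulrnAr -mulrnAl mulr2n halfpE mul1r.
apply/matrixP => i j; rewrite (ord1 j) mulmx_sum3 /dsym2 /tau !mxE /=.
elim/ord3P: i => /=; rewrite ?mulrN -?[Jp * halfp * _]mulrA ?mulr_natl ?mulNrn ?h2; ring.
Qed.

Lemma qwedge_tau u v : qwedge u v = tau (qcross u v).
Proof.
have J2 := JpE; rewrite /tau /qwedge !mxE /=.
congr (mx_of_rows _ _ [:: [:: _; _]; [:: _; _]]).
- by transitivity (Jp ^+ 2 * ((halfp + halfp) * (u 0 0 * v 2 0 - u 2 0 * v 0 0)));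
    [rewrite halfpE; ring: J2 | ring].
- by ring: J2.
- by ring: J2.
- by transitivity (- Jp ^+ 2 * ((halfp + halfp) * (u 0 0 * v 2 0 - u 2 0 * v 0 0)));
    [rewrite halfpE; ring: J2 | ring].
Qed.

Lemma qcrossC u v : qcross v u = - qcross u v.
Proof. by apply/matrixP => i j; rewrite !mxE; elim/ord3P: i => /=; ring. Qed.

Lemma tau_sym2 (g : 'M[O]_2) u : \det g = 1 -> tau (sym2 g *m u) *m g = g *m tau u.
Proof.
rewrite det_mx2 => dg.
have {}dg : g 0 0 * g 1 1 = 1 + g 0 1 * g 1 0 by rewrite -dg; ring.
rewrite [g in LHS]mx2P [X in _ = X *m _]mx2P /tau !mulmx2 !mulmx_sum3 /sym2 !mxE /=.
move: (g 0 0) (g 0 1) (g 1 0) (g 1 1) (u 0 0) (u 1 0) (u 2 0) dg => a b c d x y z dg.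
(* [halfp] is an atom for [ring], so each entry needs a suitable multiple of the relation 2 halfp =
   1, added as a zero term. *)
have h0 k : k * (halfp + halfp - 1) = 0 by rewrite halfpE subrr mulr0.
congr (mx_of_rows _ _ [:: [:: _; _]; [:: _; _]]); rewrite -[RHS]addr0.
- rewrite -(h0 (Jp * (a ^+ 2 * c * x + a * b * c * y + (b + b ^+ 2 * c) * z))).
  by ring: dg.
- rewrite -(h0 (Jp * (a * b * c * x + (b + b ^+ 2 * c) * y + b ^+ 2 * d * z))).
  by ring: dg.
- rewrite -(h0 (- Jp * (a * c ^+ 2 * x + (c + b * c ^+ 2) * y + b * c * d * z))).
  by ring: dg.
- rewrite -(h0 (- Jp * ((c + b * c ^+ 2) * x + b * c * d * y + b * d ^+ 2 * z))).
  by ring: dg.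
Qed.

Lemma tau_sl2E i : tau (VO *m delta_mx i 0) = - map_mx polyC (sl2E C i).
Proof.
have J2 := JpE.
rewrite /tau !VO_mul !mxE /= [in RHS](mx2P (sl2E C i)).
apply/matrixP => k l; rewrite !mxE /sl2E.
elim/ord3P: i => /=; elim/ord2P: k; elim/ord2P: l; rewrite /= ?mxE /=;
  rewrite ?(polyCN, polyCM, polyC0) -/Jp -/halfp; ring: J2.
Qed.

End CrossProduct.

(** * The Lie algebra g *)

Section LinearFacts.
Variables (A : pzRingType) (U V : lmodType A) (f : U -> V).
Hypothesis fl : linear f.
Let F : {linear U -> V} := HB.pack f (GRing.isLinear.Build _ _ _ _ f fl).

Lemma lin0 : f 0 = 0. Proof. exact: (linear0 F). Qed.
Lemma linD x y : f (x + y) = f x + f y. Proof. exact: (linearD F). Qed.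
Lemma linN x : f (- x) = - f x. Proof. exact: (linearN F). Qed.
Lemma linB x y : f (x - y) = f x - f y. Proof. exact: (linearB F). Qed.
Lemma linZ a x : f (a *: x) = a *: f x. Proof. by rewrite -[a *: x]addr0 fl lin0 addr0. Qed.
Lemma lin_sum I (r : seq I) (P : pred I) (E : I -> U) :
  f (\sum_(i <- r | P i) E i) = \sum_(i <- r | P i) f (E i).
Proof. exact: (linear_sum F). Qed.

End LinearFacts.

Section LinearCombinations.
Variables (A : comNzRingType) (V : lmodType A).

Lemma free_lift n (x : 'I_n -> V) :
  exists2 phi : 'rV[A]_n -> V, linear phi & forall i, phi (delta_mx 0 i) = x i.
Proof.
exists (fun u => \sum_i u 0 i *: x i) => [a u v|i].
  by rewrite scaler_sumr -big_split; apply: eq_bigr => i _; rewrite !mxE scalerDl scalerA.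
rewrite (bigD1 i isT) /= big1 => [|j ji]; first by rewrite mxE !eqxx scale1r addr0.
by rewrite mxE (negbTE ji) andbF scale0r.
Qed.

End LinearCombinations.

(* To compare two linear combinations of x, y and z, lift x, y and z to the   *)
(* standard basis of a free module.                                           *)
Ltac lincomb x y z :=
  let phi := fresh "phi" in let pl := fresh "pl" in let p := fresh "p" in
  have [phi pl p] := free_lift (fun i : 'I_3 => nth 0 [:: x; y; z] i);
  rewrite -?[x](p 0) -?[y](p 1) -?[z](p 2);
  do 12 rewrite -?(linZ pl) -?(linN pl) -?(linD pl);
  congr phi; apply/rowP; elim/ord3P; rewrite !mxE /=.

Section SumSquares.
Variables (A : comNzRingType) (V : lmodType A).

Lemma lin_sq (a b : A) (x y : V -> V) u : linear x -> linear y ->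
  a *: x (a *: x u + b *: y u) + b *: y (a *: x u + b *: y u) =
  (a * a) *: x (x u) + (a * b) *: (x (y u) + y (x u)) + (b * b) *: y (y u).
Proof.
move=> lx ly; rewrite !(linD lx) !(linZ lx) !(linD ly) !(linZ ly) !scalerDr !scalerA.
by rewrite (mulrC b a) !addrA.
Qed.

Lemma sum_squares_sl2 (e g h : V -> V) (j c : A) f :
  linear e -> linear g -> linear h -> j ^+ 2 = -1 ->
  let m0 u := (j * c) *: e u + (j * c) *: g u in
  let m1 u := c *: e u + (- c) *: g u in
  let m2 u := (- (j * c)) *: h u in
  m0 (m0 f) + (m1 (m1 f) + m2 (m2 f)) =
  - (c * c) *: (2 *: (e (g f) + g (e f)) + h (h f)).
Proof.
move=> le lg lh j2 /=; rewrite (lin_sq _ _ f le lg) (lin_sq _ _ f le lg) (linZ lh) scalerA.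
move: (e (e f)) (g (g f)) (e (g f) + g (e f)) (h (h f)) => x y z t.
have -> : - (j * c) * - (j * c) = - (c * c) by ring: j2.
rewrite scalerDr !addrA; congr (_ + _); lincomb x y z; ring: j2.
Qed.

Lemma sum_squares_quad (r0 r1 r2 : V -> V) (j c : A) f :
  linear r0 -> linear r2 -> j ^+ 2 = -1 -> 4 * (c * c) = 1 ->
  let m0 u := c *: r0 u + (- c) *: r2 u in
  let m1 u := (- (j * c)) *: r0 u + (- (j * c)) *: r2 u in
  m0 (m0 f) + (m1 (m1 f) + r1 (r1 f)) =
  (2 * (c * c)) *: (2 *: r1 (r1 f) - r0 (r2 f) - r2 (r0 f)).
Proof.
move=> l0 l2 j2 c4 /=; rewrite (lin_sq _ _ f l0 l2) (lin_sq _ _ f l0 l2)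
  -[X in _ = _ *: X]addrA -opprD.
move: (r0 (r0 f)) (r2 (r2 f)) (r0 (r2 f) + r2 (r0 f)) (r1 (r1 f)) => x y z t.
rewrite [in RHS]scalerDr scalerA (_ : 2 * (c * c) * 2 = 1); last by apply: etrans c4; ring.
rewrite scale1r [in RHS]addrC !addrA; congr (_ + _); lincomb x y z; ring: j2.
Qed.

End SumSquares.

(** * The weight basis of g *)

Section LieBasis.
Variable R : realType.
Local Notation C := R[i].
Local Notation O := {poly C}.
Local Notation J := (Jp R).
Implicit Types (u v : 'cV[O]_3).

Definition quadO : 'M[O]_3 := map_mx polyC (quad2vec C).

Lemma VO_quadO : VO R *m quadO = 1%:M.
Proof. by apply: etrans (esym (map_mxM _ _ _)) _; rewrite vec2quadK; exact: map_mx1. Qed.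

Lemma quadO_VO : quadO *m VO R = 1%:M. Proof. exact/mulmx1C/VO_quadO. Qed.

Lemma cross_quadO u v : cross (quadO *m u) (quadO *m v) = quadO *m qcross u v.
Proof.
rewrite -[LHS]mul1mx -quadO_VO -mulmxA VO_cross; congr (_ *m qcross _ _);
by rewrite mulmxA VO_quadO mul1mx.
Qed.

(** [lieL] and [lieR] take coordinates in the basis p^2, pq, q^2 of the complexified vectors, in
    which the torus acts diagonally. *)
Definition lieL u : lie_g R := (quadO *m u, 0).
Definition lieR u : lie_g R := (0, quadO *m u).

Lemma lieL_linear : linear lieL.
Proof.
by move=> a u v; rewrite /lieL mulmxDr -scalemxAr; congr (_, _); rewrite /= scaler0 addr0.
Qed.

Lemma lieR_linear : linear lieR.
Proof.
by move=> a u v; rewrite /lieR mulmxDr -scalemxAr; congr (_, _); rewrite /= scaler0 addr0.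
Qed.

Lemma lieLR (x : lie_g R) : x = lieL (VO R *m x.1) + lieR (VO R *m x.2).
Proof.
rewrite /lieL /lieR !mulmxA quadO_VO !mul1mx [LHS]surjective_pairing.
by congr (_, _); rewrite ?addr0 ?add0r.
Qed.

Lemma cross0l (A : pzRingType) (b : 'cV[A]_3) : cross 0 b = 0.
Proof. by apply/matrixP => i j; rewrite !mxE; elim/ord3P: i => /=; rewrite !mul0r subrr. Qed.

Lemma cross0r (A : pzRingType) (b : 'cV[A]_3) : cross b 0 = 0.
Proof. by apply/matrixP => i j; rewrite !mxE; elim/ord3P: i => /=; rewrite !mulr0 subrr. Qed.

Lemma bracket_LL u v : bracket (lieL u) (lieL v) = - lieL (qcross u v).
Proof.
rewrite bracketE /= cross_quadO !cross0l !cross0r scaler0 addr0 oppr0 addr0.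
by congr (_, _); rewrite oppr0.
Qed.

Lemma bracket_LR u v : bracket (lieL u) (lieR v) = - lieR (qcross u v).
Proof.
rewrite bracketE /= cross_quadO !cross0l !cross0r scaler0 oppr0 !addr0.
by congr (_, _); rewrite oppr0.
Qed.

Lemma bracket_RR u v : bracket (lieR u) (lieR v) = 'X *: lieL (qcross u v).
Proof.
rewrite bracketE /= cross_quadO !cross0l !cross0r oppr0 add0r addr0.
by congr (_, _); rewrite scaler0.
Qed.

Local Notation d j := (delta_mx j 0 : 'cV[O]_3).

(** [gE], [gF], [gH] form the sl(2)-triple which acts on forms as p dq, q dp, p dp - q dq; [gP],
    [gZ], [gM] are the combinations of the R_i of weights 2, 0, -2. *)
Definition gE := lieL (J *: d 0).
Definition gF := lieL (- J *: d 2).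
Definition gH := lieL (- 2 * J *: d 1).
Definition gP := lieR (d 0).
Definition gZ := lieR (d 1).
Definition gM := lieR (d 2).

Let J2 := JpE R.

Ltac bracket_quad l :=
  rewrite -?(linZ lieL_linear) -?(linZ lieR_linear) -?(linN lieL_linear) -?(linN lieR_linear);
  congr l; apply/colP; elim/ord3P; rewrite !mxE /=; ring: J2.

Lemma bracket_EF : bracket gE gF = gH.
Proof. rewrite bracket_LL; bracket_quad lieL. Qed.

Lemma bracket_HF : bracket gH gF = - 2 *: gF.
Proof. rewrite bracket_LL; bracket_quad lieL. Qed.

Lemma bracket_HP : bracket gH gP = 2 *: gP.
Proof. rewrite bracket_LR; bracket_quad lieR. Qed.

Lemma bracket_EP : bracket gE gP = 0.
Proof. rewrite bracket_LR -(lin0 lieR_linear); bracket_quad lieR. Qed.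

Lemma bracket_FP : bracket gF gP = 2 *: gZ.
Proof. rewrite bracket_LR; bracket_quad lieR. Qed.

Lemma bracket_FZ : bracket gF gZ = gM.
Proof. rewrite bracket_LR; bracket_quad lieR. Qed.

Lemma bracket_FM : bracket gF gM = 0.
Proof. rewrite bracket_LR -(lin0 lieR_linear); bracket_quad lieR. Qed.

Lemma bracket_PZ : bracket gP gZ = 'X *: gE.
Proof. rewrite bracket_RR; bracket_quad lieL. Qed.

Lemma bracket_PM : bracket gP gM = - 'X *: gH.
Proof. rewrite bracket_RR; bracket_quad lieL. Qed.

Lemma lie_ind (P : lie_g R -> Prop) :
  (forall a x y, P x -> P y -> P (a *: x + y)) ->
  P gE -> P gF -> P gH -> P gP -> P gZ -> P gM -> forall x, P x.
Proof.
move=> PD PE PF PH PP PZ PM x.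
have P0 : P 0 by have := PD (-1) _ _ PE PE; rewrite scaleN1r addNr.
have h2 := halfpE R.
have dE (u : 'cV[O]_3) : u = u 0 0 *: d 0 + (u 1 0 *: d 1 + (u 2 0 *: d 2 + 0)).
  by rewrite addr0; apply/matrixP => i j; rewrite (ord1 j) !mxE; elim/ord3P: i => /=; ring.
have PL u : P (lieL u).
  have -> : lieL u = (- J * u 0 0) *: gE + ((J * halfp R * u 1 0) *: gH + ((J * u 2 0) *: gF + 0)).
    rewrite addr0 -!(linZ lieL_linear) -!(linD lieL_linear); congr lieL.
    apply/matrixP => i j; rewrite (ord1 j) !mxE; elim/ord3P: i => /=; try by ring: J2.
    transitivity ((halfp R + halfp R) * u 1 0); [by rewrite h2 mul1r | ring: J2].
  by do 3!apply: (PD _ _ _) => //.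
have PR u : P (lieR u).
  rewrite (dE u) !(linD lieR_linear) !(linZ lieR_linear) (lin0 lieR_linear).
  by do 3!apply: (PD _ _ _) => //.
by rewrite (lieLR x) -[lieL _]scale1r; apply: (PD _ _ _).
Qed.

Lemma natO_cancel (V : lmodType O) n (x y : V) : n.+1%:R *: x = n.+1%:R *: y -> x = y.
Proof.
move/(congr1 ( *:%R (n.+1%:R^-1)%:P)); rewrite !scalerA -polyC_natr -polyCM.
by rewrite mulVf ?pnatr_eq0 // !scale1r.
Qed.

Lemma tau_gE : tau (J *: d 0) = mx2 0 1 0 0.
Proof.
apply/matrixP => i j; rewrite !mxE /=.
by elim/ord2P: i; elim/ord2P: j; rewrite /= ?mxE /=; ring: J2.
Qed.

Lemma tau_gF : tau (- J *: d 2) = mx2 0 0 1 0.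
Proof.
apply/matrixP => i j; rewrite !mxE /=.
by elim/ord2P: i; elim/ord2P: j; rewrite /= ?mxE /=; ring: J2.
Qed.

Lemma tau_gH : tau (- 2 * J *: d 1) = mx2 1 0 0 (-1).
Proof.
have h2 := halfpE R; apply/matrixP => i j; rewrite !mxE /=.
elim/ord2P: i; elim/ord2P: j; rewrite /= ?mxE /=; try by ring: J2.
- by transitivity (halfp R + halfp R); [ring: J2 | ].
by transitivity (- (halfp R + halfp R)); [ring: J2 | rewrite h2].
Qed.

Lemma halfp4 : 4 * (halfp R * halfp R) = 1.
Proof. by transitivity ((halfp R + halfp R) ^+ 2); [ring | rewrite halfpE expr1n]. Qed.

Lemma gL_basis : [/\ gL R 0 = (J * - halfp R) *: gE + (J * - halfp R) *: gF,
  gL R 1 = (- halfp R) *: gE + (- - halfp R) *: gF & gL R 2 = (- (J * - halfp R)) *: gH].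
Proof.
have h2 := halfpE R; have E i : gL R i = lieL (VO R *m d i).
  by rewrite /lieL mulmxA quadO_VO mul1mx.
split; rewrite E -!(linZ lieL_linear) -?(linD lieL_linear); congr lieL;
  apply/colP; elim/ord3P; rewrite VO_mul !mxE /=; try by ring: J2.
by transitivity (halfp R + halfp R); [exact/esym | ring: J2].
Qed.

Lemma gR_basis : [/\ gR R 0 = halfp R *: gP + (- halfp R) *: gM,
  gR R 1 = (- (J * halfp R)) *: gP + (- (J * halfp R)) *: gM & gR R 2 = gZ].
Proof.
have E i : gR R i = lieR (VO R *m d i) by rewrite /lieR mulmxA quadO_VO mul1mx.
split; rewrite E -?(linZ lieR_linear) -?(linD lieR_linear); congr lieR;
  by apply/colP; elim/ord3P; rewrite VO_mul !mxE /=; ring.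
Qed.

(** The factor 4 clears denominators: L^2 is minus a quarter of 2(ef + fe) + h^2, and R^2 is half
    the trace of the [gP], [gZ], [gM]. *)
Lemma env_TL2_R2E (V : lmodType O) (a : lie_g R -> V -> V) (v : V) :
  (forall x, linear (a x)) -> (forall v : V, linear (a^~ v)) ->
  4 *: env_act a (env_TL2_R2 R) v =
  - 'X *: (2 *: (a gE (a gF v) + a gF (a gE v)) + a gH (a gH v))
  - 2 *: (2 *: a gZ (a gZ v) - a gP (a gM v) - a gM (a gP v)).
Proof.
move=> ar al; rewrite /env_TL2_R2 /env_sq /=.
have [e0 e1 e2] := gL_basis; have [r0 r1 r2] := gR_basis.
have m0 (u : V) : a (gL R 0) u = (J * - halfp R) *: a gE u + (J * - halfp R) *: a gF u.
  by rewrite e0 (linD (al u)) !(linZ (al u)).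
have m1 (u : V) : a (gL R 1) u = (- halfp R) *: a gE u + (- - halfp R) *: a gF u.
  by rewrite e1 (linD (al u)) !(linZ (al u)).
have m2 (u : V) : a (gL R 2) u = (- (J * - halfp R)) *: a gH u by rewrite e2 (linZ (al u)).
have n0 (u : V) : a (gR R 0) u = halfp R *: a gP u + (- halfp R) *: a gM u.
  by rewrite r0 (linD (al u)) !(linZ (al u)).
have n1 (u : V) : a (gR R 1) u = (- (J * halfp R)) *: a gP u + (- (J * halfp R)) *: a gM u.
  by rewrite r1 (linD (al u)) !(linZ (al u)).
have n2 (u : V) : a (gR R 2) u = a gZ u by rewrite r2.
rewrite !m0 !m1 !m2 !n0 !n1 !n2.
rewrite (sum_squares_sl2 (- halfp R) v (ar gE) (ar gF) (ar gH) J2).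
rewrite (sum_squares_quad (a gZ) v (ar gP) (ar gM) J2 halfp4).
move: (2 *: (_ + _) + _) (2 *: _ - _ - _) => x y.
rewrite scalerDr !scalerA -[- (2 *: y)]scaleNr; congr (_ *: _ + _ *: _).
  transitivity (- 'X * (4 * (halfp R * halfp R))); [ring | by rewrite halfp4 mulr1].
transitivity (- 2 * (4 * (halfp R * halfp R))); [ring | by rewrite halfp4 mulr1].
Qed.

End LieBasis.

(** * The action on polynomials *)

Section Action.
Variable R : realType.
Local Notation C := R[i].
Local Notation O := {poly C}.
Local Notation S := {mpoly O[2]}.
Variable Q : O.
Implicit Types (x y : lie_g R) (f : S).

Definition ladder_c (d : nat) : O := (d.+1%:R^-1)%:P.
(** The solution of the recursion [ladder_muE], with the constant term chosen so that the central
    element takes the value Q. *)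
Definition ladder_mu (d : nat) : O := Q + (d%:R ^+ 2 / 4 - 1)%:P * 'X.

Lemma ladder_cE d : ladder_c d * d.+1%:R = 1.
Proof.
by rewrite /ladder_c -polyC_natr -polyCM mulVf // pnatr_eq0.
Qed.

Lemma ladder_muE d : ladder_mu d.+2 - ladder_mu d = 'X * d.+1%:R.
Proof.
rewrite /ladder_mu opprD addrACA subrr add0r -mulrBl -polyCB mulrC; congr (_ * _).
rewrite -polyC_natr; congr (_%:P).
by rewrite -[d.+2]addn2 -[d.+1]addn1 !natrD; field.
Qed.

Local Notation lad := (ladder ladder_c ladder_mu).

Definition act x f : S := der (tau (VO R *m x.1)) f + lad (VO R *m x.2) f.

Lemma act_linear x : linear (act x).
Proof.
by move=> a f f'; rewrite /act der_linear ladder_linear scalerDr addrACA.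
Qed.

Lemma act_linearl a x y f : act (a *: x + y) f = a *: act x f + act y f.
Proof.
rewrite /act !VO_linear ladder_linearl tau_linear.
by rewrite (der_linearl f) scalerDr addrACA.
Qed.

(** The brackets of type LL, LR and RR are respectively [der_comm], [der_ladder] and [ladder_comm],
    matched through [tau]. *)
Lemma homog_act_comm d x y f : ~~ odd d -> f \is d.-homog ->
  act (bracket x y) f = act x (act y f) - act y (act x f).
Proof.
move=> od hf; rewrite bracketE /act /= !mulmxDr !mulmxN -scalemxAr !VO_cross.
move: (VO R *m x.1) (VO R *m x.2) (VO R *m y.1) (VO R *m y.2) => u w u' w'.
have E1 := der_comm (tau u) (tau u') f; rewrite tau_comm in E1.
have E2 := @der_ladder _ ladder_c ladder_mu (tau u) w' f (tr_tau u).
have E3 := @der_ladder _ ladder_c ladder_mu (tau u') w f (tr_tau u').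
have E4 := ladder_comm ladder_cE ladder_muE w w' od hf.
rewrite dsym2_tau in E2; rewrite dsym2_tau qcrossC opprK in E3; rewrite qwedge_tau in E4.
have ll : linear (fun v => lad v f) by move=> a v1 v2; rewrite ladder_linearl.
rewrite !(linD (der_linear _)) !(linD (ladder_linear _ _ _)).
rewrite (linD (@tau_linear R)) (linZ (@tau_linear R)) (linD (der_linearl f)).
rewrite (linZ (der_linearl f)) (linB ll) -E1 -E4 -E2 -E3.
move: (der (tau u) (der (tau u') f)) (der (tau u') (der (tau u) f)) => a1 a2.
move: (lad w (lad w' f)) (lad w' (lad w f)) => a3 a4.
move: (der _ (lad w' f)) (lad w' (der _ f)) (der _ (lad w f)) (lad w (der _ f)) => *.
by ring.
Qed.

Lemma act_equivariant (A : 'M[C]_3) (g : 'M[C]_2) x f :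
  inK A -> \det g = 1 -> Ad g = \det A *: A ->
  subst (map_mx polyC g) (act x f) =
  act (adK A x) (subst (map_mx polyC g) f).
Proof.
move=> kA dg gA; pose h : 'M[O]_2 := map_mx polyC g.
have dh : \det h = 1 by rewrite /h det_map_mx dg.
have sh : map_mx polyC (sym2 g) = sym2 h.
  by apply/matrixP => i j; rewrite !mxE; elim/ord3P: i; elim/ord3P: j;
    rewrite /= ?mxE /= !(polyCM, polyCD, polyC_exp, polyC_natr, rmorphXn).
have VA (a : 'cV[O]_3) :
    VO R *m (map_mx polyC ((\det A)^-1 *: A) *m a) = sym2 h *m (VO R *m a).
  (* The determinant is a sign, so dividing and multiplying by it agree. *)
  have -> : (\det A)^-1 *: A = Ad g.
    rewrite gA; congr (_ *: _); apply: (mulIf (_ : \det A != 0)).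
      by have := orth_det kA; case: eqP => // ->; rewrite expr0n => /eqP; rewrite eq_sym oner_eq0.
    rewrite -expr2 (orth_det kA) mulVf //.
    by have := orth_det kA; case: eqP => // ->; rewrite expr0n => /eqP; rewrite eq_sym oner_eq0.
  have E : vec2quad C *m Ad g = sym2 g *m vec2quad C.
    by rewrite /Ad !mulmxA vec2quadK mul1mx.
  have E' : VO R *m map_mx polyC (Ad g) = sym2 h *m VO R.
    transitivity (map_mx polyC (vec2quad C *m Ad g)).
      exact: (esym (map_mxM (@polyC C) _ _)).
    rewrite E -sh; exact: (map_mxM (@polyC C)).
  by rewrite (mulmxA (VO R)) E' (mulmxA (sym2 h)).
rewrite /act [LHS]rmorphD -/h.
have -> : VO R *m (adK A x).1 = sym2 h *m (VO R *m x.1) by exact: VA.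
have -> : VO R *m (adK A x).2 = sym2 h *m (VO R *m x.2) by exact: VA.
rewrite -(subst_ladder _ _ _ _ dh); congr (_ + _).
by apply: subst_der; rewrite tau_sym2.
Qed.

Lemma act_gL i f : act (gL R i) f = - der (map_mx polyC (sl2E C i)) f.
Proof.
rewrite /act /= mulmx0 tau_sl2E (linN (der_linearl f)).
have ll : linear (fun v => lad v f) by move=> a v1 v2; rewrite ladder_linearl.
by rewrite (lin0 ll) addr0.
Qed.

Lemma act_lieL u (f : S) : act (lieL u) f = der (tau u) f.
Proof.
have ll : linear (fun w => ladder ladder_c ladder_mu w f).
  by move=> a v1 v2; rewrite ladder_linearl.
by rewrite /act /= mulmx0 (lin0 ll) addr0 mulmxA VO_quadO mul1mx.
Qed.

Lemma act_lieR u d (f : S) : f \is d.-homog ->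
  act (lieR u) f = ladder_c d *: (qmul u * f + ladder_mu d *: qdiff u f).
Proof.
move=> hf; rewrite /act /= mulmx0 (lin0 (@tau_linear R)) (lin0 (der_linearl f)) add0r.
by rewrite mulmxA VO_quadO mul1mx; exact: ladder_homog.
Qed.

(** The L-part contributes -T d(d+2) and the R-part 4 mu_d + 2 T (d+2); the term d^2/4 - 1 in
    [ladder_mu] makes the dependence on d cancel, leaving 4 Q. *)
Lemma act_homog_value d f : ~~ odd d -> f \is d.-homog ->
  env_act act (env_TL2_R2 R) f = Q *: f.
Proof.
move=> od hf; apply: (@natO_cancel _ _ 3).
rewrite (env_TL2_R2E f act_linear (fun f' a x y => act_linearl a x y f')).
have eE u : act (gE R) u = der (mx2 0 1 0 0) u by rewrite act_lieL tau_gE.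
have eF u : act (gF R) u = der (mx2 0 0 1 0) u by rewrite act_lieL tau_gF.
have eH u : act (gH R) u = der (mx2 1 0 0 (-1)) u by rewrite act_lieL tau_gH.
have eR w u : act (lieR w) u = lad w u.
  rewrite /act /= mulmx0 (lin0 (@tau_linear R)) (lin0 (der_linearl u)) add0r.
  by rewrite mulmxA VO_quadO mul1mx.
have Z2 (x : S) : 2 *: x = 2 * x by rewrite -mul_mpolyC mpolyC_nat.
have Zd : d%:R * (d%:R + 2) * f = (d%:R * (d%:R + 2)) *: f.
  by rewrite -[RHS]mul_mpolyC mpolyCM mpolyCD !mpolyC_nat.
have K := ladder_casimir ladder_cE ladder_muE od hf.
rewrite (eF f) (eE f) (eH f) eE eF eH (eR _ f) (eR _ f) (eR _ f) !eR !Z2.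
rewrite -(Z2 (_ - _ - _)).
apply: etrans (congr2 (fun u v => - 'X *: u - 2 *: v) (etrans (der_casimir hf) Zd) K) _.
rewrite scalerN opprK !scalerA -scalerDl; congr (_ *: _).
have -> : 4 * Q = 4 * ladder_mu d - (d%:R ^+ 2 - 4) * 'X.
  rewrite /ladder_mu -polyC_natr -(polyC_natr C d) mulrDr mulrA.
  rewrite -polyC_exp -polyCM -polyCB (_ : 4 * (d%:R ^+ 2 / 4 - 1) = d%:R ^+ 2 - 4 :> C).
    by rewrite addrK.
  by field.
by rewrite -[d.+2]addn2 natrD; ring.
Qed.

End Action.

(** * The representations of K on forms of even degree *)

Section Forms.
Variable A : comNzRingType.
Local Notation S := {mpoly A[2]}.
Implicit Types (g h : 'M[A]_2) (f : S) (d : nat).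

Definition mono (a b : nat) : 'X_{1..2} := [multinom nth 0 [:: a; b] i | i < 2]%N.

Lemma monoE0 a b : mono a b 0 = a. Proof. by rewrite mnmE. Qed.
Lemma monoE1 a b : mono a b 1 = b. Proof. by rewrite mnmE. Qed.

Lemma mdeg_mono a b : mdeg (mono a b) = (a + b)%N.
Proof. by rewrite mdegE sum2E monoE0 monoE1. Qed.

Lemma mono_eta (k : 'X_{1..2}) : k = mono (k 0) (k 1).
Proof. by apply/mnmP; elim/ord2P; rewrite ?monoE0 ?monoE1. Qed.

Lemma mono_eta_deg d (k : 'X_{1..2}) : mdeg k = d -> k = mono (d - k 1) (k 1).
Proof. by rewrite mdegE sum2E => <-; rewrite addnK -mono_eta. Qed.

Lemma monoX a b : 'X_[mono a b] = 'X_0 ^+ a * 'X_1 ^+ b :> S.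
Proof.
have prod2 (F : 'I_2 -> S) : \prod_(i < 2) F i = F 0 * F 1.
  rewrite !big_ord_recr big_ord0 /= mul1r.
  by congr (F _ * F _); apply: val_inj.
by rewrite mpolyXE_id prod2 monoE0 monoE1.
Qed.

Lemma mono_deg_inj d (i j : 'I_d.+1) : (mono (d - i) i == mono (d - j) j) = (i == j).
Proof.
apply/eqP/eqP => [/(congr1 (fun k : 'X_{1..2} => k 1))|-> //].
by rewrite !monoE1 => E; apply: val_inj.
Qed.

Lemma mdeg_mono_sub d (i : 'I_d.+1) : mdeg (mono (d - i) i) = d.
Proof. by rewrite mdeg_mono subnK // -ltnS. Qed.

Definition bform d (x : 'cV[A]_d.+1) : S := \sum_(k < d.+1) x k 0 *: 'X_[mono (d - k) k].

Lemma bform_linear d : linear (@bform d).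
Proof.
move=> a x y; rewrite /bform scaler_sumr -big_split; apply: eq_bigr => k _.
by rewrite !mxE scalerDl scalerA.
Qed.

Lemma coef_bform d (x : 'cV[A]_d.+1) (k : 'I_d.+1) : (bform x)@_(mono (d - k) k) = x k 0.
Proof.
rewrite /bform raddf_sum (bigD1 k) //= big1 => [|j jk].
  by rewrite mcoeffZ mcoeffX eqxx mulr1 addr0.
by rewrite mcoeffZ mcoeffX mono_deg_inj (negbTE jk) mulr0.
Qed.

Lemma bform_inj d : injective (@bform d).
Proof.
by move=> x y E; apply/matrixP => i j; rewrite (ord1 j) -!coef_bform E.
Qed.

Lemma bform_delta d (j : 'I_d.+1) : bform (delta_mx j 0) = 'X_[mono (d - j) j].
Proof.
rewrite /bform (bigD1 j) //= mxE !eqxx scale1r big1 ?addr0 // => k kj.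
by rewrite mxE (negbTE kj) scale0r.
Qed.

Lemma bform_homog d (x : 'cV[A]_d.+1) : bform x \is d.-homog.
Proof.
by apply: rpred_sum => k _; rewrite rpredZ // dhomogX /= mdeg_mono_sub.
Qed.

Lemma homog_bformE d f : f \is d.-homog -> f = bform (\col_(k < d.+1) f@_(mono (d - k) k)).
Proof.
move=> hf; apply/mpolyP => k; have [kd|kd] := eqVneq (mdeg k) d; last first.
  by rewrite !(dhomog_nemf_coeff (d := d) (mf := mdeg)) //; exact: bform_homog.
have k1 : (k 1%R < d.+1)%N by rewrite ltnS -kd mdegE sum2E leq_addl.
rewrite (mono_eta_deg kd) -[k 1%R]/(nat_of_ord (Ordinal k1)) coef_bform mxE.
by [].
Qed.

Definition subrep d g : 'M[A]_d.+1 :=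
  \matrix_(i, j) (subst g 'X_[mono (d - j) j])@_(mono (d - i) i).

Lemma subst_bform d g (x : 'cV[A]_d.+1) : subst g (bform x) = bform (subrep d g *m x).
Proof.
rewrite [LHS](homog_bformE (homog_subst g (bform_homog x))).
congr bform; apply/matrixP => i j; rewrite (ord1 j) !mxE.
rewrite (lin_sum (subst_linear g)) raddf_sum /=; apply: eq_bigr => k _.
by rewrite substZ mcoeffZ mxE mulrC.
Qed.

Lemma mulmx_delta_inj m n (X Y : 'M[A]_(m, n)) :
  (forall j, X *m delta_mx j 0 = Y *m (delta_mx j 0 : 'cV_n)) -> X = Y.
Proof.
move=> E; apply/matrixP => i j; have := congr1 (fun Z : 'cV_m => Z i 0) (E j).
by rewrite -!colE !mxE.
Qed.

Lemma mulmx_inj n (X Y : 'M[A]_n) : (forall x : 'cV_n, X *m x = Y *m x) -> X = Y.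
Proof. by move=> E; apply: mulmx_delta_inj => j. Qed.

Lemma subrepM d g h : subrep d (g *m h) = subrep d g *m subrep d h.
Proof.
apply: mulmx_inj => x; apply: bform_inj.
by rewrite -mulmxA -!subst_bform substM.
Qed.

Lemma subrep1 d : subrep d 1%:M = 1%:M.
Proof.
by apply: mulmx_inj => x; apply: bform_inj; rewrite -subst_bform subst1 mul1mx.
Qed.

Lemma subst_mono g (k : 'X_{1..2}) :
  subst g 'X_[k] = linform g 0 ^+ k 0 * linform g 1 ^+ k 1.
Proof.
rewrite {1}(mono_eta k) monoX; move: (k 0) (k 1) => a b.
by rewrite [LHS]rmorphM; congr (_ * _); rewrite [LHS]rmorphXn /= substX.
Qed.

Lemma substN d g f : ~~ odd d -> f \is d.-homog -> subst (- g) f = subst g f.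
Proof.
move=> od /dhomogP hf.
apply: (linear_eq_monomials (subst_linear _) (subst_linear _)) => k /hf /= dk.
have lN j : linform (- g) j = - linform g j.
  by rewrite /linform -sumrN; apply: eq_bigr => i _; rewrite mxE scaleNr.
have sN (x y : S) a b : ~~ odd (a + b)%N -> (- x) ^+ a * (- y) ^+ b = x ^+ a * y ^+ b.
  move=> /negbTE ab; rewrite (exprNn x) (exprNn y) mulrACA -exprD -signr_odd ab.
  by rewrite expr0 mul1r.
rewrite !subst_mono !lN; apply: sN.
by move: od; rewrite -dk mdegE sum2E.
Qed.

Lemma subrepN d g : ~~ odd d -> subrep d (- g) = subrep d g.
Proof.
move=> od; apply: mulmx_inj => x; apply: bform_inj.
rewrite -!subst_bform; exact: (substN g od (bform_homog x)).
Qed.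

End Forms.

Section FormsMap.
Variables (A B : comNzRingType) (phi : {rmorphism A -> B}).

Lemma map_subst (g : 'M[A]_2) f :
  map_mpoly phi (subst g f) = subst (map_mx phi g) (map_mpoly phi f).
Proof.
elim/mpoly_alg_ind: f => [c|j|f f' IH IH'|f f' IH IH'].
- by rewrite substC !map_mpolyC substC.
- rewrite map_mpolyX !substX /linform raddf_sum; apply: eq_bigr => i _.
  by rewrite /= map_mpolyZ map_mpolyX mxE.
- by rewrite !rmorphD /= IH IH'.
- by rewrite !rmorphM /= IH IH'.
Qed.

Lemma map_subrep d g : map_mx phi (subrep d g) = subrep d (map_mx phi g).
Proof.
apply/matrixP => i j; rewrite !mxE -mcoeff_map_mpoly map_subst map_mpolyX.
by [].
Qed.

End FormsMap.

Section RepW.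
Variable R : realType.
Local Notation C := R[i].
Local Notation S := {mpoly C[2]}.
Implicit Types (A B : 'M[C]_3) (g : 'M[C]_2) (l : nat).

(** [A] is first multiplied by its determinant to land in SO(3), so that -1 lifts to the
    identity. *)
Definition lift_spec A g := \det g = 1 /\ Ad g = \det A *: A.

(** A choice between two lifts of opposite sign; the sign does not affect forms of even degree. *)
Definition so3_lift A : 'M[C]_2 :=
  if boolp.pselect (exists g, lift_spec A g) is left H then sval (boolp.cid H) else 1%:M.

Lemma so3_liftP A : inK A -> lift_spec A (so3_lift A).
Proof.
move=> kA; rewrite /so3_lift; case: boolp.pselect => [H|[]].
  exact: (svalP (boolp.cid H)).
by have [g] := lift_orth kA; exists g.
Qed.

Lemma inK_unit_det A : inK A -> \det A = 1 \/ \det A = -1.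
Proof.
move=> /orth_det; rewrite -[1](expr1n _ 2) => /eqP.
by rewrite eqf_sqr expr1n => /orP[] /eqP; auto.
Qed.

Lemma inKM A B : inK A -> inK B -> inK (A *m B).
Proof.
by rewrite /inK => kA kB; rewrite trmx_mul mulmxA -(mulmxA _ _ A) kA mulmx1.
Qed.

Lemma inKN1 : inK (- 1%:M : 'M[C]_3).
Proof.
rewrite /inK (_ : (- 1%:M)^T = - 1%:M) ?mulNmx ?mulmxN ?opprK ?mul1mx //.
by apply/matrixP => i j; rewrite !mxE eq_sym.
Qed.

Lemma inK1 : inK (1%:M : 'M[C]_3).
Proof. by rewrite /inK trmx1 mul1mx. Qed.

Lemma inK_Ad g : \det g = 1 -> inK (Ad g).
Proof. exact: Ad_orth. Qed.

Lemma lift_spec_uniq A g h : lift_spec A g -> lift_spec A h -> g = h \/ g = - h.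
Proof. by move=> [dg Eg] [dh Eh]; exact: (Ad_inj dg dh (etrans Eg (esym Eh))). Qed.

Lemma lift_specM A B g h : inK A -> inK B ->
  lift_spec A g -> lift_spec B h -> lift_spec (A *m B) (g *m h).
Proof.
move=> kA kB [dg Eg] [dh Eh]; split; first by rewrite det_mulmx dg dh mulr1.
by rewrite AdM Eg Eh -scalemxAl -scalemxAr scalerA det_mulmx.
Qed.

Lemma lift_spec_Ad g : \det g = 1 -> lift_spec (Ad g) g.
Proof. by move=> dg; split; rewrite ?det_Ad ?scale1r. Qed.

Lemma lift_specN1 : lift_spec (- 1%:M) 1%:M.
Proof.
split; first exact: det1.
rewrite Ad1 -scaleN1r detZ det1 mulr1 scalerA -exprSr.
by rewrite (exprM _ 2 2) sqrrN !expr1n scale1r.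
Qed.

Definition rhoW l A : 'M[C]_(l.*2.+1) := subrep l.*2 (so3_lift A).

Lemma rhoWE l A g : inK A -> lift_spec A g -> rhoW l A = subrep l.*2 g.
Proof.
move=> kA gA; rewrite /rhoW; have [->//|->] := lift_spec_uniq (so3_liftP kA) gA.
by rewrite subrepN // odd_double.
Qed.

Lemma rhoW_Ad l g : \det g = 1 -> rhoW l (Ad g) = subrep l.*2 g.
Proof. by move=> dg; apply: rhoWE; [exact: inK_Ad | exact: lift_spec_Ad]. Qed.

Lemma rhoW1 l : rhoW l 1%:M = 1%:M.
Proof.
by rewrite -(Ad1 C) rhoW_Ad ?det1 // subrep1.
Qed.

Lemma rhoWN1 l : rhoW l (- 1%:M) = 1%:M.
Proof. by rewrite (rhoWE l inKN1 lift_specN1) subrep1. Qed.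

Lemma rhoWM l A B : inK A -> inK B -> rhoW l (A *m B) = rhoW l A *m rhoW l B.
Proof.
move=> kA kB; rewrite -subrepM; apply: rhoWE; first exact: inKM.
by apply: lift_specM => //; exact: so3_liftP.
Qed.

Definition regK (phi : 'M[C]_3 -> C) :=
  exists p : {mpoly C[3 * 3]}, forall A, inK A -> phi A = mxeval p A.

Lemma regK_ext phi psi : (forall A, inK A -> phi A = psi A) -> regK psi -> regK phi.
Proof. by move=> E [p pE]; exists p => A kA; rewrite E // pE. Qed.

Lemma regK_const c : regK (fun=> c).
Proof. by exists c%:MP => A _; rewrite /mxeval mevalC. Qed.

Lemma regKD phi psi : regK phi -> regK psi -> regK (fun A => phi A + psi A).
Proof. by move=> [p pE] [q qE]; exists (p + q) => A kA; rewrite /mxeval mevalD pE // qE. Qed.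

Lemma regKM phi psi : regK phi -> regK psi -> regK (fun A => phi A * psi A).
Proof. by move=> [p pE] [q qE]; exists (p * q) => A kA; rewrite /mxeval mevalM pE // qE. Qed.

Lemma regK_sum (I : Type) (r : seq I) (P : pred I) (phi : I -> 'M[C]_3 -> C) :
  (forall i, regK (phi i)) -> regK (fun A => \sum_(i <- r | P i) phi i A).
Proof.
move=> H; elim: r => [|i r IH].
  by apply: (regK_ext (psi := fun=> 0)) => [A _|]; [rewrite big_nil | exact: regK_const].
apply: (regK_ext (psi := fun A => (if P i then phi i A else 0) +
   \sum_(i <- r | P i) phi i A)) => [A _|].
  by rewrite big_cons; case: (P i); rewrite ?add0r.
by apply: regKD => //; case: (P i) => //; exact: regK_const.
Qed.

Lemma regK_prod (I : Type) (r : seq I) (phi : I -> 'M[C]_3 -> C) :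
  (forall i, regK (phi i)) -> regK (fun A => \prod_(i <- r) phi i A).
Proof.
move=> H; elim: r => [|i r IH].
  by apply: (regK_ext (psi := fun=> 1)) => [A _|]; [rewrite big_nil | exact: regK_const].
apply: (regK_ext (psi := fun A => phi i A * \prod_(i <- r) phi i A)) => [A _|].
  by rewrite big_cons.
exact: regKM.
Qed.

Lemma regK_entry i j : regK (fun A => A i j).
Proof.
exists 'X_(mxvec_index i j) => A _; rewrite /mxeval.
by transitivity (mxvec A 0 (mxvec_index i j)); [exact/esym/mxvecE | exact/esym/mevalXU].
Qed.

Lemma regK_det : regK (fun A => \det A).
Proof.
apply: regK_sum => s; apply: regKM; first exact: regK_const.
by apply: regK_prod => i; exact: regK_entry.
Qed.

Definition regKS (F : 'M[C]_3 -> S) := forall k, regK (fun A => (F A)@_k).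

Lemma regKSM F G : regKS F -> regKS G -> regKS (fun A => F A * G A).
Proof.
move=> hF hG k; apply: (regK_ext (psi := fun A => _)) => [A _|]; first exact: mcoeffM.
by apply: regK_sum => -[k1 k2]; exact: regKM.
Qed.

Lemma regKS_ext F G : (forall A, inK A -> F A = G A) -> regKS G -> regKS F.
Proof. by move=> E hG k; apply: regK_ext (hG k) => A kA; rewrite E. Qed.

Lemma regKS1 : regKS (fun=> 1).
Proof. by move=> k; exact: regK_const. Qed.

Lemma regKSX F n : regKS F -> regKS (fun A => F A ^+ n).
Proof.
move=> hF; elim: n => [|n IH]; first exact: regKS1.
by apply: (regKS_ext (G := fun A => F A * F A ^+ n)) => [A _|]; [rewrite exprS | exact: regKSM].
Qed.

(** The chosen lift need not be regular in A, but on quadratic forms it acts through [Ad], that is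
    through det A times A. *)
Lemma regKS_qmul (w : 'cV[C]_3) : regKS (fun A => subst (so3_lift A) (qmul w)).
Proof.
move=> k; apply: (regK_ext (psi := fun A =>
  \sum_j ((vec2quad C *m (\det A *: A) *m quad2vec C) *m w) j 0 * (qmul (delta_mx j 0))@_k)).
  move=> A kA; rewrite subst_qmul -Ad_sym2 (proj2 (so3_liftP kA)).
  move: (_ *m w) => v; rewrite sum3E !qmul_delta /= /qmul !mcoeffD.
  by rewrite -!mcoeffCM.
apply: regK_sum => j; apply: regKM; last exact: regK_const.
apply: (regK_ext (psi := fun A => \det A * (vec2quad C *m (A *m (quad2vec C *m w))) j 0)).
  by move=> A _; rewrite -scalemxAr -!scalemxAl [LHS]mxE !mulmxA.
apply: regKM; first exact: regK_det.
apply: (regK_ext (psi := fun A => \sum_i vec2quad C j i * \sum_k A i k * (quad2vec C *m w) k 0)).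
  by move=> A _; rewrite [LHS]mxE; apply: eq_bigr => i _; congr (_ * _); exact: mxE.
apply: regK_sum => i; apply: regKM; first exact: regK_const.
apply: regK_sum => m; apply: regKM; last exact: regK_const.
exact: regK_entry.
Qed.

(** A monomial of even degree is a product of the quadratic monomials p^2, pq, q^2, for which
    regularity is known. *)
Lemma regKS_mono (k : 'X_{1..2}) : ~~ odd (mdeg k) ->
  regKS (fun A => subst (so3_lift A) 'X_[k]).
Proof.
rewrite mdegE sum2E (mono_eta k) monoE0 monoE1 monoX.
move: (k 0) (k 1) => a b ab.
apply: (regKS_ext (G := fun A => subst (so3_lift A) (qmul (delta_mx 0 0)) ^+ a./2 *
  (subst (so3_lift A) (qmul (delta_mx 1 0)) ^+ (odd a) *
   subst (so3_lift A) (qmul (delta_mx 2 0)) ^+ b./2))); last first.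
  by apply: regKSM; [|apply: regKSM]; apply: regKSX; exact: regKS_qmul.
have ob : odd a = odd b by move: ab; rewrite oddD; case: (odd a); case: (odd b).
have E : 'X_0 ^+ a * 'X_1 ^+ b = qmul (delta_mx 0 0) ^+ a./2 *
    (qmul (delta_mx 1 0) ^+ (odd a) * qmul (delta_mx 2 0) ^+ b./2) :> S.
  rewrite !qmul_delta /= -[a in LHS]odd_double_half -[b in LHS]odd_double_half -ob.
  move: (@mpolyX 2 C (mnm1 (0 : 'I_2))) (@mpolyX 2 C (mnm1 (1 : 'I_2))) => p q.
  rewrite !exprD (exprMn _ p q) -!mul2n !exprM.
  by move: (p ^+ odd a) ((p ^+ 2) ^+ _) (q ^+ odd a) ((q ^+ 2) ^+ _) => *; ring.
move=> A _; rewrite E [LHS]rmorphM; congr (_ * _); first exact: rmorphXn.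
by rewrite [LHS]rmorphM; congr (_ * _); exact: rmorphXn.
Qed.

Lemma rhoW_algebraic l : algebraic_rep (rhoW l).
Proof.
split; [exact: rhoW1 | exact: rhoWM |].
have H i j : regK (fun A => rhoW l A i j).
  apply: (regK_ext (psi := fun A =>
    (subst (so3_lift A) 'X_[mono (l.*2 - j) j])@_(mono (l.*2 - i) i))) => [A _|].
    by rewrite mxE.
  by apply: regKS_mono; rewrite mdeg_mono_sub odd_double.
exists (fun i j => sval (boolp.cid (H i j))) => A kA i j.
by case: boolp.cid => p /= ->.
Qed.

End RepW.

(** * Irreducibility and Schur's lemma *)

Section Irreducible.
Variable R : realType.
Local Notation C := R[i].
Local Notation S := {mpoly C[2]}.

Lemma linform_up (z : C) :
  linform (up z) 0 = 'X_0 :> S /\ linform (up z) 1 = 'X_1 + z%:MP * 'X_0.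
Proof. by split; rewrite linform2E /up !mxE /= ?mpolyC0 mpolyC1; gring. Qed.

Lemma linform_lo (z : C) :
  linform (lo z) 0 = 'X_0 + z%:MP * 'X_1 :> S /\ linform (lo z) 1 = 'X_1.
Proof. by split; rewrite linform2E /lo !mxE /= ?mpolyC0 mpolyC1; gring. Qed.

Lemma mpoly_binomial (p q r : S) (z : C) b :
  r * (q + z%:MP * p) ^+ b =
  \sum_(j < b.+1) z ^+ j *: ('C(b, j)%:R *: (r * p ^+ j * q ^+ (b - j))).
Proof.
rewrite exprDn mulr_sumr; apply: eq_bigr => j _.
rewrite exprMn -rmorphXn /= -mulr_natl -[RHS]mul_mpolyC -[_%:R *: _]mul_mpolyC mpolyC_nat.
by move: (p ^+ j) (q ^+ _) => *; ring.
Qed.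

Lemma subst_up (z : C) a b : subst (up z) 'X_[mono a b] =
  \sum_(j < b.+1) z ^+ j *: ('C(b, j)%:R *: 'X_[mono (a + j) (b - j)]) :> S.
Proof.
have [E0 E1] := linform_up z.
rewrite subst_mono monoE0 monoE1 E0 E1 mpoly_binomial; apply: eq_bigr => j _.
by rewrite monoX exprD.
Qed.

Lemma subst_lo (z : C) a b : subst (lo z) 'X_[mono a b] =
  \sum_(j < a.+1) z ^+ j *: ('C(a, j)%:R *: 'X_[mono (a - j) (b + j)]) :> S.
Proof.
have [E0 E1] := linform_lo z.
rewrite subst_mono monoE0 monoE1 E0 E1 mulrC mpoly_binomial; apply: eq_bigr => j _.
by rewrite monoX exprD mulrC.
Qed.

(** The upper unipotents extract p^d from any nonzero invariant vector, and the lower unipotents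
    then spread p^d over all monomials. *)
Lemma subrep_invariant d (U : 'M[C]_d.+1) :
  (forall g, \det g = 1 -> stablemx U (subrep d g)^T) -> U = 0 \/ row_full U.
Proof.
move=> Ust; have [->|nzU] := eqVneq U 0; [by left | right].
pose P (f : S) := exists2 x : 'cV[C]_d.+1, f = bform x & (x^T <= U)%MS.
have P0 : P 0.
  by exists 0; rewrite ?(lin0 (@bform_linear _ d)) // trmx0 sub0mx.
have Plin a f f' : P f -> P f' -> P (a *: f + f').
  move=> [x -> xU] [y -> yU]; exists (a *: x + y); first by rewrite bform_linear.
  have -> : (a *: x + y)^T = a *: x^T + y^T by apply/matrixP => i j; rewrite !mxE.
  by rewrite addmx_sub // scalemx_sub.
have Pst g f : \det g = 1 -> P f -> P (subst g f).
  move=> dg [x -> xU]; exists (subrep d g *m x); first exact: subst_bform.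
  by rewrite trmx_mul; apply: submx_trans (submxMr _ xU) (Ust g dg).
have PZ a f : a != 0 -> P (a *: f) -> P f.
  move=> nz Pf; rewrite -[f]scale1r -(mulVf nz) -scalerA -[_ *: _]addr0.
  exact: Plin.
have [i nzi] : exists i, row i U != 0.
  by apply/existsP; apply: contraNT nzU; rewrite negb_exists => /forallP H;
    apply/eqP/row_matrixP => i; rewrite row0; apply/eqP; rewrite -[_ == _]negbK H.
pose x := (row i U)^T.
have Px : P (bform x) by exists x => //; rewrite trmxK row_sub.
have [j0 nzj0] : exists j, x j 0 != 0.
  apply/existsP; apply: contraNT nzi; rewrite negb_exists => /forallP H.
  by apply/eqP/rowP => j; have := H j; rewrite negbK mxE => /eqP ->; rewrite mxE.
case: (@arg_maxnP _ j0 (fun j => x j 0 != 0) (fun j : 'I_d.+1 => (j : nat)) nzj0).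
move=> J nzJ maxJ.
(* The top coefficient in z of [subst (up z) (bform x)] is a multiple of p ^ d. *)
have Ptop : P 'X_[mono d 0].
  apply: (PZ (x J 0)) => //.
  pose u j := \sum_(k < d.+1) x k 0 *: ('C(k, j)%:R *: 'X_[mono (d - k + j) (k - j)]) : S.
  have -> : x J 0 *: 'X_[mono d 0] = u J.
    have u0 k : k != J ->
        x k 0 *: ('C(k, J)%:R *: 'X_[mono (d - k + J) (k - J)]) = 0 :> S.
      move=> kJ; have [lt|le] := ltnP k J; first by rewrite bin_small // scale0r scaler0.
      have [->|nzk] := eqVneq (x k 0) 0; first by rewrite scale0r.
      have := maxJ k nzk; rewrite /= leqNgt => /negP[].
      by rewrite ltn_neqAle le andbT eq_sym.
    rewrite /u (bigD1 J isT) /=; rewrite [X in _ = _ + X]big1; last by move=> k; exact: u0.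
    have dJ : (J <= d)%N by rewrite -ltnS.
    by rewrite [RHS]addr0 binn scale1r (subnK dJ) subnn.
  apply: (@subspace_curve_coef _ _ P d.+1 u) => // z.
  have -> : \sum_(j < d.+1) z ^+ j *: u j = subst (up z) (bform x).
    rewrite /bform (lin_sum (subst_linear _)).
    under eq_bigr => j _ do rewrite scaler_sumr.
    rewrite exchange_big /=; apply: eq_bigr => k _.
    rewrite substZ subst_up scaler_sumr.
    rewrite (big_ord_widen d.+1 (fun j => x k 0 *: (z ^+ j *:
      ('C(k, j)%:R *: 'X_[mono (d - k + j) (k - j)])) : S) (ltn_ord k)).
    rewrite [RHS]big_mkcond; apply: eq_bigr => j _ /=.
    rewrite scalerA mulrC -scalerA; case: ifP => // /negbT; rewrite -leqNgt => kj.
    by rewrite bin_small // scale0r !scaler0.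
  by apply: Pst => //; exact: det_up.
have Pall (j : 'I_d.+1) : P 'X_[mono (d - j) j].
  apply: (PZ 'C(d, j)%:R); first by rewrite pnatr_eq0 -lt0n bin_gt0 -ltnS.
  apply: (@subspace_curve_coef _ _ P d.+1
    (fun j => 'C(d, j)%:R *: 'X_[mono (d - j) (0 + j)])) => // z.
  by rewrite -subst_lo; apply: Pst => //; exact: det_lo.
rewrite -sub1mx; apply/row_subP => j; rewrite rowE mulmx1.
have [y Ey yU] := Pall j; have {}Ey : delta_mx j 0 = y.
  by apply: bform_inj; rewrite bform_delta Ey.
by rewrite -Ey trmx_delta in yU.
Qed.

Lemma rhoW_irreducible l : irreducible_rep (@rhoW R l).
Proof.
split=> [|//|U Ust]; first exact: rhoW_algebraic.
apply: subrep_invariant => g dg; rewrite -rhoW_Ad //.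
exact/Ust/inK_Ad.
Qed.

Lemma rhoW_is_W l : is_W (@rhoW R l).
Proof. by split; [exact: rhoW_irreducible | exact: rhoWN1]. Qed.

(** The kernel and the image of an intertwiner are invariant; the transposes appear because
    subspaces are row spaces. *)
Lemma schur n n' (rho : 'M[C]_3 -> 'M[C]_n) (rho' : 'M[C]_3 -> 'M[C]_n') (B : 'M[C]_(n', n)) :
  irreducible_rep rho -> irreducible_rep rho' ->
  (forall A, inK A -> B *m rho A = rho' A *m B) ->
  B = 0 \/ exists B' : 'M[C]_(n, n'), B *m B' = 1%:M /\ B' *m B = 1%:M.
Proof.
move=> [_ _ irr] [_ _ irr'] BE.
have BT A : inK A -> (rho A)^T *m B^T = B^T *m (rho' A)^T.
  by move=> kA; rewrite -!trmx_mul BE.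
have [B0|nzB] := eqVneq B 0; [by left | right].
have nzBT : B^T != 0 by apply: contraNneq nzB => E; rewrite -[B]trmxK E trmx0.
have fr : row_free B^T.
  rewrite -kermx_eq0; have [A kA|->//|full] := irr (kermx B^T).
    by apply/sub_kermxP; rewrite -mulmxA BT // mulmxA mulmx_ker mul0mx.
  case/eqP: nzBT; rewrite -[B^T]mul1mx.
  by apply/sub_kermxP; rewrite sub1mx.
have fu : row_full B^T.
  have [A kA|E|] := irr' <<B^T>>%MS.
  - rewrite (eqmxMr _ (genmxE _)) genmxE -BT //; exact: submxMl.
  - by case/eqP: nzBT; apply/eqP; rewrite -submx0 -E genmxE.
  - by rewrite -!sub1mx genmxE.
exists (pinvmx B^T)^T; split; apply: trmx_inj; rewrite trmx_mul trmxK trmx1.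
  exact: mulVpmx.
exact: mulmxVp.
Qed.

End Irreducible.

(** * The model *)

Section EvenPolynomials.
Variable R : realType.
Local Notation O := {poly R[i]}.
Local Notation S := {mpoly O[2]}.

Definition even_mpoly : {pred S} := fun f => all (fun k => ~~ odd (mdeg k)) (msupp f).

Lemma even_mpolyP (f : S) :
  reflect {in msupp f, forall k, ~~ odd (mdeg k)} (f \in even_mpoly).
Proof. exact: allP. Qed.

Lemma even_mpoly_submod : submod_closed even_mpoly.
Proof.
split=> [|a f g /even_mpolyP hf /even_mpolyP hg].
  by apply/even_mpolyP => k; rewrite (msupp0 2 O).
apply/even_mpolyP => k; move/msuppD_le; rewrite mem_cat => /orP[|/hg //].
by move/msuppZ_le/hf.
Qed.

HB.instance Definition _ := GRing.isSubmodClosed.Build O S even_mpoly even_mpoly_submod.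

Record evenS := EvenS { evenS_val :> S; _ : evenS_val \in even_mpoly }.

HB.instance Definition _ := [isSub for evenS_val].
HB.instance Definition _ := [Choice of evenS by <:].
HB.instance Definition _ := [SubChoice_isSubLmodule of evenS by <:].

End EvenPolynomials.

Section EvenModule.
Variable R : realType.
Local Notation C := R[i].
Local Notation O := {poly C}.
Local Notation S := {mpoly O[2]}.
Local Notation M := (evenS R).
Implicit Types (A : 'M[C]_3) (v : M) (f : S).

Lemma even_homog d f : ~~ odd d -> f \is d.-homog -> f \in @even_mpoly R.
Proof. by move=> od /dhomogP hf; apply/even_mpolyP => k /hf /= ->. Qed.

Lemma even_linear (L : S -> S) :
  linear L -> (forall k : 'X_{1..2}, ~~ odd (mdeg k) -> L 'X_[k] \in @even_mpoly R) ->
  forall f, f \in @even_mpoly R -> L f \in @even_mpoly R.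
Proof.
move=> Ll H f /even_mpolyP hf; rewrite (subst_linext _ Ll) big_seq.
by apply: rpred_sum => k /hf ok; apply: rpredZ; apply: H.
Qed.

Lemma even_linear_eq (V : lmodType O) (L L' : S -> V) :
  linear L -> linear L' ->
  (forall d f, ~~ odd d -> f \is d.-homog -> L f = L' f) ->
  forall f, f \in @even_mpoly R -> L f = L' f.
Proof.
move=> Ll Ll' H f /even_mpolyP hf; apply: linear_eq_monomials => // k /hf ok.
exact: (H _ _ ok (homog_monomial _ k)).
Qed.

Lemma evenSP v : evenS_val v \in @even_mpoly R. Proof. exact: valP v. Qed.

Lemma even_subst (g : 'M[O]_2) f : f \in @even_mpoly R -> subst g f \in @even_mpoly R.
Proof.
apply: even_linear; first exact: subst_linear.
move=> k ok; apply: (even_homog ok); apply: homog_subst; exact: homog_monomial.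
Qed.

Lemma even_act Q x f : f \in @even_mpoly R -> act Q x f \in @even_mpoly R.
Proof.
apply: even_linear; first exact: act_linear.
move=> k ok; have hk := homog_monomial O k; rewrite /act (ladder_homog _ _ _ hk).
apply: rpredD; first by apply: (even_homog ok); apply: homog_der.
apply: rpredZ; apply: rpredD.
  by apply: (@even_homog (mdeg k).+2); [rewrite /= negbK | exact: homog_qmul].
apply: rpredZ; apply: (@even_homog (mdeg k).-2); last exact: homog_qdiff.
by move: (mdeg k) ok => [|[|d]] //=; rewrite negbK.
Qed.

Definition liftO A : 'M[O]_2 := map_mx polyC (so3_lift A).

Definition evenK A v : M := EvenS (even_subst (liftO A) (evenSP v)).
Definition evenG Q (x : lie_g R) v : M := EvenS (even_act Q x (evenSP v)).

Lemma evenS_eq v v' : evenS_val v = evenS_val v' -> v = v'.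
Proof. exact: val_inj. Qed.

Lemma evenS_linear : linear (@evenS_val R). Proof. by []. Qed.

Lemma evenK_linear A : linear (evenK A).
Proof. by move=> a u v; apply: evenS_eq; rewrite /= subst_linear. Qed.

Lemma evenG_linear Q x : linear (evenG Q x).
Proof. by move=> a u v; apply: evenS_eq; rewrite /= act_linear. Qed.

Lemma subst_even_opp (g : 'M[O]_2) f : f \in @even_mpoly R -> subst (- g) f = subst g f.
Proof.
apply: even_linear_eq; [exact: subst_linear | exact: subst_linear |].
move=> d h; exact: substN.
Qed.

Lemma evenK_lift A g v : inK A -> lift_spec A g ->
  evenS_val (evenK A v) = subst (map_mx polyC g) v.
Proof.
move=> kA gA; rewrite /= /liftO; have [->//|->] := lift_spec_uniq (so3_liftP kA) gA.
rewrite (_ : map_mx _ _ = - map_mx polyC g) ?(subst_even_opp _ (evenSP v)) //.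
by apply/matrixP => i j; rewrite !mxE polyCN.
Qed.

Lemma evenK1 v : evenK 1%:M v = v.
Proof.
apply: evenS_eq; have := lift_spec_Ad (det1 C 2); rewrite Ad1 => h.
by rewrite (evenK_lift _ (inK1 R) h) (map_mx1 (@polyC C)) subst1.
Qed.

Lemma evenKM A B v : inK A -> inK B -> evenK (A *m B) v = evenK A (evenK B v).
Proof.
move=> kA kB; apply: evenS_eq.
rewrite (evenK_lift _ (inKM kA kB) (lift_specM kA kB (so3_liftP kA) (so3_liftP kB))).
transitivity (subst (liftO A *m liftO B) v); last exact/esym/substM.
have E : map_mx polyC (so3_lift A *m so3_lift B) =
    map_mx polyC (so3_lift A) *m map_mx polyC (so3_lift B).
  exact: (map_mxM (@polyC C) (so3_lift A) (so3_lift B)).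
by rewrite E.
Qed.

Lemma evenK_N1 v : evenK (- 1%:M) v = v.
Proof.
apply: evenS_eq.
by rewrite (evenK_lift _ (inKN1 R) (lift_specN1 R)) (map_mx1 (@polyC C)) subst1.
Qed.

Lemma even_bform l (x : 'cV[O]_(l.*2.+1)) : bform x \in @even_mpoly R.
Proof. by apply: (@even_homog l.*2); [rewrite odd_double | exact: bform_homog]. Qed.

Definition emb l (x : 'cV[O]_(l.*2.+1)) : M := EvenS (even_bform x).
Arguments emb : clear implicits.

Lemma emb_linear l : linear (emb l).
Proof. by move=> a x y; apply: evenS_eq; exact: bform_linear. Qed.

Lemma emb_inj l : injective (emb l).
Proof. by move=> x y /(congr1 (@evenS_val R)); exact: bform_inj. Qed.

Lemma evenK_emb l A x : evenK A (emb l x) = emb l (map_mx polyC (rhoW l A) *m x).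
Proof.
apply: evenS_eq; rewrite /= subst_bform; congr (bform (_ *m _)).
exact/esym/(map_subrep (@polyC C)).
Qed.

Lemma even_ind (P : M -> Prop) : P 0 -> (forall u v, P u -> P v -> P (u + v)) ->
  (forall l c j, P (c *: emb l (delta_mx j 0))) -> forall v, P v.
Proof.
move=> P0 PD PX v; have /even_mpolyP hv := evenSP v.
have [w wE] : exists w : 'X_{1..2} -> M, forall k, ~~ odd (mdeg k) ->
    evenS_val (w k) = 'X_[k] /\ forall c, P (c *: w k).
  exists (fun k => emb (mdeg k)./2
    (\col_i (i == inord (k 1) :> 'I_((mdeg k)./2.*2.+1))%:R)) => k ok.
  have dk : (mdeg k)./2.*2 = mdeg k by rewrite -[RHS]odd_double_half (negbTE ok).
  have E : (\col_i (i == inord (k 1))%:R : 'cV[O]_((mdeg k)./2.*2.+1)) = delta_mx (inord (k 1)) 0.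
    by apply/matrixP => i j; rewrite !mxE (ord1 j) eqxx andbT.
  rewrite E; split=> [|c]; last exact: PX.
  rewrite /= bform_delta inordK; last by rewrite dk ltnS mdegE sum2E leq_addl.
  by rewrite dk -mono_eta_deg.
have -> : v = \sum_(k <- msupp v) (evenS_val v)@_k *: w k.
  apply: evenS_eq; rewrite (lin_sum evenS_linear) [LHS]mpolyE.
  apply: eq_big_seq => k /hv ok; rewrite (linZ evenS_linear).
  by have [-> _] := wE k ok.
rewrite big_seq; elim/big_ind: _ => // k /hv ok.
by have [_] := wE k ok; apply.
Qed.

Lemma even_free : free_module M.
Proof.
exists {k : 'X_{1..2} | ~~ odd (mdeg k)}.
have b_even (k : {k : 'X_{1..2} | ~~ odd (mdeg k)}) : 'X_[val k] \in @even_mpoly R.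
  by apply: (even_homog (valP k)); exact: homog_monomial.
exists (fun k => EvenS (b_even k)); split=> [v|s c us].
  exists (pmap insub (msupp v)), (fun k => (evenS_val v)@_(val k)).
  apply: evenS_eq; rewrite (lin_sum evenS_linear) [LHS]mpolyE.
  transitivity (\sum_(k <- map val (pmap insub (msupp v) :
     seq {k : 'X_{1..2} | ~~ odd (mdeg k)})) (evenS_val v)@_k *: 'X_[k]).
    rewrite (pmap_filter (insubK _)); congr (bigop _ _ _); apply/esym/all_filterP.
    by apply/allP => k kv /=; rewrite insubT //; have /even_mpolyP := evenSP v; apply.
  by rewrite big_map; apply: eq_bigr => k _; rewrite (linZ evenS_linear).
move=> /(congr1 (@evenS_val R)); rewrite (lin_sum evenS_linear) => E k ks.
have := congr1 (mcoeff (val k)) E; rewrite mcoeff0 raddf_sum /= (big_rem k ks) /=.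
rewrite mcoeffZ mcoeffX eqxx mulr1 big_seq big1 ?addr0 // => j.
rewrite mem_rem_uniq // => /andP[jk _]; rewrite mcoeffZ mcoeffX val_eqE.
by rewrite (negbTE jk) mulr0.
Qed.

Lemma even_locally_finite : locally_finite_algebraic evenK.
Proof.
move=> v; elim/even_ind: v => [|u v [n [w [p [[c uE] wE]]]] [n' [w' [p' [[c' vE] wE']]]]|l a j].
- exists 0, (fun=> 0), (fun _ _ => 0); split; last by move=> A _ [].
  by exists (fun=> 0); rewrite big_ord0.
(* The union of the two spanning families, with block diagonal matrix coefficients. *)
- pose W (s : 'I_n + 'I_n') := match s with inl i => w i | inr i => w' i end.
  pose P s t := match s, t with inl i, inl j => p i j | inr i, inr j => p' i j | _, _ => 0 end.
  exists (n + n')%N, (fun i => W (split i)), (fun i j => P (split i) (split j)).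
  have sl (i : 'I_n) : split (lshift n' i) = inl i by rewrite (unsplitK (inl i)).
  have sr (i : 'I_n') : split (rshift n i) = inr i by rewrite (unsplitK (inr i)).
  have m0 A : mxeval (0 : {mpoly C[3 * 3]}) A = 0 by exact: meval0.
  split.
    exists (fun i => match split i with inl i => c i | inr i => c' i end).
    rewrite big_split_ord uE vE /=; congr (_ + _); apply: eq_bigr => i _.
      by rewrite sl.
    by rewrite sr.
  move=> A kA j; rewrite big_split_ord /=.
  case: (split_ordP j) => i _ /=.
    rewrite wE // [X in _ + X]big1 ?addr0.
      by apply: eq_bigr => k _; rewrite sl.
    by move=> k _; rewrite sr /= m0 polyC0 scale0r.
  rewrite wE' // [X in X + _]big1 ?add0r.
    by apply: eq_bigr => k _; rewrite sr.
  by move=> k _; rewrite sl /= m0 polyC0 scale0r.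
have [_ _ [p pE]] := rhoW_algebraic R l.
exists l.*2.+1, (fun i => a *: emb l (delta_mx i 0)), p; split.
  exists (fun i => (i == j)%:R); rewrite (bigD1 j) //= eqxx scale1r big1 ?addr0 // => i ij.
  by rewrite (negbTE ij) scale0r.
move=> A kA k; rewrite (linZ (evenK_linear A)) evenK_emb.
have -> : map_mx polyC (rhoW l A) *m (delta_mx k 0 : 'cV[O]_(l.*2.+1)) =
    \sum_i (mxeval (p i k) A)%:P *: delta_mx i 0.
  apply/matrixP => i z; rewrite (ord1 z) summxE [LHS]mxE.
  rewrite (bigD1 k isT) /= big1 => [|t tk]; last first.
    by rewrite [X in _ * X]mxE (negbTE tk) mulr0.
  rewrite addr0 [X in _ * X]mxE !eqxx mulr1 (bigD1 i isT) /= big1 => [|t ti].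
    by rewrite addr0 [LHS]mxE pE // [RHS]mxE [X in _ = _ * X]mxE !eqxx mulr1.
  by rewrite !mxE [i == t]eq_sym (negbTE ti) mulr0.
rewrite (lin_sum (@emb_linear l)) scaler_sumr; apply: eq_bigr => i _.
by rewrite (linZ (@emb_linear l)) !scalerA mulrC.
Qed.

End EvenModule.
Arguments emb {R l} x.

(** * Isotypical summands of the model *)

Section Isotypical.
Variable R : realType.
Local Notation C := R[i].
Local Notation O := {poly C}.
Local Notation M := (evenS R).
Implicit Types (A : 'M[C]_3) (v : M) (l r : nat).

(** The coefficient of T^r in the part of degree 2l: an equivariant projection onto a
    finite-dimensional complex representation, to which Schur's lemma applies. *)
Definition comp l r v : 'cV[C]_(l.*2.+1) :=
  \col_i ((evenS_val v)@_(mono (l.*2 - i) i))`_r.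

Lemma comp_linear l r a u v : comp l r (a%:P *: u + v) = a *: comp l r u + comp l r v.
Proof.
by apply/matrixP => i j; rewrite !mxE /= mcoeffD mcoeffZ coefD coefCM.
Qed.

Lemma coef_emb l l' (x : 'cV[O]_(l'.*2.+1)) (i : 'I_(l.*2.+1)) : l != l' ->
  (evenS_val (emb x))@_(mono (l.*2 - i) i) = 0.
Proof.
move=> ll'; apply: dhomog_nemf_coeff (bform_homog x) _.
by rewrite /= mdeg_mono_sub; apply: contra ll' => /eqP /double_inj ->.
Qed.

Lemma comp_evenK l r A v : comp l r (evenK A v) = rhoW l A *m comp l r v.
Proof.
elim/even_ind: v => [|u v IHu IHv|l' c j].
- rewrite (lin0 (evenK_linear A)) (_ : comp l r 0 = 0) ?mulmx0 //.
  by apply/matrixP => i k; rewrite !mxE /= mcoeff0 coef0.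
- have cD x y : comp l r (x + y) = comp l r x + comp l r y.
    by rewrite -[x]scale1r -polyC1 comp_linear scale1r polyC1 scale1r.
  by rewrite (linD (evenK_linear A)) !cD IHu IHv mulmxDr.
rewrite (linZ (evenK_linear A)) evenK_emb.
have [->|ll'] := eqVneq l l'; last first.
  have z x : comp l r (c *: emb (l := l') x) = 0.
    by apply/matrixP => i k; rewrite !mxE /= mcoeffZ coef_emb // mulr0 coef0.
  by rewrite !z mulmx0.
have cE (x : 'cV[O]_(l'.*2.+1)) : comp l' r (c *: emb x) = \col_i (c * x i 0)`_r.
  by apply/matrixP => i k; rewrite !mxE /= mcoeffZ coef_bform.
rewrite !cE -colE.
have -> : (\col_i (c * (delta_mx j 0 : 'cV[O]_(l'.*2.+1)) i 0)`_r : 'cV[C]_(l'.*2.+1)) =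
    c`_r *: delta_mx j 0.
  by apply/matrixP => i k; rewrite (ord1 k) !mxE; case: (_ && _);
    rewrite ?mulr1 ?mulr0 ?coef0.
rewrite -scalemxAr -colE; apply/matrixP => i k.
rewrite [LHS]mxE [in LHS]mxE [in LHS]mxE [RHS]mxE [in RHS]mxE. by rewrite coefMC mulrC.
Qed.

Lemma homog_emb l v : evenS_val v \is l.*2.-homog -> exists x, v = emb (l := l) x.
Proof.
by move=> hv; exists (\col_i (evenS_val v)@_(mono (l.*2 - i) i)); apply: evenS_eq;
  exact: homog_bformE.
Qed.

Lemma comp_emb l v : (forall l' r, l' != l -> comp l' r v = 0) ->
  exists x, v = emb (l := l) x.
Proof.
move=> H; apply: homog_emb; apply/dhomogP => k kv /=.
have ok : ~~ odd (mdeg k) by have /even_mpolyP := evenSP v; apply.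
have dk : (mdeg k)./2.*2 = mdeg k by rewrite -[RHS]odd_double_half (negbTE ok).
have [<-|ne] := eqVneq (mdeg k)./2 l; first by rewrite dk.
move: kv; rewrite mcoeff_msupp => /eqP[]; apply/polyP => r; rewrite coef0.
have k1 : (k 1%R < (mdeg k)./2.*2.+1)%N by rewrite dk ltnS mdegE sum2E leq_addl.
have := congr1 (fun X : 'cV_ _ => X (Ordinal k1) 0) (H _ r ne).
by rewrite !mxE /= -(mono_eta_deg (esym dk)).
Qed.

Lemma cV_sum_delta (F : comNzRingType) n (w : 'cV[F]_n) :
  w = \sum_j w j 0 *: delta_mx j 0.
Proof.
apply/matrixP => i k; rewrite (ord1 k) summxE (bigD1 i isT) /= big1 => [|j ji].
  by rewrite addr0 !mxE !eqxx mulr1.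
by rewrite !mxE eq_sym (negbTE ji) mulr0.
Qed.

Lemma linear_cV_mx (F : comNzRingType) n m (L : 'cV[F]_n -> 'cV[F]_m) :
  linear L -> forall w, L w = (\matrix_(i, j) L (delta_mx j 0) i 0) *m w.
Proof.
move=> Ll w; rewrite {1}[w]cV_sum_delta (lin_sum Ll); apply/matrixP => i k.
rewrite (ord1 k) summxE mxE; apply: eq_bigr => j _.
by rewrite (linZ Ll) !mxE mulrC.
Qed.

Variables (n : nat) (rho : 'M[C]_3 -> 'M[C]_n).

Lemma intertwiner_comp (phi : 'cV[C]_n -> M) l r : irreducible_rep rho ->
  intertwiner (@evenK R) rho phi ->
  exists2 B : 'M[C]_(l.*2.+1, n), forall w, comp l r (phi w) = B *m w &
    B = 0 \/ ((forall A, inK A -> B *m rho A = rhoW l A *m B) /\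
      exists B' : 'M[C]_(n, l.*2.+1), B *m B' = 1%:M /\ B' *m B = 1%:M).
Proof.
move=> irr [plin pK].
have Ll : linear (fun w => comp l r (phi w)) by move=> a x y; rewrite plin comp_linear.
exists (\matrix_(i, j) comp l r (phi (delta_mx j 0)) i 0); first exact: linear_cV_mx.
set B := \matrix_(i, j) _.
have BE w : comp l r (phi w) = B *m w by exact: (linear_cV_mx Ll).
have Brho A : inK A -> B *m rho A = rhoW l A *m B.
  move=> kA; apply/matrixP => i j.
  have E : (B *m rho A) *m delta_mx j 0 = (rhoW l A *m B) *m (delta_mx j 0 : 'cV_n).
    by rewrite -!mulmxA -!BE -comp_evenK pK.
  have := congr1 (fun X : 'cV_ _ => X i 0) E.
  by rewrite -!colE !mxE.
by case: (schur irr (rhoW_irreducible R l) Brho) => H; [left | right].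
Qed.

(** When rho is equivalent to [rhoW l], Schur's lemma kills the components of an intertwiner in
    every other degree; conversely each basis vector of [emb] spans, with its K-translates, a copy
    of rho. *)
Lemma isotypical_emb l (B : 'M[C]_(l.*2.+1, n)) (B' : 'M[C]_(n, l.*2.+1)) :
  irreducible_rep rho -> B *m B' = 1%:M -> B' *m B = 1%:M ->
  (forall A, inK A -> B *m rho A = rhoW l A *m B) ->
  forall v, isotypical (@evenK R) rho v <-> exists x, v = emb (l := l) x.
Proof.
move=> irr BB' B'B Brho v; split; last first.
  move=> [x ->]; exists l.*2.+1, (fun k w => x k 0 *: emb (l := l) (map_mx polyC (B *m w))),
    (fun k => B' *m delta_mx k 0).
  split=> [k|]; last first.
    rewrite {1}[x]cV_sum_delta (lin_sum (@emb_linear R l)); apply: eq_bigr => k _.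
    rewrite (linZ (@emb_linear R l)) mulmxA BB' mul1mx; congr (_ *: emb _).
    by apply/matrixP => i j; rewrite !mxE; case: (_ && _); rewrite ?polyC1 ?polyC0.
  split=> [a w w'|A kA w].
    have -> : map_mx polyC (B *m (a *: w + w')) =
        a%:P *: map_mx polyC (B *m w) + map_mx polyC (B *m w').
      by rewrite mulmxDr -scalemxAr; apply/matrixP => i j; rewrite !mxE polyCD polyCM.
    by rewrite emb_linear scalerDr !scalerA mulrC.
  rewrite (linZ (evenK_linear A)) evenK_emb mulmxA Brho // -mulmxA.
  congr (_ *: emb _); exact: (map_mxM (@polyC C)).
move=> [m [phi [w [phiI ->]]]].
have H i : exists x, phi i (w i) = emb (l := l) x.
  apply: comp_emb => l' r ll'.
  have [D -> [->|[_ [D' [DD' D'D]]]]] := intertwiner_comp l' r irr (phiI i).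
    by rewrite mul0mx.
  (* Two-sided inverses force equal dimensions, so the two degrees agree. *)
  have e1 := mulmx1_min BB'; have e2 := mulmx1_min B'B.
  have e3 := mulmx1_min DD'; have e4 := mulmx1_min D'D.
  have : l'.*2.+1 = l.*2.+1.
    by apply/eqP; rewrite eqn_leq (leq_trans e3 e2) (leq_trans e1 e4).
  by case=> /double_inj E; rewrite E eqxx in ll'.
exists (\sum_i sval (boolp.cid (H i))); rewrite (lin_sum (@emb_linear R l)).
by apply: eq_bigr => i _; case: boolp.cid.
Qed.

Lemma isotypical_trivial : irreducible_rep rho ->
  (forall l (B : 'M[C]_(l.*2.+1, n)) (B' : 'M[C]_(n, l.*2.+1)),
     B *m B' = 1%:M -> B' *m B = 1%:M ->
     (forall A, inK A -> B *m rho A = rhoW l A *m B) -> False) ->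
  forall v, isotypical (@evenK R) rho v <-> v = 0.
Proof.
move=> irr none v; split=> [|->]; last first.
  exists 0, (fun _ _ => 0), (fun=> 0); split; last by rewrite big_ord0.
  by case.
move=> [m [phi [w [phiI ->]]]]; apply: big1 => i _.
have Z l r : comp l r (phi i (w i)) = 0.
  have [D -> [->|[Drho [D' [DD' D'D]]]]] := intertwiner_comp l r irr (phiI i).
    by rewrite mul0mx.
  by case: (none l D D' DD' D'D Drho).
(* The vanishing of the components outside degree 0 puts the vector in degree 0, and those in degree
   0 then kill it. *)
have [x xE] : exists x, phi i (w i) = emb (l := 0) x by apply: comp_emb => l r _.
have : x = 0.
  apply/matrixP => k j; rewrite (ord1 j) [RHS]mxE; apply/polyP => r; rewrite coef0.
  have := congr1 (fun X : 'cV_ _ => X k 0) (Z 0%N r).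
  by rewrite xE !mxE /= coef_bform.
by rewrite xE => ->; exact: (lin0 (@emb_linear R 0)).
Qed.

Lemma even_isotypical_free : irreducible_rep rho ->
  fg_free_submodule (isotypical (@evenK R) rho).
Proof.
move=> irr; have [H|none] := boolp.pselect (exists l (B : 'M[C]_(l.*2.+1, n))
  (B' : 'M[C]_(n, l.*2.+1)), [/\ B *m B' = 1%:M, B' *m B = 1%:M &
     forall A, inK A -> B *m rho A = rhoW l A *m B]); last first.
  exists 0, (fun=> 0); split=> [v|c _ []//].
  rewrite isotypical_trivial // => [|l B B' E1 E2 E3]; last by apply: none; exists l, B, B'.
  split=> [->|[c ->]]; last by rewrite big_ord0.
  by exists (fun=> 0); rewrite big_ord0.
have [l [B [B' [E1 E2 E3]]]] := H.
exists l.*2.+1, (fun k => emb (l := l) (delta_mx k 0)).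
have sE (c : 'I_(l.*2.+1) -> O) :
    \sum_(i < l.*2.+1) c i *: emb (l := l) (delta_mx i 0) = emb (\col_i c i).
  rewrite [X in _ = emb X]cV_sum_delta (lin_sum (@emb_linear R l)).
  by apply: eq_bigr => i _; rewrite (linZ (@emb_linear R l)) mxE.
split=> [v|c].
  rewrite (isotypical_emb irr E1 E2 E3); split=> [[x ->]|[c ->]].
    exists (fun i => x i 0); rewrite sE; congr emb.
    by apply/matrixP => i j; rewrite (ord1 j) mxE.
  by rewrite sE; exists (\col_i c i).
rewrite sE -(lin0 (@emb_linear R l)) => /emb_inj /matrixP E i.
by have := E i 0; rewrite !mxE.
Qed.

End Isotypical.

(** * The model as a Harish-Chandra family *)

Section EvenFamily.
Variable R : realType.
Local Notation C := R[i].
Local Notation O := {poly C}.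
Local Notation S := {mpoly O[2]}.
Local Notation M := (evenS R).
Implicit Types (A : 'M[C]_3) (v : M).

Lemma curve_poly_mpoly (q : {poly S}) :
  curve (fun z : C => q.[z%:P%:MP] : cmod S) (fun j => q`_j : cmod S).
Proof.
exists (size q); split=> [j /(nth_default 0)//|z].
rewrite horner_coef; apply: eq_bigr => j _.
rewrite cscaleE -mul_mpolyC mulrC; congr (_ * _).
rewrite [in RHS](rmorphXn (@polyC C)) [RHS](rmorphXn (@mpolyC 2 O)); exact: erefl.
Qed.

(** The orbit under exp(z m) is expanded twice, by substitution and by the given expression of the
    orbit map; the linear coefficients agree. *)
Lemma even_infinitesimal_nil m v n (w : 'I_n -> M) (p : 'I_n -> {mpoly C[3 * 3]}) :
  nil2 m -> (forall A, inK A -> evenK A v = \sum_(i < n) (mxeval (p i) A)%:P *: w i) ->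
  der (map_mx polyC m) v =
  evenS_val (\sum_(i < n) (mxderiv1 (p i) (tang m))%:P *: w i).
Proof.
move=> nm E; have [q [qE _ <-]] := subst_one_par (map_mx polyC m) (evenS_val v).
pose Qi i := sval (boolp.cid (mxeval_one_par (p i) m)).
have QE i z : (Qi i).[z] = mxeval (p i) (one_par m z).
  by rewrite /Qi; case: boolp.cid => x /= [].
have Q1 i : (Qi i)`_1 = mxderiv1 (p i) (tang m).
  by rewrite /Qi; case: boolp.cid => x /= [].
have c1 := curve_poly_mpoly q.
have c2 := curve_sum (index_enum 'I_n) (fun i => curve_poly (Qi i) (evenS_val (w i) : cmod S)).
have h : (fun z : C => q.[z%:P%:MP] : cmod S) =1
    (fun z => \sum_(i < n) (Qi i).[z] *: (evenS_val (w i) : cmod S)).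
  move=> z; rewrite qE.
  have -> : 1%:M + z%:P *: map_mx polyC m = map_mx polyC (1%:M + z *: m).
    by apply/matrixP => i j; rewrite !mxE polyCD polyCM; case: (i == j).
  rewrite -(evenK_lift _ (one_par_orth z nm) (lift_spec_Ad (nil2_det z nm))).
  rewrite E; last exact: one_par_orth.
  rewrite (lin_sum (@evenS_linear R)); apply: eq_bigr => i _.
  by rewrite QE (linZ (@evenS_linear R)).
rewrite (curve_uniq (curve_ext h c1) c2 1) (lin_sum (@evenS_linear R)).
by apply: eq_bigr => i _; rewrite Q1 (linZ (@evenS_linear R)).
Qed.

(** Both sides are linear in [m], and sl(2) is spanned by nilpotents. *)
Lemma even_infinitesimal m v n (w : 'I_n -> M) (p : 'I_n -> {mpoly C[3 * 3]}) :
  \tr m = 0 -> (forall A, inK A -> evenK A v = \sum_(i < n) (mxeval (p i) A)%:P *: w i) ->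
  der (map_mx polyC m) v =
  evenS_val (\sum_(i < n) (mxderiv1 (p i) (tang m))%:P *: w i).
Proof.
move=> tm E; elim/sl2_nil_ind: m / tm => [m nm|a m m' IH IH'].
  exact: even_infinitesimal_nil.
have -> : map_mx polyC (a *: m + m') = a%:P *: map_mx polyC m + map_mx polyC m'.
  by apply/matrixP => i j; rewrite !mxE polyCD polyCM.
rewrite der_linearl IH IH' -evenS_linear; congr evenS_val.
rewrite scaler_sumr -big_split; apply: eq_bigr => i _ /=.
by rewrite tang_linear mxderiv1_linear polyCD polyCM scalerDl scalerA.
Qed.

Variable Q : O.

Lemma evenG_linearl v : linear (fun x => evenG Q x v).
Proof. by move=> a x y; apply: evenS_eq; rewrite /= act_linearl. Qed.

Lemma evenG_bracket x y v :
  evenG Q (bracket x y) v = evenG Q x (evenG Q y v) - evenG Q y (evenG Q x v).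
Proof.
apply: evenS_eq; apply: (even_linear_eq (L := act Q (bracket x y))
  (L' := fun f => act Q x (act Q y f) - act Q y (act Q x f)) _ _ _ (evenSP v)).
- exact: act_linear.
- by move=> a f g; rewrite !act_linear scalerBr opprD addrACA.
by move=> d f; exact: homog_act_comm.
Qed.

Lemma evenG_equivariant A x v : inK A ->
  evenK A (evenG Q x v) = evenG Q (adK A x) (evenK A v).
Proof.
move=> kA; have [d1 d2] := so3_liftP kA; apply: evenS_eq.
exact: act_equivariant.
Qed.

Lemma evenG_infinitesimal i v :
  infinitesimal (@evenK R) (soE R i) v (evenG Q (- gL R i) v).
Proof.
move=> n w p E; apply: evenS_eq.
rewrite -tang_sl2E -(even_infinitesimal (tr_sl2E C i) E) /=.
have al : linear (fun x => act Q x v) by move=> a x y; rewrite act_linearl.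
by rewrite (linN al) act_gL opprK.
Qed.

Lemma env_act_linear (F : lmodType O) (a : lie_g R -> F -> F) u :
  (forall x, linear (a x)) -> linear (env_act a u).
Proof.
move=> al; elim: u => [p|x|u IHu w IHw|u IHu w IHw] c f g /=.
- by rewrite scalerDr !scalerA mulrC.
- exact: al.
- by rewrite IHu IHw scalerDr addrACA.
by rewrite IHw IHu.
Qed.

Definition evenHC : HC_family R :=
  HCFamily (@even_free R) (fun A _ => evenK_linear A) (@evenK1 R) 
   (fun A B kA kB v => evenKM v kA kB) (@even_locally_finite R) (@even_isotypical_free R)
   evenG_linearl (evenG_linear Q) evenG_bracket
   (fun A kA x v => evenG_equivariant x v kA) evenG_infinitesimal.

Lemma evenHC_value : TL2_R2_value evenHC Q.
Proof.
move=> v; apply: evenS_eq. 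
transitivity (env_act (act Q) (env_TL2_R2 R) (evenS_val v)); first by [].
rewrite (linZ (@evenS_linear R)).
apply: (even_linear_eq (L := env_act (act Q) (env_TL2_R2 R)) (L' := fun f => Q *: f)
  _ _ _ (evenSP v)).
- by apply: env_act_linear => x; exact: act_linear.
- by move=> a f g; rewrite scalerDr !scalerA mulrC.
by move=> d f; exact: act_homog_value.
Qed.

End EvenFamily.

(** * Classification of the irreducible representations *)

Section CurveMaps.
Variables (C : numFieldType) (V W : lmodType C).

Lemma curve_at0 (f : C -> V) u : curve f u -> f 0 = u 0.
Proof.
move=> [[|m] [u0 ->]]; first by rewrite big_ord0 u0.
rewrite big_ord_recl expr0 scale1r big1 ?addr0 // => i _.
by rewrite lift0 expr0n scale0r.
Qed.

Lemma curve_linear (L : V -> W) f u :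
  linear L -> curve f u -> curve (fun z => L (f z)) (fun j => L (u j)).
Proof.
move=> Ll [m [u0 fE]]; exists m; split=> [j /u0 ->|z]; first exact: lin0.
by rewrite fE (lin_sum Ll); apply: eq_bigr => j _; rewrite (linZ Ll).
Qed.

Lemma curve_shift (f : C -> V) u :
  curve f u -> curve (fun z => z *: f z) (fun j => if j is j'.+1 then u j' else 0).
Proof.
move=> [m [u0 fE]]; exists m.+1; split=> [[//|j] /u0 //|z].
rewrite big_ord_recl scaler0 add0r fE scaler_sumr; apply: eq_bigr => j _.
by rewrite lift0 scalerA exprS.
Qed.

Lemma curve_coef_eq (f g : C -> V) u (v : nat -> V) :
  curve f u -> curve g v -> u =1 v -> f =1 g.
Proof.
move=> [m [u0 fE]] [n [u0' gE]] uv z.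
rewrite (curve_widen u0 fE (leq_maxl m n)) (curve_widen u0' gE (leq_maxr m n)).
by apply: eq_bigr => j _; rewrite uv.
Qed.

End CurveMaps.

(** * Highest weight theory for sl(2) *)

Section HighestWeight.
Variables (A : comNzRingType) (V : lmodType A) (e f h : V -> V) (v : V) (lam : A).
Hypothesis fl : linear f.
Hypotheses (hf : forall x, h (f x) = f (h x) - 2 *: f x).
Hypotheses (ef : forall x, e (f x) = f (e x) + h x).
Hypotheses (ev : e v = 0) (hv : h v = lam *: v).

Lemma weight_lower k : h (iter k f v) = (lam - 2 * k%:R) *: iter k f v.
Proof.
elim: k => [|k IH]; first by rewrite mulr0 subr0.
rewrite iterS hf IH (linZ fl) -scalerBl; congr (_ *: _).
by rewrite -[k.+1]addn1 natrD; ring.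
Qed.

Lemma raise_lower k : e (iter k.+1 f v) = (k.+1%:R * (lam - k%:R)) *: iter k f v.
Proof.
elim: k => [|k IH]; first by rewrite /= ef ev (lin0 fl) add0r hv subr0 mul1r.
rewrite iterS ef IH (linZ fl) -iterS weight_lower -scalerDl; congr (_ *: _).
by rewrite -[k.+2]addn1 -[k.+1]addn1 !natrD; ring.
Qed.

End HighestWeight.

(** Comparing linear coefficients in the conjugation identity turns it into a commutator. *)
Lemma curve_conj_quadratic (C : numFieldType) n (f : C -> 'M[C]_n) u (D D1 D2 : 'M[C]_n) :
  curve f u -> u 0 = 1%:M ->
  (forall z, f z *m D = (z *: (z *: D2 + D1) + D) *m f z) ->
  u 1 *m D = D *m u 1 + D1.
Proof.
move=> cu u0 E; pose L (Y X : 'M[C]_n) := Y *m X.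
have Ll Y : linear (L Y) by move=> a X Z; rewrite /L mulmxDr scalemxAr.
have c1 : curve (fun z => f z *m D) (fun j => u j *m D).
  by apply: (curve_linear (L := mulmx^~ D)) cu => a X Y; rewrite mulmxDl scalemxAl.
have c2 := curveD (curve_linear (Ll D) cu) (curve_shift (curveD (curve_linear (Ll D1) cu)
  (curve_shift (curve_linear (Ll D2) cu)))).
have h z : f z *m D = L D (f z) + z *: (L D1 (f z) + z *: L D2 (f z)).
  by rewrite E /L !mulmxDl -!scalemxAl mulmxDl -scalemxAl addrC [_ + D1 *m _]addrC.
by have := curve_uniq (curve_ext h c1) c2 1; rewrite /L /= u0 mulmx1 addr0.
Qed.

Section Sl2Matrices.
Variables (C : numClosedFieldType) (n : nat) (X Y Z : 'M[C]_n).
Let e : 'cV[C]_n -> 'cV[C]_n := mulmx X.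
Let f : 'cV[C]_n -> 'cV[C]_n := mulmx Y.
Let h : 'cV[C]_n -> 'cV[C]_n := mulmx Z.
Hypothesis ef : forall x, e (f x) = f (e x) + h x.
Hypothesis he : forall x, h (e x) = e (h x) + 2 *: e x.
Hypothesis hf : forall x, h (f x) = f (h x) - 2 *: f x.
Hypothesis e_nil : forall v, exists N, iter N e v = 0.
Hypothesis f_nil : forall v, exists N, iter N f v = 0.
Hypothesis n_gt0 : (0 < n)%N.

Let el : linear e. Proof. by move=> a x y; rewrite /e mulmxDr scalemxAr. Qed.
Let fl : linear f. Proof. by move=> a x y; rewrite /f mulmxDr scalemxAr. Qed.

Lemma exists_highest_weight : exists v lam, [/\ v != 0, e v = 0 & h v = lam *: v].
Proof.
(* Eigenvectors of matrices are row vectors here, hence the transpose. *)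
have [a] : exists a, root (char_poly Z^T) a.
  by apply/closed_rootP; rewrite size_char_poly eqSS -lt0n.
rewrite -eigenvalue_root_char => /eigenvalueP[w wE w0].
have hw : h w^T = a *: w^T by rewrite /h -[Z]trmxK -trmx_mul wE linearZ.
have hi k : h (iter k e w^T) = (a + 2 * k%:R) *: iter k e w^T.
  elim: k => [|k IH]; first by rewrite mulr0 addr0.
  rewrite iterS he IH (linZ el) -scalerDl; congr (_ *: _).
  by rewrite -[k.+1]addn1 natrD; ring.
have ex : exists N, iter N e w^T == 0.
  by have [N /eqP N0] := e_nil w^T; exists N.
case: (ex_minnP ex) => [[|N]] /eqP eN minN.
  by case/eqP: w0; rewrite -[w]trmxK [w^T]eN trmx0.
exists (iter N e w^T), (a + 2 * N%:R); split=> //.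
by apply/negP => /minN; rewrite ltnn.
Qed.

(** The vectors (k-b)! f^b v are normalized so that e and f act on them as p dq and q dp act on
    p^(k-b) q^b. *)
Lemma exists_ladder : exists k (d : nat -> 'cV[C]_n), [/\ d 0 != 0,
  forall b, (b <= k)%N -> e (d b) = b%:R *: d b.-1 &
  forall b, f (d b) = (k - b)%:R *: d b.+1].
Proof.
have [v [lam [v0 ev hv]]] := exists_highest_weight.
have ex : exists N, iter N f v == 0 by have [N /eqP N0] := f_nil v; exists N.
case: (ex_minnP ex) => [[|k]] /eqP fk mink; first by rewrite [v]fk eqxx in v0.
have fk0 : iter k f v != 0 by apply/negP => /mink; rewrite ltnn.
(* Since f^(k+1) v = 0, applying e gives (k+1)(lam - k) f^k v = 0 with f^k v nonzero. *)
have lamE : lam = k%:R.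
  have /esym/eqP := raise_lower fl hf ef ev hv k.
  by rewrite fk (lin0 el) scaler_eq0 (negbTE fk0) orbF mulf_eq0 pnatr_eq0 subr_eq0 => /eqP.
exists k, (fun b => (k - b)`!%:R *: iter b f v); split=> [|[|b] bk|b].
- by rewrite scaler_eq0 negb_or pnatr_eq0 -lt0n fact_gt0.
- by rewrite (linZ el) ev scaler0 scale0r.
- rewrite (linZ el) (raise_lower fl hf ef ev hv) !scalerA; congr (_ *: _).
  rewrite lamE -natrB ?(ltnW bk) //= -(subnSK bk) factS -!natrM; congr _%:R.
  by rewrite mulnC -mulnA.
rewrite (linZ fl) -iterS scalerA; have [bk|kb] := ltnP b k.
  by rewrite -(subnSK bk) factS natrM.
suff -> : iter b.+1 f v = 0 by rewrite !scaler0.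
by rewrite -(subnK kb) -addnS iterD fk; elim: (_ - _)%N => //= j ->; exact: lin0.
Qed.

End Sl2Matrices.

Lemma intertwine_mul (A : pzRingType) n k (D : 'M[A]_(n, k)) r1 r2 s1 s2 :
  D *m s1 = r1 *m D -> D *m s2 = r2 *m D -> D *m (s1 *m s2) = (r1 *m r2) *m D.
Proof. by move=> E1 E2; rewrite mulmxA E1 -mulmxA E2 mulmxA. Qed.

Section SubrepUnipotent.
Variables (R : realType) (k : nat).
Local Notation C := R[i].

Lemma subrep_up_delta z (b : 'I_k.+1) : subrep k (up z) *m (delta_mx b 0 : 'cV[C]_k.+1) =
  \sum_(j < b.+1) z ^+ j *: ('C(b, j)%:R *: delta_mx (inord (b - j)) 0).
Proof.
have bk : (b <= k)%N by rewrite -ltnS.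
apply: bform_inj; rewrite -subst_bform bform_delta subst_up.
rewrite (lin_sum (@bform_linear C k)); apply: eq_bigr => j _.
rewrite (linZ (@bform_linear C k)) (linZ (@bform_linear C k)) bform_delta inordK; last first.
  by rewrite ltnS; exact: leq_trans (leq_subr _ _) bk.
by rewrite subnA // -ltnS.
Qed.

Lemma subrep_lo_delta z (b : 'I_k.+1) : subrep k (lo z) *m (delta_mx b 0 : 'cV[C]_k.+1) =
  \sum_(j < (k - b).+1) z ^+ j *: ('C(k - b, j)%:R *: delta_mx (inord (b + j)) 0).
Proof.
have bk : (b <= k)%N by rewrite -ltnS.
apply: bform_inj; rewrite -subst_bform bform_delta subst_lo.
rewrite (lin_sum (@bform_linear C k)); apply: eq_bigr => j _.
rewrite (linZ (@bform_linear C k)) (linZ (@bform_linear C k)) bform_delta inordK -?subnDA //.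
by case: j => j /= jk; lia.
Qed.

End SubrepUnipotent.

(** * Representations of SO(3) through their derivative *)

Section Classification.
Variable R : realType.
Local Notation C := R[i].
Variables (n : nat) (rho : 'M[C]_3 -> 'M[C]_n) (p : 'I_n -> 'I_n -> {mpoly C[3 * 3]}).
Hypothesis rho1 : rho 1%:M = 1%:M.
Hypothesis rhoM : forall A B, inK A -> inK B -> rho (A *m B) = rho A *m rho B.
Hypothesis rhoE : forall A, inK A -> forall i j, rho A i j = mxeval (p i j) A.
Implicit Types (m g : 'M[C]_2).

Fact drho_key : unit. Proof. by []. Qed.
Definition drho m : 'M[C]_n :=
  locked_with drho_key (\matrix_(i, j) mxderiv1 (p i j) (tang m)).

Lemma drhoE m i j : drho m i j = mxderiv1 (p i j) (tang m).
Proof. by rewrite /drho unlock mxE. Qed.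

Lemma drho_linear : linear drho.
Proof.
move=> a X Y; apply/matrixP => i j; rewrite drhoE tang_linear mxderiv1_linear.
rewrite [RHS]mxE (drhoE Y).
congr (_ + _).
by rewrite [RHS]mxE drhoE.
Qed.

Lemma drho_curve m : nil2 m ->
  exists u, [/\ curve (fun z => rho (one_par m z)) u, u 0 = 1%:M & u 1 = drho m].
Proof.
move=> nm; pose q i j := sval (boolp.cid (mxeval_one_par (p i j) m)).
have qE i j z : (q i j).[z] = mxeval (p i j) (one_par m z).
  by rewrite /q; case: boolp.cid => x /= [].
have q1 i j : (q i j)`_1 = mxderiv1 (p i j) (tang m).
  by rewrite /q; case: boolp.cid => x /= [].
have c := curve_sum (index_enum 'I_n) (fun i => curve_sum (index_enum 'I_n)
  (fun j => curve_poly (q i j) (delta_mx i j : 'M[C]_n))).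
have c' : curve (fun z => rho (one_par m z)) (fun k => \matrix_(i, j) (q i j)`_k).
  have [N [u0 E]] := c; exists N; split=> [k /u0|z].
    by move=> <-; rewrite [LHS]matrix_sum_delta; apply: eq_bigr => i _;
      apply: eq_bigr => j _; rewrite mxE.
  transitivity (\sum_i \sum_j (q i j).[z] *: (delta_mx i j : 'M[C]_n)).
    rewrite [LHS]matrix_sum_delta; apply: eq_bigr => i _; apply: eq_bigr => j _.
    by rewrite rhoE ?qE //; exact: one_par_orth.
  rewrite E; apply: eq_bigr => k _; congr (_ *: _).
  by rewrite [RHS]matrix_sum_delta; apply: eq_bigr => i _;
    apply: eq_bigr => j _; rewrite mxE.
exists (fun k => \matrix_(i, j) (q i j)`_k); split=> //.
  by rewrite -(curve_at0 c') one_par0.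
by apply/matrixP => i j; rewrite mxE drhoE q1.
Qed.

Lemma rho_exp m (v : 'cV[C]_n) : nil2 m ->
  curve (fun z => rho (one_par m z) *m v)
    (fun j => (j`!%:R)^-1 *: iter j (mulmx (drho m)) v).
Proof.
move=> nm; apply: (@one_param_exp _ _ (fun z => mulmx (rho (one_par m z))) (mulmx (drho m))).
- by move=> w; rewrite one_par0 rho1 mul1mx.
- move=> z w x; rewrite one_parD // rhoM ?mulmxA //; exact: one_par_orth.
move=> x; have [u [cu _ <-]] := drho_curve nm.
exists (fun j => u j *m x) => //.
by apply: (curve_linear (L := mulmx^~ x)) cu => a X Y; rewrite mulmxDl scalemxAl.
Qed.

(** By linearity [m] may be taken nilpotent; then rho (Ad g) conjugates the one-parameter group of m
    into that of its conjugate, and linear coefficients are compared. *)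
Lemma drho_conj g h m : \det g = 1 -> h *m g = 1%:M -> \tr m = 0 ->
  rho (Ad g) *m drho m = drho (g *m m *m h) *m rho (Ad g).
Proof.
move=> dg hg; elim/sl2_nil_ind => [{}m nm|a X Y IX IY]; last first.
  have -> : g *m (a *: X + Y) *m h = a *: (g *m X *m h) + g *m Y *m h.
    by rewrite mulmxDr mulmxDl -scalemxAr -scalemxAl.
  rewrite (drho_linear a X) (drho_linear a (g *m X *m h)).
  move: (drho X) (drho Y) (drho (g *m X *m h)) (drho (g *m Y *m h)) IX IY => X1 Y1 X2 Y2 IX IY.
  by rewrite mulmxDr mulmxDl -scalemxAr -scalemxAl IX IY.
have [u [cu _ <-]] := drho_curve nm.
have nm' := nil2_conj hg nm; have [u' [cu' _ <-]] := drho_curve nm'.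
have c1 : curve (fun z => rho (Ad g) *m rho (one_par m z)) (fun j => rho (Ad g) *m u j).
  by apply: curve_linear cu => a X Y; rewrite mulmxDr scalemxAr.
have c2 : curve (fun z => rho (one_par (g *m m *m h) z) *m rho (Ad g))
    (fun j => u' j *m rho (Ad g)).
  by apply: (curve_linear (L := mulmx^~ (rho (Ad g)))) cu' => a X Y;
    rewrite mulmxDl scalemxAl.
apply: (curve_uniq (curve_ext _ c1) c2) => z /=.
have E : g *m (1%:M + z *: m) = (1%:M + z *: (g *m m *m h)) *m g.
  by rewrite mulmxDr mulmxDl mulmx1 mul1mx -scalemxAl -scalemxAr
     -(mulmxA (g *m m)) hg mulmx1.
apply: etrans (esym (rhoM (inK_Ad dg) (one_par_orth z nm))) _.
apply: etrans _ (rhoM (one_par_orth z nm') (inK_Ad dg)).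
exact/congr1/(etrans (esym (AdM _ _)))/(etrans (congr1 (@Ad C) E))/AdM.
Qed.

(** The linear coefficient in z of conjugation by 1 + z N, which is quadratic in z because N is
    nilpotent. *)
Lemma drho_bracket N m : nil2 N -> \tr m = 0 ->
  drho N *m drho m = drho m *m drho N + drho (N *m m - m *m N).
Proof.
move=> nN tm; have [u [cu u0 <-]] := drho_curve nN; have N2 := nil2_sqr nN.
apply: (curve_conj_quadratic (D2 := drho (- (N *m m *m N))) cu u0) => z.
have gN : (1%:M - z *: N) *m (1%:M + z *: N) = 1%:M.
  rewrite mulmxDr mulmx1 mulmxBl mul1mx -scalemxAl -scalemxAr N2 !scaler0 subr0.
  by rewrite subrK.
apply: etrans (drho_conj (nil2_det z nN) gN tm) _.
suff -> : (1%:M + z *: N) *m m *m (1%:M - z *: N) =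
    z *: (z *: - (N *m m *m N) + (N *m m - m *m N)) + m.
  by rewrite (drho_linear z _ m) (drho_linear z (- (N *m m *m N))).
rewrite mulmxDl mul1mx mulmxBr mulmx1 -!scalemxAl -!scalemxAr mulmxDl -scalemxAl.
move: (N *m m *m N) (N *m m) (m *m N) => Y1 Y2 Y3.
by apply/matrixP => i j; rewrite !mxE; ring.
Qed.

Lemma drho_iter_nil m : nil2 m -> forall v : 'cV[C]_n, exists N, iter N (mulmx (drho m)) v = 0.
Proof.
move=> nm v; have [N [u0 _]] := rho_exp v nm; exists N.
have /eqP := u0 N (leqnn N); rewrite scaler_eq0 invr_eq0 pnatr_eq0.
by rewrite eqn0Ngt fact_gt0 => /eqP.
Qed.

Definition H22 : 'M[C]_2 := mx2 1 0 0 (-1).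

Let tH : \tr H22 = 0.
Proof. by rewrite /mxtrace sum2E !mxE /= subrr. Qed.

Lemma drho_bracket_act N m a m' (x : 'cV[C]_n) :
  nil2 N -> \tr m = 0 -> N *m m - m *m N = a *: m' ->
  drho N *m (drho m *m x) = drho m *m (drho N *m x) + a *: (drho m' *m x).
Proof.
move=> nN tm E; have := drho_bracket nN tm; have := linZ drho_linear a m'; rewrite E.
move: (drho N) (drho m) (drho m') (drho (a *: m')) => X Y Z W -> XY.
by rewrite !mulmxA XY mulmxDl scalemxAl.
Qed.

Lemma rho_ladder : (0 < n)%N -> exists k (d : nat -> 'cV[C]_n), [/\ d 0 != 0,
  forall b, (b <= k)%N -> drho (@E12 C) *m d b = b%:R *: d b.-1 &
  forall b, drho (@E21 C) *m d b = (k - b)%:R *: d b.+1].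
Proof.
have swap1 (u v w : 'cV[C]_n) : u = v + 1 *: w -> u = v + w by rewrite scale1r.
have swapN (u v w : 'cV[C]_n) a : u = v + (- a) *: w -> v = u + a *: w.
  by move=> ->; rewrite scaleNr subrK.
have swap (u v w : 'cV[C]_n) a : u = v + a *: w -> v = u - a *: w.
  by move=> ->; rewrite addrK.
move=> n0; apply: (@exists_ladder C n (drho (@E12 C)) (drho (@E21 C)) (drho H22)) => //.
- move=> x; have E : @E12 C *m @E21 C - @E21 C *m @E12 C = 1 *: H22.
    rewrite /E12 /E21 /H22 !mulmx2.
    by apply/matrixP => i j; elim/ord2P: i; elim/ord2P: j; rewrite !mxE /=; ring.
  exact: swap1 (drho_bracket_act x (nil2_E12 C) (proj1 (nil2_E21 C)) E).
- move=> x; have E : @E12 C *m H22 - H22 *m @E12 C = (- 2) *: @E12 C.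
    rewrite /E12 /H22 !mulmx2.
    by apply/matrixP => i j; elim/ord2P: i; elim/ord2P: j; rewrite !mxE /=; ring.
  exact: swapN (drho_bracket_act x (nil2_E12 C) tH E).
- move=> x; have E : @E21 C *m H22 - H22 *m @E21 C = 2 *: @E21 C.
    rewrite /E21 /H22 !mulmx2.
    by apply/matrixP => i j; elim/ord2P: i; elim/ord2P: j; rewrite !mxE /=; ring.
  exact: swap (drho_bracket_act x (nil2_E21 C) tH E).
- exact/drho_iter_nil/nil2_E12.
exact/drho_iter_nil/nil2_E21.
Qed.

Section Intertwiner.
Let e : 'cV[C]_n -> 'cV[C]_n := mulmx (drho (@E12 C)).
Let f : 'cV[C]_n -> 'cV[C]_n := mulmx (drho (@E21 C)).
Let el : linear e. Proof. by rewrite /e; move: (drho _) => X a x y; rewrite mulmxDr scalemxAr. Qed.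
Let fl : linear f. Proof. by rewrite /f; move: (drho _) => X a x y; rewrite mulmxDr scalemxAr. Qed.
Variables (k : nat) (d : nat -> 'cV[C]_n).
Hypothesis ed : forall b, (b <= k)%N -> e (d b) = b%:R *: d b.-1.
Hypothesis fd : forall b, f (d b) = (k - b)%:R *: d b.+1.

(** Sends the monomial p^(k-j) q^j to [d j]. *)
Let D : 'M[C]_(n, k.+1) := \matrix_(i < n, j < k.+1) d j i 0.

Let D_delta (j : 'I_k.+1) : D *m (delta_mx j 0 : 'cV_k.+1) = d j.
Proof. by rewrite -colE; apply/matrixP => i z; rewrite !mxE (ord1 z). Qed.

Let iter_e b j : (b <= k)%N -> iter j e (d b) = (b ^_ j)%:R *: d (b - j).
Proof.
move=> bk; elim: j => [|j IH]; first by rewrite ffactn0 scale1r subn0.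
rewrite iterS IH (linZ el) ed; last exact: leq_trans (leq_subr _ _) bk.
by rewrite scalerA -natrM -ffactnSr subnS.
Qed.

Let iter_f b j : iter j f (d b) = ((k - b) ^_ j)%:R *: d (b + j).
Proof.
elim: j => [|j IH]; first by rewrite ffactn0 scale1r addn0.
rewrite iterS IH (linZ fl) fd.
by rewrite scalerA -natrM subnDA -ffactnSr addnS.
Qed.

Let bin_scale b j : (j`!%:R)^-1 * (b ^_ j)%:R = 'C(b, j)%:R :> C.
Proof.
by rewrite -bin_ffact natrM mulrC mulfK // pnatr_eq0 -lt0n fact_gt0.
Qed.

(** Both sides are polynomial in z: on monomials the substitution expands by the binomial formula,
    while rho is the exponential series, where falling factorials divided by j! give the same
    binomials. *)
Let intertwines_up z : D *m subrep k (up z) = rho (Ad (up z)) *m D.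
Proof.
apply: mulmx_delta_inj => b; rewrite -!mulmxA D_delta -one_par_up.
have bk : (b <= k)%N by rewrite -ltnS.
pose u j := 'C(b, j)%:R *: d (b - j).
transitivity (\sum_(j < b.+1) z ^+ j *: u j); last first.
  apply: (@curve_coef_eq _ _ (fun z => \sum_(j < b.+1) z ^+ j *: u j)
    (fun z => rho (one_par _ z) *m d b) u _ _ (rho_exp (d b) (nil2_E12 C))) => [|j].
    exists b.+1; split=> [j jb|z'] //; by rewrite /u bin_small // scale0r.
  by rewrite iter_e // scalerA bin_scale.
rewrite subrep_up_delta mulmx_sumr; apply: eq_bigr => j _; rewrite -!scalemxAr D_delta inordK //.
by rewrite ltnS; exact: leq_trans (leq_subr _ _) bk.
Qed.

Let intertwines_lo z : D *m subrep k (lo z) = rho (Ad (lo z)) *m D.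
Proof.
apply: mulmx_delta_inj => b; rewrite -!mulmxA D_delta -one_par_lo.
have bk : (b <= k)%N by rewrite -ltnS.
pose u j := 'C(k - b, j)%:R *: d (b + j).
transitivity (\sum_(j < (k - b).+1) z ^+ j *: u j); last first.
  apply: (@curve_coef_eq _ _ (fun z => \sum_(j < (k - b).+1) z ^+ j *: u j)
    (fun z => rho (one_par _ z) *m d b) u _ _ (rho_exp (d b) (nil2_E21 C))) => [|j].
    exists (k - b).+1; split=> [j jb|z'] //; by rewrite /u bin_small // scale0r.
  by rewrite iter_f // scalerA bin_scale.
rewrite subrep_lo_delta mulmx_sumr; apply: eq_bigr => j _.
rewrite -!scalemxAr D_delta inordK //; by case: j => j /= jk; lia.
Qed.

Lemma ladder_intertwines g : \det g = 1 -> D *m subrep k g = rho (Ad g) *m D.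
Proof.
move=> dg; suff [] : \det g = 1 /\ D *m subrep k g = rho (Ad g) *m D by [].
elim/SL2_ind: dg => {g} [z|z|g g' [dg IH] [dg' IH']].
- by rewrite det_up intertwines_up.
- by rewrite det_lo intertwines_lo.
split; first by rewrite det_mulmx dg dg' mulr1.
have E := etrans (congr1 rho (AdM g g')) (rhoM (inK_Ad dg) (inK_Ad dg')).
apply: etrans (congr1 (mulmx D) (subrepM k g g')) _.
apply: etrans _ (congr1 (mulmx^~ D) (esym E)).
exact: intertwine_mul IH IH'.
Qed.

(** The matrix -1 of SL(2) has trivial image in SO(3) but acts by (-1)^k on p^k. *)
Lemma ladder_even : d 0%N != 0 -> ~~ odd k.
Proof.
apply: contraNN => ok; have dN : \det (- 1%:M : 'M[C]_2) = 1.
  by rewrite -scaleN1r detZ det1 mulr1 expr2 mulrNN mulr1.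
have := congr1 (mulmx^~ (delta_mx ord0 0 : 'cV[C]_k.+1)) (ladder_intertwines dN).
rewrite AdN Ad1 rho1 mul1mx D_delta -mulmxA.
have -> : subrep k (- 1%:M) *m (delta_mx ord0 0 : 'cV[C]_k.+1) = - delta_mx ord0 0.
  apply: bform_inj; rewrite -subst_bform (linN (@bform_linear C k)) bform_delta.
  rewrite subst_mono subn0 monoE0 monoE1 monoX !expr0 !mulr1.
  have -> : linform (- 1%:M) 0 = - 'X_0 :> {mpoly C[2]}.
    by rewrite -scaleN1r (linZ (fun a => @linform_linear C 0 a)) scaleN1r linform1.
  by rewrite exprNn -signr_odd ok mulN1r.
rewrite mulmxN D_delta /= => /eqP; rewrite -subr_eq0 -opprD oppr_eq0 -mulr2n.
by rewrite -scaler_nat scaler_eq0 pnatr_eq0.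
Qed.

Lemma ladder_mx0 : D *m (delta_mx ord0 0 : 'cV_k.+1) = d 0.
Proof. exact: D_delta. Qed.

End Intertwiner.

Lemma rho_highest_weight : (0 < n)%N -> rho (- 1%:M) = 1%:M ->
  exists l (D : 'M[C]_(n, l.*2.+1)), D != 0 /\
    forall A, inK A -> D *m rhoW l A = rho A *m D.
Proof.
move=> n0 rN; have [k [d [d0 ed fd]]] := rho_ladder n0.
have := ladder_mx0 k d; have := ladder_intertwines ed fd.
have /negbTE ok := ladder_even ed fd d0.
have [l ->] : exists l, k = l.*2 by exists k./2; rewrite -[LHS]odd_double_half ok.
set D := \matrix_(_, _) _ => DE D0; exists l, D; split.
  by apply: contraNneq d0 => D00; rewrite -D0 D00 mul0mx.
move=> A kA; have [dg gA] := so3_liftP kA; have := DE _ dg; rewrite /rhoW gA.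
have [->|dA] := inK_unit_det kA; first by rewrite scale1r.
rewrite dA scaleN1r => ->.
(* When det A = -1 the lift covers -A, and -1 acts trivially. *)
suff -> : rho A = rho (- A) by [].
have AN : - A = - 1%:M *m A by rewrite mulNmx mul1mx.
by apply/esym; rewrite AN (rhoM (inKN1 R) kA) rN mul1mx.
Qed.

End Classification.

(** The intertwiner from a highest weight vector is invertible by Schur's lemma, and the dimension
    2l + 1 determines l. *)
Lemma is_W_rhoW (R : realType) l (rho : 'M[R[i]]_3 -> 'M[R[i]]_(l.*2.+1)) : is_W rho ->
  exists B B' : 'M[R[i]]_(l.*2.+1), [/\ B *m B' = 1%:M, B' *m B = 1%:M &
    forall A, inK A -> B *m rho A = rhoW l A *m B].
Proof.
move=> [irr rN]; have [[r1 rM [p pE]] n0 _] := irr.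
have [l' [D [D0 DE]]] := rho_highest_weight r1 rM pE n0 rN.
have [E|[D' [DD' D'D]]] := schur (rhoW_irreducible R l') irr DE.
  by rewrite E eqxx in D0.
have ll : l' = l.
  have e1 := mulmx1_min DD'; have e2 := mulmx1_min D'D.
  have : l'.*2.+1 = l.*2.+1 by apply/eqP; rewrite eqn_leq e2 e1.
  by case=> /double_inj.
move: D D' {D0} DE DD' D'D; rewrite ll => D D' DE DD' D'D.
exists D', D; split=> // A kA.
move: (DE A kA); move: (rho A) (rhoW l A) => X Y XY.
by rewrite -[X]mulmx1 -DD' (mulmxA X) -XY !mulmxA D'D mul1mx.
Qed.

(** * The model is standard and spherical *)

Section EvenFamilyStandard.
Variables (R : realType) (Q : {poly R[i]}).
Local Notation C := R[i].
Local Notation O := {poly C}.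
Local Notation S := {mpoly O[2]}.
Local Notation M := (evenS R).

Lemma even_isotypical_iso l (rho : 'M[C]_3 -> 'M[C]_(l.*2.+1)) :
  is_W rho -> isotypical_iso (evenHC Q) rho.
Proof.
move=> rW; have [irr _] := rW; have [B [B' [BB' B'B E]]] := is_W_rhoW rW.
pose PB : 'M[O]_(l.*2.+1) := map_mx polyC B; pose PB' : 'M[O]_(l.*2.+1) := map_mx polyC B'.
have P1 : PB *m PB' = 1%:M.
  rewrite /PB /PB' -(map_mx1 (@polyC C)) -BB'; exact: esym (map_mxM (@polyC C) _ _).
have P2 := mulmx1C P1.
pose f (x : 'cV[O]_(l.*2.+1)) : M := emb (PB *m x).
have fl : linear f by move=> a x y; rewrite /f mulmxDr -scalemxAr emb_linear.
pose F : {linear 'cV[O]_(l.*2.+1) -> evenHC Q} :=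
  HB.pack (f : 'cV[O]_(l.*2.+1) -> evenHC Q) (GRing.isLinear.Build _ _ _ _
    (f : 'cV[O]_(l.*2.+1) -> evenHC Q) fl).
exists F; split.
- move=> x y /emb_inj/(congr1 (mulmx PB')); rewrite !mulmxA P2.
  by rewrite !mul1mx.
- move=> v; apply: (iff_trans (isotypical_emb irr BB' B'B E v)).
  split=> [[x ->]|[x ->]]; last by exists (PB *m x).
  by exists (PB' *m x); rewrite /= /f mulmxA P1 mul1mx.
move=> A kA x; rewrite /= /f [RHS]evenK_emb; congr emb.
rewrite !mulmxA; congr (_ *m x).
by apply: etrans (esym (map_mxM _ _ _)) _; rewrite E //; exact: map_mxM.
Qed.

Lemma even_isotypical_sum (v : evenHC Q) : exists m (u : 'I_m -> evenHC Q),
  v = \sum_(i < m) u i /\ forall i, exists l (rho : 'M[C]_3 -> 'M[C]_(l.*2.+1)),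
    is_W rho /\ isotypical (@hc_K R (evenHC Q)) rho (u i).
Proof.
elim/even_ind: v => [|u v [m [f [-> fP]]] [n [g [-> gP]]]|l c j].
- by exists 0, (fun=> 0); rewrite big_ord0; split=> // [[]].
- exists (m + n)%N, (fun i => match split i with inl i => f i | inr i => g i end).
  split=> [|i]; last by case: (split i).
  rewrite big_split_ord; congr (_ + _); apply: eq_bigr => i _.
    by rewrite (unsplitK (inl i)).
  by rewrite (unsplitK (inr i)).
exists 1, (fun=> c *: emb (delta_mx j 0)); rewrite big_ord1; split=> // _.
exists l, (rhoW l); split; first exact: rhoW_is_W.
apply/(isotypical_emb (rhoW_irreducible R l) (mul1mx 1%:M) (mul1mx 1%:M)) => [A kA|].
  by rewrite mulmx1 mul1mx.
by exists (c *: delta_mx j 0); rewrite (linZ (@emb_linear R l)).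
Qed.

Definition generated (F : HC_family R) (v : F) := exists m (u : 'I_m -> env R) (v0 : 'I_m -> F),
  (forall i, K_fixed (v0 i)) /\ v = \sum_(i < m) env_act (@hc_g R F) (u i) (v0 i).

Lemma generated_fixed (F : HC_family R) (v : F) : K_fixed v -> generated v.
Proof.
by move=> kv; exists 1, (fun=> EScalar 1), (fun=> v); rewrite big_ord1 /= scale1r.
Qed.

Lemma generated0 (F : HC_family R) : generated (0 : F).
Proof. by exists 0, (fun=> EScalar 0), (fun=> 0); rewrite big_ord0; split=> // [[]]. Qed.

Lemma generatedD (F : HC_family R) (v w : F) : generated v -> generated w -> generated (v + w).
Proof.
move=> [m [u [v0 [kv ->]]]] [n [u' [w0 [kw ->]]]].
exists (m + n)%N, (fun i => match split i with inl i => u i | inr i => u' i end),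
  (fun i => match split i with inl i => v0 i | inr i => w0 i end).
split=> [i|]; first by case: (split i).
rewrite big_split_ord; congr (_ + _); apply: eq_bigr => i _.
  by rewrite (unsplitK (inl i)).
by rewrite (unsplitK (inr i)).
Qed.

Lemma generatedZ (F : HC_family R) a (v : F) : generated v -> generated (a *: v).
Proof.
move=> [m [u [v0 [kv ->]]]]; exists m, (fun i => EMul (EScalar a) (u i)), v0.
by rewrite scaler_sumr.
Qed.

Lemma generated_g (F : HC_family R) x (v : F) : generated v -> generated (hc_g x v).
Proof.
move=> [m [u [v0 [kv ->]]]]; exists m, (fun i => EMul (EElt x) (u i)), v0.
by rewrite (lin_sum (@hc_g_linearr R F x)).
Qed.

Lemma monomial_qmul l (a b : nat) : (a + b = l.+1.*2)%N -> exists (w : 'cV[O]_3) k,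
  mdeg k = l.*2 /\ 'X_[mono a b] = qmul w * 'X_[k] :> S.
Proof.
case: a => [|[|a]] E.
- case: b E => [//|[//|b]] E; exists (delta_mx 2 0), (mono 0 b).
  rewrite mdeg_mono; split; first by move: E; lia.
  by rewrite qmul_delta !monoX !mul1r /= -exprD.
- case: b E => [//|b] E; exists (delta_mx 1 0), (mono 0 b).
  rewrite mdeg_mono; split; first by move: E; lia.
  by rewrite qmul_delta !monoX /= expr1 expr0 mul1r exprS mulrA.
exists (delta_mx 0 0), (mono a b).
rewrite mdeg_mono; split; first by move: E; lia.
by rewrite qmul_delta !monoX /= mulrA -exprD.
Qed.

(** A monomial of degree 2l + 2 is a quadratic monomial times one of degree 2l. The action of R_i
    produces this product up to a term of lower degree, which is generated by induction. *)
Lemma even_generated_homog l (v : evenHC Q) :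
  evenS_val v \is l.*2.-homog -> generated v.
Proof.
elim/ltn_ind: l v => l IH v hv; have [x ->] := homog_emb hv.
rewrite [x]cV_sum_delta (lin_sum (@emb_linear R l)).
elim/big_ind: _ => [|u w|j _]; [exact: generated0 | exact: generatedD |].
rewrite (linZ (@emb_linear R l)); apply: generatedZ.
case: l j IH {x hv v} => [|l] j IH.
  apply: generated_fixed => A kA; apply: evenS_eq.
  have E : evenS_val (emb (delta_mx j 0 : 'cV[O]_(0.*2.+1)) : M) = 1.
    by rewrite /= bform_delta (ord1 j) monoX !expr0 mulr1.
  apply: etrans (congr1 (subst (liftO A)) E) (etrans _ (esym E)); exact: rmorph1.
have jl : (j <= l.+1.*2)%N by rewrite -ltnS.
have [w [k [dk kE]]] := @monomial_qmul l (l.+1.*2 - j) j (subnK jl).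
have ek : 'X_[k] \in @even_mpoly R.
  by apply: (even_homog (d := l.*2)); [rewrite odd_double | rewrite -dk; exact: homog_monomial].
pose u : evenHC Q := EvenS ek.
have hk : evenS_val u \is l.*2.-homog by rewrite -dk; exact: homog_monomial.
have e2 : l.*2.-2 = l.-1.*2 by case: (l).
have od : ~~ odd l.*2.-2 by rewrite e2 odd_double.
pose u' : evenHC Q := EvenS (even_homog od (homog_qdiff w hk)).
have Gu : generated u by apply: (IH l).
have Gu' : generated u'.
  apply: (IH l.-1); first by rewrite ltnS leq_pred.
  by rewrite -e2; exact: homog_qdiff.
suff -> : emb (delta_mx j 0) = l.*2.+1%:R *: hc_g (lieR w) u - ladder_mu Q l.*2 *: u'.
  apply: generatedD; last by rewrite -scaleNr; apply: generatedZ.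
  by apply/generatedZ/generated_g.
apply: evenS_eq; rewrite (linB (@evenS_linear R)) !(linZ (@evenS_linear R)) /=.
rewrite bform_delta kE.
rewrite (act_lieR _ _ hk).
have cE := @ladder_cE R l.*2.
move: (qmul w * 'X_[k]) (qdiff w 'X_[k]) => x y.
by rewrite scalerA mulrC cE scale1r addrK.
Qed.

Lemma even_generated (v : evenHC Q) : generated v.
Proof.
elim/even_ind: v => [|u v|l c j]; [exact: generated0 | exact: generatedD |].
by apply: generatedZ; apply: (@even_generated_homog l); exact: bform_homog.
Qed.

Lemma evenHC_standard : standard_spherical (evenHC Q).
Proof.
split; [exact: even_isotypical_iso | exact: even_isotypical_sum | exact: even_generated].
Qed.

End EvenFamilyStandard.

(** * Spherical vectors *)

Section SphericalVector.
Variables (A : comNzRingType) (V : lmodType A) (e f h p z m : V -> V) (v0 : V) (T Q c : A).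
Hypotheses (fl : linear f) (hl : linear h).
Hypotheses (pl : linear p) (zl : linear z) (ml : linear m).
Hypothesis ef : forall x, e (f x) = f (e x) + h x.
Hypothesis ep : forall x, e (p x) = p (e x).
Hypothesis hp : forall x, h (p x) = p (h x) + 2 *: p x.
Hypothesis fp : forall x, f (p x) = p (f x) + 2 *: z x.
Hypothesis fz : forall x, f (z x) = z (f x) + m x.
Hypothesis fm : forall x, f (m x) = m (f x).
Hypothesis pz : forall x, p (z x) = z (p x) + T *: e x.
Hypothesis pm : forall x, p (m x) = m (p x) - T *: h x.
Hypothesis c4 : 4 * c = 1.
Hypothesis casimir : forall x, (4 * Q) *: x =
  - T *: (2 *: (e (f x) + f (e x)) + h (h x)) - 2 *: (2 *: z (z x) - p (m x) - m (p x)).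
Hypotheses (ev : e v0 = 0) (fv : f v0 = 0) (hv : h v0 = 0).

Definition sph_w l := iter l p v0.
Local Notation w := sph_w.

Lemma sph_e l : e (w l) = 0.
Proof. by elim: l => [//|l IH]; rewrite [w _]/= ep IH (lin0 pl). Qed.

Lemma sph_h l : h (w l) = (2 * l%:R) *: w l.
Proof.
elim: l => [|l IH]; first by rewrite hv mulr0 scale0r.
rewrite [w _]/= hp IH (linZ pl) -scalerDl; congr (_ *: _).
by rewrite -[l.+1]addn1 natrD; ring.
Qed.

Lemma sph_f l : f (w l.+1) = (2 * l.+1%:R) *: z (w l).
Proof.
elim: l => [|l IH]; first by rewrite /= fp fv (lin0 pl) add0r mulr1.
rewrite [w l.+2]/= fp IH (linZ pl) pz sph_e scaler0 addr0 -scalerDl; congr (_ *: _).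
by rewrite -[l.+2]addn1 natrD; ring.
Qed.

Lemma sph_m0 : m v0 = f (z v0).
Proof. by rewrite fz fv (lin0 zl) add0r. Qed.

(** Two relations between R_- w_(l+1) and R_0^2 w_l, one from the central value and one from f R_0
    w_(l+1), are solved for the former. *)
Lemma sph_m l :
  (2 * l%:R + 3) *: m (w l.+1) = f (z (w l.+1)) +
    (2 * l.+1%:R * (Q + T * (l%:R * (l%:R + 2)))) *: w l.
Proof.
have can4 x y : 4 *: x = 4 *: y -> x = y :> V.
  by move/(congr1 ( *:%R c)); rewrite !scalerA (mulrC c) c4 !scale1r.
(* The central value evaluated on w_l, with the weight 2l and e w_l = 0. *)
have E : m (w l.+1) = z (z (w l)) + (Q + T * (l%:R * (l%:R + 2))) *: w l.
  apply: can4; rewrite (scalerDl (w l) Q) !(scalerDr 4) (scalerA 4 Q) casimir.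
  rewrite ef sph_e (lin0 fl) add0r addr0 sph_h (linZ hl) sph_h pm sph_h.
  rewrite [p (w l)]/(w l.+1).
  move: (w l) (z (z (w l))) (m (w l.+1)) => x y t.
  lincomb x y t; ring.
rewrite fz sph_f (linZ zl).
have -> : z (z (w l)) = m (w l.+1) - (Q + T * (l%:R * (l%:R + 2))) *: w l.
  by rewrite E addrK.
move: (w l) (m (w l.+1)) => x y.
lincomb x y y; ring.
Qed.

(** By [sph_f], w_(l+1) reduces to R_0 w_l; moving n + 1 powers of f across R_0 costs only a term
    R_- f^n, since f commutes with R_-. *)
Lemma sph_f_nil l : iter l.*2.+1 f (w l) = 0.
Proof.
have fn n x : iter n.+1 f (z x) = z (iter n.+1 f x) + n.+1%:R *: m (iter n f x).
  elim: n x => [|n IH] x; first by rewrite /= fz scale1r.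
  apply: etrans (congr1 f (IH x)) _; rewrite (linD fl) (linZ fl) fz fm /=.
  by rewrite -addrA -(natr1 n.+1) (scalerDl _ n.+1%:R) scale1r [n.+1%:R *: _ + _]addrC.
elim: l => [|l IH]; first by rewrite /= fv.
rewrite doubleS iterSr sph_f.
have iZ n a x : iter n f (a *: x) = a *: iter n f x.
  by elim: n => //= n ->; rewrite (linZ fl).
by rewrite iZ (fn l.*2.+1) iterS IH (lin0 fl) (lin0 zl) (lin0 ml) scaler0 addr0 scaler0.
Qed.

End SphericalVector.

Section SphericalFamily.
Variables (R : realType) (F : HC_family R).
Local Notation C := R[i].
Local Notation O := {poly C}.

Lemma hc_comm x y (v : F) : hc_g x (hc_g y v) = hc_g y (hc_g x v) + hc_g (bracket x y) v.
Proof. by rewrite hc_g_bracket addrC subrK. Qed.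

Lemma hc_gD x y (v : F) : hc_g (x + y) v = hc_g x v + hc_g y v.
Proof. exact: (linD (@hc_g_linearl R F v)). Qed.

Lemma hc_gZ a x (v : F) : hc_g (a *: x) v = a *: hc_g x v.
Proof. exact: (linZ (@hc_g_linearl R F v)). Qed.

Lemma hc_g0 (v : F) : hc_g 0 v = 0.
Proof. exact: (lin0 (@hc_g_linearl R F v)). Qed.

Local Notation gE := (gE R). Local Notation gF := (gF R). Local Notation gH := (gH R).
Local Notation gP := (gP R). Local Notation gZ := (gZ R). Local Notation gM := (gM R).

Let ef (x : F) : hc_g gE (hc_g gF x) = hc_g gF (hc_g gE x) + hc_g gH x.
Proof. by rewrite hc_comm bracket_EF. Qed.

Let hf (x : F) : hc_g gH (hc_g gF x) = hc_g gF (hc_g gH x) - 2 *: hc_g gF x.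
Proof. by rewrite hc_comm bracket_HF hc_gZ scaleNr. Qed.

Variables (Q : O) (v0 : F).
Hypothesis valQ : TL2_R2_value F Q.
Hypotheses (ev : hc_g gE v0 = 0) (fv : hc_g gF v0 = 0).

Definition hw l := sph_w (hc_g gP) v0 l.

Lemma hwS l : hw l.+1 = hc_g gP (hw l). Proof. by []. Qed.

Let ep (x : F) : hc_g gE (hc_g gP x) = hc_g gP (hc_g gE x).
Proof. by rewrite hc_comm bracket_EP hc_g0 addr0. Qed.

Let hp (x : F) : hc_g gH (hc_g gP x) = hc_g gP (hc_g gH x) + 2 *: hc_g gP x.
Proof. by rewrite hc_comm bracket_HP hc_gZ. Qed.

Let fp (x : F) : hc_g gF (hc_g gP x) = hc_g gP (hc_g gF x) + 2 *: hc_g gZ x.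
Proof. by rewrite hc_comm bracket_FP hc_gZ. Qed.

Let fz (x : F) : hc_g gF (hc_g gZ x) = hc_g gZ (hc_g gF x) + hc_g gM x.
Proof. by rewrite hc_comm bracket_FZ. Qed.

Let fm (x : F) : hc_g gF (hc_g gM x) = hc_g gM (hc_g gF x).
Proof. by rewrite hc_comm bracket_FM hc_g0 addr0. Qed.

Let pz (x : F) : hc_g gP (hc_g gZ x) = hc_g gZ (hc_g gP x) + 'X *: hc_g gE x.
Proof. by rewrite hc_comm bracket_PZ hc_gZ. Qed.

Let pm (x : F) : hc_g gP (hc_g gM x) = hc_g gM (hc_g gP x) - 'X *: hc_g gH x.
Proof. by rewrite hc_comm bracket_PM hc_gZ scaleNr. Qed.

Let hv : hc_g gH v0 = 0.
Proof.
have := ef v0; rewrite ev fv (lin0 (@hc_g_linearr R F gE)) (lin0 (@hc_g_linearr R F gF)).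
by rewrite add0r.
Qed.

Let casimir (x : F) : (4 * Q) *: x =
  - 'X *: (2 *: (hc_g gE (hc_g gF x) + hc_g gF (hc_g gE x)) + hc_g gH (hc_g gH x))
  - 2 *: (2 *: hc_g gZ (hc_g gZ x) - hc_g gP (hc_g gM x) - hc_g gM (hc_g gP x)).
Proof.
rewrite -scalerA -valQ; apply: env_TL2_R2E; [exact: hc_g_linearr | exact: hc_g_linearl].
Qed.

Let gl x := @hc_g_linearr R F x.

Lemma hw_e l : hc_g gE (hw l) = 0.
Proof. exact: (sph_e (gl _) ep ev). Qed.

Lemma hw_h l : hc_g gH (hw l) = (2 * l%:R) *: hw l.
Proof. exact: (sph_h (gl _) hp hv). Qed.

Lemma hw_f l : hc_g gF (hw l.+1) = (2 * l.+1%:R) *: hc_g gZ (hw l).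
Proof. exact: (sph_f (gl _) ep fp pz ev fv). Qed.

Lemma hw_m0 : hc_g gM (hw 0) = hc_g gF (hc_g gZ (hw 0)).
Proof. exact: (sph_m0 (gl _) fz fv). Qed.

Lemma hw_m l : (2 * l%:R + 3) *: hc_g gM (hw l.+1) = hc_g gF (hc_g gZ (hw l.+1)) +
    (2 * l.+1%:R * (Q + 'X * (l%:R * (l%:R + 2)))) *: hw l.
Proof.
exact: (sph_m (gl _) (gl _) (gl _) (gl _) ef ep hp fp fz pz pm (halfp4 R) casimir ev fv hv).
Qed.

Lemma hw_f_nil l : iter l.*2.+1 (hc_g gF) (hw l) = 0.
Proof. exact: (sph_f_nil (gl _) (gl _) (gl _) (gl _) ep fp fz fm pz ev fv). Qed.

Lemma hw_raise l k : hc_g gE (iter k.+1 (hc_g gF) (hw l)) =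
  (k.+1%:R * (2 * l%:R - k%:R)) *: iter k (hc_g gF) (hw l).
Proof. exact: (raise_lower (gl _) hf ef (hw_e l) (hw_h l)). Qed.

End SphericalFamily.

(** * The model in terms of monomials *)

Section MonomialAction.
Variables (R : realType) (Q : {poly R[i]}).
Local Notation C := R[i].
Local Notation O := {poly C}.
Local Notation S := {mpoly O[2]}.
Local Notation gE := (gE R). Local Notation gF := (gF R). Local Notation gH := (gH R).
Local Notation gP := (gP R).

Lemma mderiv_mono0 a b : ('X_[mono a b] : S)^`M(0) = a%:R *: 'X_[mono a.-1 b].
Proof.
rewrite mderivX monoE0; case: a => [|a]; first by rewrite !scale0r.
congr (_ *: 'X_[_]); apply/mnmP => i; rewrite mnmBE mnm1E.
by elim/ord2P: i; rewrite ?monoE0 ?monoE1 /= ?subn1 ?subn0.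
Qed.

Lemma mderiv_mono1 a b : ('X_[mono a b] : S)^`M(1) = b%:R *: 'X_[mono a b.-1].
Proof.
rewrite mderivX monoE1; case: b => [|b]; first by rewrite !scale0r.
congr (_ *: 'X_[_]); apply/mnmP => i; rewrite mnmBE mnm1E.
by elim/ord2P: i; rewrite ?monoE0 ?monoE1 /= ?subn1 ?subn0.
Qed.

Lemma X0_mono a b : 'X_0 * 'X_[mono a b] = 'X_[mono a.+1 b] :> S.
Proof. by rewrite !monoX mulrA -exprS. Qed.

Lemma X1_mono a b : 'X_1 * 'X_[mono a b] = 'X_[mono a b.+1] :> S.
Proof. by rewrite !monoX mulrCA -exprS. Qed.

Lemma linform_mx2 (a b c d : O) :
  linform (mx2 a b c d) 0 = a *: 'X_0 + c *: 'X_1 :> S /\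
  linform (mx2 a b c d) 1 = b *: 'X_0 + d *: 'X_1 :> S.
Proof. by split; rewrite /linform sum2E !mxE. Qed.

Lemma der_mx2 (a b c d : O) (f : S) : der (mx2 a b c d) f =
  (a *: 'X_0 + c *: 'X_1) * f^`M(0) + (b *: 'X_0 + d *: 'X_1) * f^`M(1).
Proof. by rewrite /der sum2E; have [-> ->] := linform_mx2 a b c d. Qed.

Lemma act_gE a b : act Q gE 'X_[mono a b] = b%:R *: 'X_[mono a.+1 b.-1].
Proof.
rewrite act_lieL tau_gE der_mx2 mderiv_mono0 mderiv_mono1.
rewrite !scale0r addr0 mul0r add0r addr0 scale1r -scalerAr X0_mono.
by [].
Qed.

Lemma act_gF a b : act Q gF 'X_[mono a b] = a%:R *: 'X_[mono a.-1 b.+1].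
Proof.
rewrite act_lieL tau_gF der_mx2 mderiv_mono0 mderiv_mono1.
by rewrite !scale0r addr0 mul0r add0r addr0 scale1r -scalerAr X1_mono.
Qed.

Lemma act_gH a b : act Q gH 'X_[mono a b] = (a%:R - b%:R) *: 'X_[mono a b].
Proof.
rewrite act_lieL tau_gH der_mx2 mderiv_mono0 mderiv_mono1.
rewrite !scale0r addr0 add0r scale1r scaleN1r mulNr -!scalerAr scalerBl; congr (_ - _).
  by case: a => [|a]; [rewrite !scale0r | rewrite X0_mono].
by case: b => [|b]; [rewrite !scale0r | rewrite X1_mono].
Qed.

Lemma act_gP d : act Q gP 'X_[mono d 0] = ladder_c R d *: 'X_[mono d.+2 0].
Proof.
have hd : ('X_[mono d 0] : S) \is d.-homog.
  by have := homog_monomial O (mono d 0); rewrite mdeg_mono addn0.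
rewrite (act_lieR _ _ hd); congr (_ *: _).
rewrite qmul_delta qdiff_delta /= mderiv_mono1 scale0r mderiv0 scaler0 addr0.
by rewrite expr2 -mulrA !X0_mono.
Qed.

Definition evenX k : evenS R := insubd (0 : evenS R) ('X_[k] : S).

Lemma evenXE (k : 'X_{1..2}) : ~~ odd (mdeg k) -> evenS_val (evenX k) = 'X_[k].
Proof.
move=> ok; rewrite /evenX (val_insubd (0 : evenS R)) ifT //.
by apply: (even_homog ok); exact: homog_monomial.
Qed.

Lemma evenXm a b : ~~ odd (a + b) -> evenS_val (evenX (mono a b)) = 'X_[mono a b].
Proof. by move=> ok; apply: evenXE; rewrite mdeg_mono. Qed.

Local Notation M := (evenHC Q).

Lemma evenG_gE a b : ~~ odd (a + b) ->
  @hc_g R M gE (evenX (mono a b)) = b%:R *: evenX (mono a.+1 b.-1).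
Proof.
move=> ok; apply: evenS_eq; rewrite (linZ (@evenS_linear R)).
apply: etrans (congr1 (act Q gE) (evenXm ok)) _; rewrite act_gE.
case: b ok => [|b] ok; first by rewrite !scale0r.
by rewrite evenXm // addSnnS.
Qed.

Lemma evenG_gF a b : ~~ odd (a + b) ->
  @hc_g R M gF (evenX (mono a b)) = a%:R *: evenX (mono a.-1 b.+1).
Proof.
move=> ok; apply: evenS_eq; rewrite (linZ (@evenS_linear R)).
apply: etrans (congr1 (act Q gF) (evenXm ok)) _; rewrite act_gF.
case: a ok => [|a] ok; first by rewrite !scale0r.
by rewrite evenXm // -addSnnS.
Qed.

Lemma evenG_gH a b : ~~ odd (a + b) ->
  @hc_g R M gH (evenX (mono a b)) = (a%:R - b%:R) *: evenX (mono a b).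
Proof.
move=> ok; apply: evenS_eq; rewrite (linZ (@evenS_linear R)) evenXm //.
by apply: etrans (congr1 (act Q gH) (evenXm ok)) _; rewrite act_gH.
Qed.

Lemma evenG_gP d : ~~ odd d ->
  @hc_g R M gP (evenX (mono d 0)) = ladder_c R d *: evenX (mono d.+2 0).
Proof.
move=> ok; have ok0 : ~~ odd (d + 0) by rewrite addn0.
apply: evenS_eq; rewrite (linZ (@evenS_linear R)) evenXm ?addn0 //= ?negbK //.
by apply: etrans (congr1 (act Q gP) (evenXm ok0)) _; rewrite act_gP.
Qed.

Definition even1 : M := evenX (mono 0 0).

Lemma even1_gE : hc_g gE even1 = 0.
Proof. by rewrite evenG_gE // scale0r. Qed.

Lemma even1_gF : hc_g gF even1 = 0.
Proof. by rewrite evenG_gF // scale0r. Qed.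

(** The scalar relating f^b w_l to p^(2l-b) q^b in the model: the product comes from the l raisings
    by [gP], the falling factorial from the b lowerings. *)
Definition mono_coef l b : C := (\prod_(i < l) i.*2.+1%:R^-1) * (l.*2 ^_ b)%:R.

Lemma mono_coef_neq0 l b : (b <= l.*2)%N -> mono_coef l b != 0.
Proof.
move=> bl; rewrite mulf_neq0 // ?pnatr_eq0 -?lt0n ?ffact_gt0 //.
by apply/prodf_neq0 => i _; rewrite invr_eq0 pnatr_eq0.
Qed.

Lemma even_hw l b : (b <= l.*2)%N ->
  iter b (@hc_g R M gF) (hw even1 l) = (mono_coef l b)%:P *: evenX (mono (l.*2 - b) b).
Proof.
elim: b => [|b IH] bl; last first.
  rewrite iterS IH; last exact: ltnW.
  rewrite (linZ (@hc_g_linearr R M gF)) evenG_gF; last by rewrite subnK ?odd_double // ltnW.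
  rewrite scalerA -subnS; congr (_ *: _).
  by rewrite -polyC_natr -polyCM /mono_coef -mulrA -natrM ffactnSr.
rewrite subn0 /=; elim: l bl => [|l IH] _.
  by rewrite /mono_coef big_ord0 mul1r ffactn0 polyC1 scale1r.
rewrite hwS IH // (linZ (@hc_g_linearr R M gP)) evenG_gP ?odd_double // scalerA.
congr (_ *: _); rewrite /mono_coef /ladder_c -polyCM !ffactn0 !mulr1.
by rewrite big_ord_recr.
Qed.

Lemma evenHC_ind (P : M -> Prop) :
  (forall a u v, P u -> P v -> P (a *: u + v)) ->
  (forall l b, (b <= l.*2)%N -> P (iter b (hc_g gF) (hw even1 l))) -> forall v, P v.
Proof.
move=> PD PX; have P0 : P 0.
  by have := PD (-1) _ _ (PX 0%N 0%N isT) (PX 0%N 0%N isT); rewrite scaleN1r addNr.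
elim/even_ind => // [u v Pu Pv|l c j].
  by rewrite -[u]scale1r; apply: (PD _ _ _).
have jl : (j <= l.*2)%N by rewrite -ltnS.
have -> : emb (delta_mx j 0) = (mono_coef l j)^-1%:P *: iter j (@hc_g R M gF) (hw even1 l).
  rewrite even_hw // scalerA -polyCM mulVf ?mono_coef_neq0 // polyC1 scale1r.
  apply: evenS_eq; rewrite /= bform_delta evenXm // subnK // odd_double.
  by [].
rewrite scalerA -[_ *: _]addr0; apply: (PD _ _ _) => //; exact: PX.
Qed.

End MonomialAction.

(** * Comparison with the model *)

Section Comparison.
Variables (R : realType) (F : HC_family R) (Q : {poly R[i]}) (v0 : F).
Local Notation C := R[i].
Local Notation O := {poly C}.
Local Notation S := {mpoly O[2]}.
Local Notation gE := (gE R). Local Notation gF := (gF R). Local Notation gH := (gH R).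
Local Notation gP := (gP R). Local Notation gZ := (gZ R). Local Notation gM := (gM R).
Local Notation M := (evenHC Q).
Hypothesis valQ : TL2_R2_value F Q.
Hypotheses (ev : hc_g gE v0 = 0) (fv : hc_g gF v0 = 0).
Implicit Types (v : M).

(** Dividing by [mono_coef] makes f^b w_l in the model correspond to f^b w_l in the family. *)
Definition compare v : F := linext (fun k : 'X_{1..2} =>
  (mono_coef R (mdeg k)./2 (k 1%R))^-1%:P *: iter (k 1%R) (hc_g gF) (hw v0 (mdeg k)./2))
  (evenS_val v).

Lemma compare_linear : linear compare.
Proof. by move=> a u v; rewrite /compare evenS_linear linext_linear. Qed.

Let valM := @evenHC_value R Q.
Let e1 := even1_gE Q.
Let f1 := even1_gF Q.

Lemma compare_ladder l b : compare (iter b (hc_g gF) (hw (even1 Q) l)) = iter b (hc_g gF) (hw v0 l).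
Proof.
have [bl|bl] := leqP b l.*2; last first.
  have it0 (F' : HC_family R) (x : F') : iter l.*2.+1 (hc_g gF) x = 0 -> iter b (hc_g gF) x = 0.
    move=> E; rewrite -(subnK bl) iterD E.
    by elim: (_ - _)%N => //= n ->; exact: (lin0 (@hc_g_linearr R F' gF)).
  rewrite !it0; first exact: (lin0 compare_linear).
    exact: (hw_f_nil ev fv).
  exact: (hw_f_nil e1 f1).
rewrite even_hw // (linZ compare_linear) /compare evenXm ?subnK ?odd_double //.
rewrite linextX mdeg_mono subnK // monoE1 doubleK scalerA -polyCM.
by rewrite mulfV ?mono_coef_neq0 // polyC1 scale1r.
Qed.

Lemma compare_hw l : compare (hw (even1 Q) l) = hw v0 l.
Proof. exact: (compare_ladder l 0). Qed.

Lemma compare_gF v : compare (hc_g gF v) = hc_g gF (compare v).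
Proof.
elim/evenHC_ind: v => [a u v IHu IHv|l b _].
  by rewrite hc_g_linearr !compare_linear IHu IHv hc_g_linearr.
by rewrite -iterS !compare_ladder.
Qed.

(** R_0 w_l is f w_(l+1) divided by 2(l+1) in both families. *)
Lemma compare_gZ l : compare (hc_g gZ (hw (even1 Q) l)) = hc_g gZ (hw v0 l).
Proof.
apply: (@natO_cancel _ _ l.*2.+1); have -> : l.*2.+2%:R = 2 * l.+1%:R :> O.
  by rewrite -natrM mul2n.
rewrite -(linZ compare_linear) -(hw_f e1 f1) compare_gF compare_hw.
exact: (hw_f ev fv).
Qed.

Lemma compare_gM l : compare (hc_g gM (hw (even1 Q) l)) = hc_g gM (hw v0 l).
Proof.
case: l => [|l].
  rewrite (hw_m0 f1) compare_gF compare_gZ; exact/esym/(hw_m0 fv).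
apply: (@natO_cancel _ _ l.*2.+2); have -> : l.*2.+3%:R = 2 * l%:R + 3 :> O.
  by rewrite -natrM mul2n -natrD addn3.
rewrite -(linZ compare_linear) (hw_m valM e1 f1) (linD compare_linear) (linZ compare_linear).
by rewrite compare_gF compare_gZ compare_hw; exact/esym/(hw_m valQ ev fv).
Qed.

Lemma compare_g_hw l x : compare (hc_g x (hw (even1 Q) l)) = hc_g x (hw v0 l).
Proof.
elim/lie_ind: x => [a x y IHx IHy||||||].
- by rewrite !hc_gD !hc_gZ compare_linear IHx IHy.
- by rewrite (hw_e e1) (hw_e ev); exact: (lin0 compare_linear).
- by rewrite compare_gF compare_hw.
- by rewrite (hw_h e1 f1) (hw_h ev fv) (linZ compare_linear) compare_hw.
- by rewrite -!hwS compare_hw.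
- exact: compare_gZ.
exact: compare_gM.
Qed.

(** Known on the w_l by [compare_g_hw], it extends along f-strings because x f = f x + [x, f], with
    the induction on b run for all x at once. *)
Lemma compare_g x v : compare (hc_g x v) = hc_g x (compare v).
Proof.
elim/evenHC_ind: v x => [a u v IHu IHv x|l b _].
  by rewrite hc_g_linearr !compare_linear IHu IHv hc_g_linearr.
elim: b => [|b IH] x; first by rewrite compare_hw compare_g_hw.
rewrite iterS hc_comm (linD compare_linear) !compare_gF !IH.
by rewrite [RHS]hc_comm.
Qed.

End Comparison.

(** * From the g-action to the K-action *)

Section Transport.
Variable R : realType.
Local Notation C := R[i].
Local Notation O := {poly C}.

Lemma env_act_morph (F1 F2 : HC_family R) (phi : F1 -> F2) u v : linear phi ->
  (forall x v, phi (hc_g x v) = hc_g x (phi v)) ->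
  phi (env_act (@hc_g R F1) u v) = env_act (@hc_g R F2) u (phi v).
Proof.
move=> pl pg; elim: u v => [p|x|u IHu w IHw|u IHu w IHw] v /=.
- exact: linZ.
- exact: pg.
- by rewrite (linD pl) IHu IHw.
by rewrite IHu IHw.
Qed.

(* On SO(3) a K-action is recovered from the g-action by exponentiating the   *)
(* nilpotent elements; -1 acts trivially.                                     *)
Lemma g_morph_K (F1 F2 : HC_family R) (phi : F1 -> F2) : linear phi ->
  (forall x v, phi (hc_g x v) = hc_g x (phi v)) ->
  (forall v : F1, hc_K (- 1%:M) v = v) -> (forall v : F2, hc_K (- 1%:M) v = v) ->
  forall A, inK A -> forall v, phi (hc_K A v) = hc_K A (phi v).
Proof.
move=> pl pg n1 n2.
have nilK m z v : nil2 m -> phi (hc_K (one_par m z) v) = hc_K (one_par m z) (phi v).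
  move=> nm; pose L : cmod F1 -> cmod F2 := phi.
  have Ll : linear L by move=> a x y; exact: pl.
  have c1 := curve_linear Ll (hc_exp v nm); have c2 := hc_exp (phi v) nm.
  apply: (curve_coef_eq c1 c2 _ z) => j; rewrite (linZ Ll); congr (_ *: _).
  by elim: j => [//|j IH]; rewrite [LHS]pg; congr hc_g.
move=> A; elim/orth_ind => {A} [v|z v|z v|A B kA kB IHA IHB v].
- by rewrite n1 n2.
- by rewrite -one_par_up; apply/nilK/nil2_E12.
- by rewrite -one_par_lo; apply/nilK/nil2_E21.
by rewrite !hc_KM // IHA IHB.
Qed.

(** The orbit curve of a fixed vector is constant, so its linear coefficient vanishes. *)
Lemma fixed_gk (F : HC_family R) (v : F) m : nil2 m -> K_fixed v -> hc_g (gk m) v = 0.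
Proof.
move=> nm kv.
have c0 : curve (fun z => hc_K (one_par m z) v : cmod F)
    (fun j => if j is 0 then v : cmod F else 0).
  exists 1; split=> [[|j]//|z]; rewrite big_ord1 scale1r.
  by apply: kv; exact: one_par_orth.
have := curve_uniq (hc_exp v nm) c0 1; rewrite /= => E.
by have := E; rewrite invr1 cscaleE polyC1 scale1r.
Qed.

Lemma gk_pair (m : 'M[C]_2) : gk m = (\col_i - (sl2_coord m i)%:P, 0).
Proof.
rewrite /gk [LHS]surjective_pairing fst_sum snd_sum; congr (_, _); last first.
  by apply: big1 => i _; rewrite /= oppr0 scaler0.
apply/colP => i; rewrite summxE [RHS]mxE (bigD1 i isT) big1 => [|j ji].
  by rewrite [LHS]addr0 !mxE !eqxx mulrN mulr1.
by rewrite !mxE eq_sym (negbTE ji) oppr0 mulr0.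
Qed.

Lemma gk_E12 : gk (E12 C) = gE R.
Proof.
have J2 := JpE R; rewrite gk_pair; unfold gE, lieL, quadO; congr (_, _); apply/colP => i.
rewrite [RHS]mulmx_sum3 !mxE /sl2_coord /E12.
elim/ord3P: i; rewrite /= ?mxE /= ?subr0 ?sub0r ?addr0 ?add0r ?(polyCN, polyCM, polyC1, polyC0)
  -?/(Jp R); ring: J2.
Qed.

Lemma gk_E21 : gk (E21 C) = gF R.
Proof.
have J2 := JpE R; rewrite gk_pair; unfold gF, lieL, quadO; congr (_, _); apply/colP => i.
rewrite [RHS]mulmx_sum3 !mxE /sl2_coord /E21.
elim/ord3P: i; rewrite /= ?mxE /= ?subr0 ?sub0r ?addr0 ?add0r ?(polyCN, polyCM, polyC1, polyC0)
  -?/(Jp R); ring: J2.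
Qed.

Lemma free_torsion (F : lmodType O) : free_module F ->
  forall a (v : F), a != 0 -> a *: v = 0 -> v = 0.
Proof.
move=> [I [b [gen ind]]] a v a0; have [s [c ->]] := gen v.
(* The generating clause of [free_module] allows repeated indices, while independence needs them
   distinct; repetitions become multiplicities. *)
have -> : \sum_(i <- s) c i *: b i = \sum_(i <- undup s) ((count_mem i s)%:R * c i) *: b i.
  rewrite -big_undup_iterop_count; apply: eq_bigr => i _.
  by rewrite -scalerA scaler_nat.
rewrite scaler_sumr; under eq_bigr => i _ do rewrite scalerA.
move/(ind _ _ (undup_uniq s)) => E; rewrite big_seq big1 // => i /E/eqP.
by rewrite mulf_eq0 (negbTE a0) => /eqP ->; rewrite scale0r.
Qed.

Lemma hc_iso_sym (F1 F2 : HC_family R) : hc_iso F1 F2 -> hc_iso F2 F1.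
Proof.
move=> [f [[g gf fg] fK fG]].
have gl : linear g by move=> a x y; apply: (can_inj gf); rewrite fg linearP !fg.
pose G : {linear F2 -> F1} := HB.pack (g : F2 -> F1)
  (GRing.isLinear.Build _ _ _ _ (g : F2 -> F1) gl).
exists G.
split=> [|A kA v|x v] /=; first by exists f.
  by apply: (can_inj gf); rewrite fK // !fg.
by apply: (can_inj gf); rewrite fG !fg.
Qed.

Lemma hc_iso_trans (F1 F2 F3 : HC_family R) : hc_iso F1 F2 -> hc_iso F2 F3 -> hc_iso F1 F3.
Proof.
move=> [f [bf fK fG]] [g [bg gK gG]]; exists (g \o f).
split=> [|A kA v|x v] /=; first exact: bij_comp.
  by rewrite fK // gK.
by rewrite fG gG.
Qed.

End Transport.

(** * Fixed and lowest weight vectors of a standard family *)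

Section SphericalStructure.
Variables (R : realType) (F : HC_family R).
Local Notation C := R[i].
Local Notation O := {poly C}.
Hypothesis st : standard_spherical F.

Lemma standard_KN1 (v : F) : hc_K (- 1%:M) v = v.
Proof.
have [_ sp _] := st; have [m [u [-> uP]]] := sp v.
have Kl : linear (hc_K (- 1%:M) : F -> F) by exact/hc_K_linear/inKN1.
rewrite (lin_sum Kl); apply: eq_bigr => i _.
have [l [rho [[_ rN] [n [phi [w [phiP ->]]]]]]] := uP i.
rewrite (lin_sum Kl); apply: eq_bigr => j _.
by have [_ pK] := phiP j; rewrite -(pK _ (inKN1 R)) rN mul1mx.
Qed.

Lemma rhoW0 (A : 'M[C]_3) : rhoW 0 A = 1%:M.
Proof.
apply: mulmx_inj => x; rewrite mul1mx; apply: bform_inj; rewrite -subst_bform.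
have -> : bform x = (x 0 0)%:MP.
  by rewrite /bform big_ord1 monoX !expr0 mulr1 -mul_mpolyC mulr1.
exact: substC.
Qed.

Lemma standard_fixed : exists v0 : F, [/\ v0 != 0, K_fixed v0 &
  forall v, K_fixed v -> exists a, v = a *: v0].
Proof.
have [iso _ _] := st; have [f [finj fiso fK]] := iso 0%N _ (rhoW_is_W R 0).
exists (f (const_mx 1)); split.
- apply/eqP => f0; have : const_mx 1 = 0 :> 'cV[O]_(0.*2.+1).
    by apply: finj; rewrite f0 linear0.
  by move/matrixP/(_ 0 0); rewrite !mxE => /eqP; rewrite oner_eq0.
- move=> A kA; rewrite -fK // rhoW0; congr (f _).
  by rewrite (map_mx1 (@polyC C)) mul1mx.
move=> v kv; have /fiso[x ->] : isotypical (@hc_K R F) (@rhoW R 0) v.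
  (* A fixed vector is the image of the trivial representation W_0 under an intertwiner. *)
  exists 1, (fun _ w => (w 0 0)%:P *: v), (fun=> const_mx 1).
  rewrite big_ord1 mxE polyC1 scale1r; split=> // _.
  split=> [a w w'|A kA w]; first by rewrite !mxE polyCD polyCM scalerDl scalerA.
  by rewrite rhoW0 mul1mx (linZ (hc_K_linear kA)) kv.
exists (x 0 0); rewrite -linearZ; congr (f _).
by apply/matrixP => i j; rewrite !ord1 !mxE mulr1.
Qed.

(* The lowest weight vector of the l-isotypical component is reached from its *)
(* highest weight vector by 2 l lowerings.                                    *)
Lemma standard_lower_neq0 l : exists v : F, iter l.*2 (hc_g (gF R)) v != 0.
Proof.
have [iso _ _] := st; have [f [finj _ fK]] := iso l _ (rhoW_is_W R l).
pose d j : 'cV[O]_(l.*2.+1) := delta_mx j 0.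
exists (f (d 0)); apply/eqP => it0.
pose L (x : 'cV[C]_(l.*2.+1)) : cmod F := f (map_mx polyC x).
have Ll : linear L.
  move=> a x y; rewrite /L cscaleE -linearP; congr (f _).
  by apply/matrixP => i j; rewrite !mxE polyCD polyCM.
have Ld j : L (delta_mx j 0) = f (d j).
  congr (f _); apply/matrixP => i k; rewrite !mxE.
  by case: (_ && _); rewrite ?polyC1 ?polyC0.
have c1 := hc_exp (f (d 0)) (nil2_E21 C); rewrite gk_E21 in c1.
pose u j : 'cV[C]_(l.*2.+1) := 'C(l.*2, j)%:R *: delta_mx (inord j) 0.
have c2 : curve (fun z => hc_K (one_par (E21 C) z) (f (d 0)) : cmod F) (fun j => L (u j)).
  apply: (@curve_ext _ _ (fun z => L (subrep l.*2 (lo z) *m delta_mx 0 0))) => [z|].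
    rewrite -fK; last exact/one_par_orth/nil2_E21.
    rewrite one_par_lo rhoW_Ad ?det_lo // /L; congr (f _).
    apply: etrans (map_mxM (@polyC C) _ _) _; congr (_ *m _).
    by apply/matrixP => i k; rewrite !mxE; case: (_ && _); rewrite ?polyC1 ?polyC0.
  apply: (curve_linear Ll); exists l.*2.+1; split=> [j jl|z].
    by rewrite /u bin_small // scale0r.
  by rewrite subrep_lo_delta subn0.
(* The coefficient of z^(2l) is a multiple of f^(2l) v in one expansion and the lowest basis vector
   in the other. *)
have := curve_uniq c1 c2 l.*2; rewrite it0 scaler0 /u binn scale1r Ld.
move/esym => E; have : d (inord l.*2) = 0 by apply: finj; rewrite E linear0.
by move/matrixP/(_ (inord l.*2) 0); rewrite !mxE !eqxx => /eqP; rewrite oner_eq0.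
Qed.

End SphericalStructure.

(** * Diagonal operators separating the monomials *)

Section DiagonalOperators.
Variables (R : realType) (Q : {poly R[i]}).
Local Notation C := R[i].
Local Notation O := {poly C}.
Local Notation M := (evenHC Q).
Implicit Types (k : 'X_{1..2}) (v : M).

Lemma natO_inj m n : m%:R = n%:R :> O -> m = n.
Proof. by rewrite -!polyC_natr => /polyC_inj/eqP; rewrite eqr_nat => /eqP. Qed.

Lemma diagonal_coef (L : M -> M) (c : 'X_{1..2} -> O) : linear L ->
  (forall k, ~~ odd (mdeg k) -> L (evenX R k) = c k *: (evenX R k : M)) ->
  forall v k, (evenS_val (L v))@_k = c k * (evenS_val v)@_k.
Proof.
move=> Ll LX v k; elim/even_ind: v => [|u v IHu IHv|l a j].
- by rewrite (lin0 Ll) !mcoeff0 mulr0.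
- by rewrite (linD Ll) !(linD (@evenS_linear R)) !mcoeffD IHu IHv mulrDr.
have jl : (j <= l.*2)%N by rewrite -ltnS.
have dk : mdeg (mono (l.*2 - j) j) = l.*2 by rewrite mdeg_mono subnK.
have -> : emb (delta_mx j 0) = evenX R (mono (l.*2 - j) j).
  by apply: evenS_eq; rewrite /= bform_delta evenXE // dk odd_double.
rewrite (linZ Ll) LX ?dk ?odd_double // !(linZ (@evenS_linear R)) !mcoeffZ.
rewrite evenXE ?dk ?odd_double //.
rewrite mcoeffX; have [->|_] := eqVneq; last by rewrite !mulr0.
by rewrite mulrCA.
Qed.

Definition weight_eigen k : O := (k 0%R)%:R - (k 1%R)%:R.
Definition casimir_eigen k : O := ((k 1%R) * (k 0%R).+1)%:R.

Lemma coef_gH v k : (evenS_val (hc_g (gH R) v))@_k = weight_eigen k * (evenS_val v)@_k.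
Proof.
apply: diagonal_coef => {k v}[|k ok]; first exact: hc_g_linearr.
have := @evenG_gH R Q (k 0%R) (k 1%R); rewrite -mono_eta; apply.
by rewrite -mdeg_mono -mono_eta.
Qed.

Lemma coef_gFE v k : (evenS_val (hc_g (gF R) (hc_g (gE R) v)))@_k =
  casimir_eigen k * (evenS_val v)@_k.
Proof.
apply: (@diagonal_coef (fun v => hc_g (gF R) (hc_g (gE R) v))) => {k v}[|k ok].
  by move=> a u v; rewrite !hc_g_linearr.
rewrite {1}[k]mono_eta /casimir_eigen; move: ok; rewrite {1}[k]mono_eta mdeg_mono.
have -> : evenX R k = evenX R (mono (k 0%R) (k 1%R)) by rewrite -mono_eta.
move: (k 0%R) (k 1%R) => a b ok; rewrite evenG_gE // (linZ (@hc_g_linearr R M (gF R))).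
case: b ok => [|b] ok; first by rewrite mul0n !scale0r.
by rewrite evenG_gF ?addSnnS // scalerA -natrM.
Qed.

(** With a - b fixed, the eigenvalue b (a + 1) of f e on p^a q^b is strictly increasing in b. *)
Lemma eigen_separate k k' : weight_eigen k = weight_eigen k' ->
  casimir_eigen k = casimir_eigen k' -> k = k'.
Proof.
rewrite /weight_eigen /casimir_eigen => /eqP; rewrite subr_eq addrAC eq_sym subr_eq.
rewrite -!natrD => /eqP/natO_inj E1 /natO_inj E2.
rewrite [k]mono_eta [k']mono_eta; move: E1 E2.
move: (k 0%R) (k 1%R) (k' 0%R) (k' 1%R) => a b a' b' E1 E2.
by suff [-> ->] : a = a' /\ b = b' by []; nia.
Qed.

(* The eigenvalues of h and f e together separate the monomials, so as long as *)
(* an element of P has two monomials one of them can be removed.              *)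
Lemma stable_monomial (P : M -> Prop) :
  (forall a u v, P u -> P v -> P (a *: u + v)) ->
  (forall x v, P v -> P (hc_g x v)) ->
  forall v, v != 0 -> P v -> exists a k, [/\ a != 0, ~~ odd (mdeg k) & P (a *: (evenX R k : M))].
Proof.
move=> PD Pg v; have [n] := ubnP (size (msupp (evenS_val v))).
elim: n v => // n IH v sv v0 Pv.
have [k kv] : exists k, k \in msupp (evenS_val v).
  case E: (msupp (evenS_val v)) => [|k s]; last by exists k; rewrite mem_head.
  by case/eqP: v0; apply: evenS_eq; apply/eqP; rewrite -msupp_eq0 E.
have ok : ~~ odd (mdeg k) by have /even_mpolyP := evenSP v; apply.
have [/hasP[k' k'v /= kk']|/hasPn one] := boolP (has (predC1 k) (msupp (evenS_val v))); last first.
  exists (evenS_val v)@_k, k; split=> //; first by rewrite -mcoeff_msupp.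
  suff -> : (evenS_val v)@_k *: (evenX R k : M) = v by [].
  apply: evenS_eq; rewrite (linZ (@evenS_linear R)) evenXE // [RHS]mpolyE.
  rewrite (big_rem k kv) /= big_seq big1 ?addr0 // => j.
  rewrite mem_rem_uniq // => /andP[jk /one]; by rewrite /= (negbTE jk).
have step (D : M -> M) (c : 'X_{1..2} -> O) :
    (forall v k, (evenS_val (D v))@_k = c k * (evenS_val v)@_k) ->
    P (D v) -> c k != c k' -> exists a k, [/\ a != 0, ~~ odd (mdeg k) & P (a *: (evenX R k : M))].
  (* This combination loses the monomial k' but keeps k. *)
  move=> DE PDv ck; pose u : M := (- c k') *: v + D v.
  have uE j : (evenS_val u)@_j = (c j - c k') * (evenS_val v)@_j.
    rewrite evenS_linear mcoeffD mcoeffZ DE; ring.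
  apply: (IH u); last exact: PD.
    rewrite -ltnS; apply: leq_ltn_trans sv.
    apply: (@uniq_leq_size _ (k' :: msupp (evenS_val u))) => [|j].
      rewrite /= msupp_uniq andbT mcoeff_msupp uE subrr mul0r eqxx //.
    rewrite inE => /orP[/eqP -> //|]; rewrite !mcoeff_msupp uE.
    by apply: contra => /eqP ->; rewrite mulr0.
  apply: contraTneq kv => u0; rewrite mcoeff_msupp negbK.
  have := uE k; rewrite u0 mcoeff0 => /esym/eqP; rewrite mulf_eq0 subr_eq0 (negbTE ck).
  by [].
have [E1|] := eqVneq (weight_eigen k) (weight_eigen k'); last first.
  by apply: (step _ _ coef_gH); apply: Pg.
have [E2|] := eqVneq (casimir_eigen k) (casimir_eigen k'); last first.
  by apply: (step _ _ coef_gFE); exact: (Pg _ _ (Pg _ _ Pv)).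
by move: kk'; rewrite (eigen_separate E1 E2) eqxx.
Qed.

End DiagonalOperators.

(** * Uniqueness: every standard family is the model *)

Section Uniqueness.
Variables (R : realType) (F : HC_family R) (Q : {poly R[i]}).
Local Notation C := R[i].
Local Notation O := {poly C}.
Local Notation gE := (gE R). Local Notation gF := (gF R).
Local Notation M := (evenHC Q).
Hypotheses (st : standard_spherical F) (valQ : TL2_R2_value F Q).

Lemma iter0_ge (F' : HC_family R) m n (x : F') : (m <= n)%N ->
  iter m (hc_g gF) x = 0 -> iter n (hc_g gF) x = 0.
Proof.
move=> mn E; rewrite -(subnK mn) iterD E.
by elim: (_ - _)%N => //= j ->; exact: (lin0 (@hc_g_linearr R F' gF)).
Qed.

Section FixedVector.
Variable v0 : F.
Hypotheses (kv0 : K_fixed v0) (gen : forall v, K_fixed v -> exists a, v = a *: v0).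

Let ev : hc_g gE v0 = 0.
Proof. by rewrite -gk_E12; apply: fixed_gk kv0; exact: nil2_E12. Qed.

Let fv : hc_g gF v0 = 0.
Proof. by rewrite -gk_E21; apply: fixed_gk kv0; exact: nil2_E21. Qed.

Local Notation Phi := (@compare R F Q v0).
Let Pl := @compare_linear R F Q v0.
Let Pg := @compare_g R F Q v0 valQ ev fv.

Lemma compare_surj v : exists u, Phi u = v.
Proof.
have [_ _ sp] := st; have [m [u [w [wK ->]]]] := sp v.
pose a i := sval (boolp.cid (gen (wK i))).
have aE i : w i = a i *: v0 by rewrite /a; case: boolp.cid.
exists (\sum_(i < m) env_act (@hc_g R M) (u i) (a i *: even1 Q)).
rewrite (lin_sum Pl); apply: eq_bigr => i _.
rewrite (env_act_morph _ _ Pl Pg) aE (linZ Pl); congr (env_act _ _ (_ *: _)).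
exact: (compare_hw Q ev fv 0).
Qed.

(** If w_l = 0 then w_j = 0 for all j >= l, while f^(2l) already kills the strings of w_j with j <
    l. By surjectivity f^(2l) would vanish on the whole family, against [standard_lower_neq0]. *)
Lemma hw_neq0 l : hw v0 l != 0.
Proof.
apply/eqP => w0; have [v /eqP[]] := standard_lower_neq0 st l.
have [u <-] := compare_surj v; elim/evenHC_ind: u => [a x y IHx IHy|j b bj].
  have iL n : linear (iter n (hc_g gF) : F -> F).
    elim: n => //= n IH c x' y'.
    apply: etrans (congr1 (hc_g gF) (IH c x' y')) _; exact: hc_g_linearr.
  by rewrite Pl iL IHx IHy scaler0 addr0.
rewrite (compare_ladder Q ev fv) -iterD; have [jl|lj] := ltnP j l.
  apply: iter0_ge (hw_f_nil ev fv j).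
  by rewrite (leq_trans _ (leq_addr _ _)) // ltn_double.
have -> : hw v0 j = 0.
  rewrite -(subnK lj); elim: (_ - _)%N => [//|n IH].
  by rewrite addSn hwS IH; exact: (lin0 (@hc_g_linearr R F _)).
by apply: (@iter0_ge F 0).
Qed.

(** Raising back multiplies by (b+1)(2l-b), which is nonzero for b < 2l, and the module is torsion
    free. *)
Lemma lower_hw_neq0 l b : (b <= l.*2)%N -> iter b (hc_g gF) (hw v0 l) != 0.
Proof.
elim: b => [|b IH] bl; first exact: hw_neq0.
apply: contraNneq (IH (ltnW bl)) => E; apply/eqP.
apply: (free_torsion (@hc_free R F) (a := b.+1%:R * (2 * l%:R - b%:R))).
  rewrite -natrM -natrB ?mul2n 1?ltnW // -natrM; apply/eqP => /(@natO_inj _ _ 0%N).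
  by move/eqP; rewrite muln_eq0 /= subn_eq0 leqNgt bl.
rewrite -(hw_raise ev fv) E; exact: (lin0 (@hc_g_linearr R F _)).
Qed.

(** The kernel is a g-submodule, so if nonzero it contains a multiple of a monomial; its image is a
    nonzero multiple of some f^b w_l with b at most 2l. *)
Lemma compare_inj : injective Phi.
Proof.
move=> x y E; apply/eqP; rewrite -subr_eq0; apply/negPn/negP => xy.
have ND a u v : Phi u = 0 -> Phi v = 0 -> Phi (a *: u + v) = 0.
  by move=> u0 v0'; rewrite Pl u0 v0' scaler0 addr0.
have Ng z v : Phi v = 0 -> Phi (hc_g z v) = 0.
  by move=> v0'; rewrite Pg v0'; exact: (lin0 (@hc_g_linearr R F _)).
have Nxy : Phi (x - y) = 0 by rewrite (linB Pl) E subrr.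
have [a [k [a0 ok]]] := @stable_monomial R Q (fun v => Phi v = 0) ND Ng _ xy Nxy.
rewrite (linZ Pl) /compare evenXE // linextX scalerA => /(free_torsion (@hc_free R F)).
have dk : (mdeg k)./2.*2 = mdeg k by rewrite -[RHS]odd_double_half (negbTE ok).
have kl : (k 1%R <= (mdeg k)./2.*2)%N by rewrite dk mdegE sum2E leq_addl.
move=> H; have := lower_hw_neq0 kl; rewrite H ?eqxx //.
by rewrite mulf_neq0 // polyC_eq0 invr_eq0 mono_coef_neq0.
Qed.

End FixedVector.

Lemma standard_iso_even : hc_iso M F.
Proof.
have [v0 [_ kv0 gen]] := standard_fixed st.
have ev : hc_g gE v0 = 0 by rewrite -gk_E12; apply: fixed_gk kv0; exact: nil2_E12.
have fv : hc_g gF v0 = 0 by rewrite -gk_E21; apply: fixed_gk kv0; exact: nil2_E21.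
have Pl := @compare_linear R F Q v0.
have Pg := compare_g valQ ev fv.
pose f : {linear M -> F} := HB.pack (@compare R F Q v0 : M -> F)
  (GRing.isLinear.Build _ _ _ _ (@compare R F Q v0 : M -> F) Pl).
exists f; split; last exact: Pg.
  have inj := compare_inj kv0 gen.
  pose g v := sval (boolp.cid (compare_surj kv0 gen v)).
  have fg : cancel g f by move=> v; rewrite /g; case: boolp.cid.
  by exists g => // x; apply: inj; rewrite [LHS]fg.
apply: (g_morph_K (phi := f) Pl Pg); last exact: standard_KN1.
exact: evenK_N1.
Qed.

End Uniqueness.

Theorem theorem3p4p4 (R : realType) :
  (forall (F1 F2 : HC_family R) (Q : {poly R[i]}),
     standard_spherical F1 -> standard_spherical F2 ->
     TL2_R2_value F1 Q -> TL2_R2_value F2 Q -> hc_iso F1 F2) /\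
  (forall Q : {poly R[i]}, exists F : HC_family R,
     standard_spherical F /\ TL2_R2_value F Q).
Proof.
split=> [F1 F2 Q s1 s2 q1 q2|Q].
  exact: (hc_iso_trans (hc_iso_sym (standard_iso_even s1 q1)) (standard_iso_even s2 q2)).
by exists (evenHC Q); split; [exact: evenHC_standard | exact: evenHC_value].
Qed.
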